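(* Define the formal series $${\cal K}_A(x;y;q,t)=\sum_{\eta\in\mathbb{N}^n}\frac{d_\eta(q,t)}{d'_\eta(q,t)\,e_\eta(q,t)}\,E_\eta(x;q,t)\,E_\eta(y;q^{-1},t^{-1}).$$ Then: (a) for $1\le i\le n-1$, $(T_i)^{(x)}{\cal K}_A=\bigl(\overline{T_i^{-1}}\bigr)^{(y)}{\cal K}_A$ and $(T_i^{-1})^{(x)}{\cal K}_A=\bigl(\overline{T_i}\bigr)^{(y)}{\cal K}_A$; (b) $\widehat{\Phi}_q^{(x)}{\cal K}_A=\bigl(\overline{\Phi_q}\bigr)^{(y)}{\cal K}_A$; (c) for $1\le i\le n$, $D_i^{(x)}{\cal K}_A=y_i\,{\cal K}_A$.
   Context: Let $n\ge1$, $q,t$ generic parameters; operators act on (Laurent) polynomials or formal series in $x=(x_1,\dots,x_n)$ and $y=(y_1,\dots,y_n)$ over $\mathbb{Q}(q,t)$, termwise on series; superscript $(x)$/$(y)$ indicates the variables acted on. Let $s_i$ interchange the $i$-th and $(i+1)$-th variables, $(\tau_if)(x)=f(x_1,\dots,qx_i,\dots,x_n)$, $T_i=t+\frac{tx_i-x_{i+1}}{x_i-x_{i+1}}(s_i-1)$ (invertible, $T_i^{-1}=t^{-1}-1+t^{-1}T_i$), $\omega=s_{n-1}\cdots s_1\tau_1$, $Y_i=t^{-n+i}T_i\cdots T_{n-1}\,\omega\,T_1^{-1}\cdots T_{i-1}^{-1}$, $T_{ij}^{-1}=T_i^{-1}\cdots T_{j-2}^{-1}T_{j-1}^{-1}T_{j-2}^{-1}\cdots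 T_i^{-1}$ ($i<j$), $D_i=x_i^{-1}\bigl(1-t^{n-1}[1+(t^{-1}-1)\sum_{j=i+1}^n t^{j-i}T_{ij}^{-1}]Y_i\bigr)$, $\Phi_q=x_nT_{n-1}^{-1}\cdots T_1^{-1}$, $\widehat{\Phi}_q=T_1\cdots T_{n-1}D_n$. For an operator $A$, $\overline{A}$ is obtained by replacing $q\mapsto q^{-1}$, $t\mapsto t^{-1}$. Nonsymmetric Macdonald polynomials: for $\eta\in\mathbb{N}^n$, $x^\eta=\prod x_i^{\eta_i}$, $\eta^+$ the decreasing rearrangement; for $\nu\ne\eta$, $\nu\prec\eta$ iff $\nu^+<\eta^+$, or $\nu^+=\eta^+$ and $\nu<\eta$, where $\nu<\eta$ means $\sum_{i=1}^p(\eta_i-\nu_i)\ge0$ for all $p$. With $t^\alpha=q$ and $\bar\eta_i=\alpha\eta_i-\#\{k<i:\eta_k\ge\eta_i\}-\#\{k>i:\eta_k>\eta_i\}$, $E_\eta(x;q,t)$ is the unique polynomial $x^\eta+\sum_{\nu\prec\eta}b_{\eta\nu}x^\nu$ with $Y_iE_\eta=t^{\bar\eta_i}E_\eta$ for all $i$. Constants: for a node $s=(i,j)$ of $\eta$ ($1\le j\le\eta_i$) let $a(s)=\eta_i-j$, $a'(s)=j-1$, $l(s)=\#\{k>i:j\le\eta_k\le\eta_i\}+\#\{k<i:j\le\eta_k+1\le\eta_i\}$, $l'(s)=\#\{k>i:\eta_k>\eta_i\}+\#\{k<i:\eta_k\ge\eta_i\}$. Then $d_\eta=\prod_{s}(1-q^{a(s)+1}t^{l(s)+1})$,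 $d'_\eta=\prod_s(1-q^{a(s)+1}t^{l(s)})$, $e_\eta=\prod_s(1-q^{a'(s)+1}t^{n-l'(s)})$. *)

(* Defs.v *)
From HB Require Import structures.
From mathcomp Require Import all_boot all_order all_algebra.
From mathcomp Require Import mpoly.
From Stdlib Require Import ClassicalEpsilon.

Set Implicit Arguments.
Unset Strict Implicit.
Unset Printing Implicit Defensive.

Import Order.TTheory GRing.Theory Num.Theory.
Local Open Scope ring_scope.

Definition pick0 {T : Type} (x0 : T) (P : T -> Prop) : T :=
  epsilon (inhabits x0) P.

Section Operators.
Variables (K : fieldType) (n : nat) (q t : K).

Notation Poly := {mpoly K[n]}.

(* variable x_i, 1-based: x_1, ..., x_n (x_i = 0 for out of range i) *)
Definition xv (i : nat) : Poly :=
  match (insub i.-1 : option 'I_n) with Some j => 'X_j | None => 0 end.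

(* Laurent polynomials: (k, p) represents p * (x_1 ... x_n)^(-k). *)
Definition laur := (nat * Poly)%type.

Definition xprod : Poly := \prod_(j < n) 'X_j.

Definition lcoef (f : laur) (a : n.-tuple int) : K :=
  if [forall j : 'I_n, 0 <= tnth a j + (f.1)%:Z]
  then f.2@_[multinom absz ((tnth a j + (f.1)%:Z)%R) | j < n]
  else 0.

Definition leqL (f g : laur) : Prop := forall a, lcoef f a = lcoef g a.

Definition lpoly (p : Poly) : laur := (0%N, p).
Definition ladd (f g : laur) : laur :=
  ((f.1 + g.1)%N, f.2 * xprod ^+ g.1 + g.2 * xprod ^+ f.1).
Definition lscale (c : K) (f : laur) : laur := (f.1, c *: f.2).
Definition lsub (f g : laur) : laur := ladd f (lscale (-1) g).
Definition lmul (f g : laur) : laur := ((f.1 + g.1)%N, f.2 * g.2).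
Definition lmulX (i : nat) (f : laur) : laur := lmul (lpoly (xv i)) f.
(* multiplication by x_i^{-1} = (prod_{j<>i} x_j) / (x_1...x_n) *)
Definition linvX (i : nat) (f : laur) : laur :=
  lmul (1%N, \prod_(j < n | j.+1 != i) 'X_j) f.

Definition swapn (i k : nat) : nat :=
  if k == i then i.+1 else if k == i.+1 then i else k.
Definition ls (i : nat) (f : laur) : laur :=
  (f.1, f.2 \mPo [tuple xv (swapn i j.+1) | j < n]).
(* tau_i : x_i -> q x_i ; note tau_i ((x_1...x_n)^{-k}) = q^{-k} (x_1...x_n)^{-k} *)
Definition ltau (i : nat) (f : laur) : laur :=
  (f.1, q ^- f.1 *: (f.2 \mPo
     [tuple (if j.+1 == i then q *: xv j.+1 else xv j.+1) | j < n])).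
Definition ldivd (i : nat) (f : laur) : laur :=
  (f.1, pick0 0 (fun h : Poly => f.2 = (xv i - xv i.+1) * h)).

Definition lT (i : nat) (f : laur) : laur :=
  ladd (lscale t f)
       (lmul (lpoly (t *: xv i - xv i.+1)) (ldivd i (lsub (ls i f) f))).
Definition lTinv (i : nat) (f : laur) : laur :=
  ladd (lscale (t^-1 - 1) f) (lscale t^-1 (lT i f)).

Definition opprod (F : nat -> laur -> laur) (l : seq nat) (f : laur) : laur :=
  foldr F f l.

Definition lomega (f : laur) : laur :=
  opprod ls (rev (iota 1 n.-1)) (ltau 1 f).

Definition lY (i : nat) (f : laur) : laur :=
  lscale (t ^- (n - i))
    (opprod lT (iota i (n - i)) (lomega (opprod lTinv (iota 1 i.-1) f))).

Definition lTijinv (i j : nat) (f : laur) : laur :=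
  opprod lTinv (iota i (j.-1 - i) ++ j.-1 :: rev (iota i (j.-1 - i))) f.

Definition lD (i : nat) (f : laur) : laur :=
  let g := lY i f in
  linvX i (lsub f (lscale (t ^+ n.-1)
     (ladd g (lscale (t^-1 - 1)
        (foldr ladd (lpoly 0)
           [seq lscale (t ^+ (j - i)) (lTijinv i j g) | j <- iota i.+1 (n - i)]))))).

Definition lPhi (f : laur) : laur :=
  lmulX n (opprod lTinv (rev (iota 1 n.-1)) f).
Definition lPhihat (f : laur) : laur :=
  opprod lT (iota 1 n.-1) (lD n f).

Definition ev (eta : 'X_{1..n}) (i : nat) : nat := nth 0%N eta i.-1.
Definition dplus (eta : 'X_{1..n}) : seq nat := sort geq eta.
Definition domle (nu eta : seq nat) : bool :=
  [forall p : 'I_n.+1, sumn (take p nu) <= sumn (take p eta)]%N.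
Definition prec (nu eta : 'X_{1..n}) : Prop :=
  nu <> eta /\
  ((domle (dplus nu) (dplus eta) /\ dplus nu <> dplus eta)
   \/ (dplus nu = dplus eta /\ domle nu eta)).

Definition lp (eta : 'X_{1..n}) (i : nat) : nat :=
  (\sum_(1 <= k < i) (ev eta i <= ev eta k) + \sum_(i.+1 <= k < n.+1) (ev eta i < ev eta k))%N.
(* t^{bar eta_i} with t^alpha = q *)
Definition evY (eta : 'X_{1..n}) (i : nat) : K := q ^+ (ev eta i) * t ^- (lp eta i).

Definition isE (eta : 'X_{1..n}) (f : Poly) : Prop :=
  f@_eta = 1 /\ (forall nu, f@_nu != 0 -> nu = eta \/ prec nu eta) /\
  (forall i, (1 <= i <= n)%N -> leqL (lY i (lpoly f)) (lscale (evY eta i) (lpoly f))).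

Definition Emac (eta : 'X_{1..n}) : Poly := pick0 0 (isE eta).

Definition arm (eta : 'X_{1..n}) (i j : nat) : nat := (ev eta i - j)%N.
Definition coarm (i j : nat) : nat := j.-1.
Definition leg (eta : 'X_{1..n}) (i j : nat) : nat :=
  (\sum_(i.+1 <= k < n.+1) ((j <= ev eta k) && (ev eta k <= ev eta i))
   + \sum_(1 <= k < i) ((j <= (ev eta k).+1) && ((ev eta k).+1 <= ev eta i)))%N.
Definition coleg (eta : 'X_{1..n}) (i : nat) : nat :=
  (\sum_(i.+1 <= k < n.+1) (ev eta i < ev eta k) + \sum_(1 <= k < i) (ev eta i <= ev eta k))%N.

Definition nodeprod (eta : 'X_{1..n}) (F : nat -> nat -> K) : K :=
  \prod_(1 <= i < n.+1) \prod_(1 <= j < (ev eta i).+1) F i j.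

Definition dcst (eta : 'X_{1..n}) : K :=
  nodeprod eta (fun i j => 1 - q ^+ (arm eta i j).+1 * t ^+ (leg eta i j).+1).
Definition dpcst (eta : 'X_{1..n}) : K :=
  nodeprod eta (fun i j => 1 - q ^+ (arm eta i j).+1 * t ^+ (leg eta i j)).
Definition ecst (eta : 'X_{1..n}) : K :=
  nodeprod eta (fun i j => 1 - q ^+ (coarm i j).+1 * t ^+ (n - coleg eta i)).

End Operators.

Section Series.
Variables (K : fieldType) (n : nat).

Definition monom2 := (n.-tuple int * n.-tuple int)%type.
Definition family := 'X_{1..n} -> monom2 -> K.

Definition covers (F : family) (m : monom2) (s : seq 'X_{1..n}) : Prop :=
  forall eta, F eta m != 0 -> eta \in s.
Definition summable (F : family) : Prop := forall m, exists s, covers F m s.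
Definition ssum (F : family) (m : monom2) : K :=
  \sum_(eta <- undup (pick0 [::] (covers F m))) F eta m.
Definition series_eq (F G : family) : Prop :=
  summable F /\ summable G /\ forall m, ssum F m = ssum G m.
End Series.

Definition Kqt : fieldType := {fraction {poly {poly rat}}}.
Definition qq : Kqt := FracField.tofrac ('X%:P : {poly {poly rat}}).
Definition tt : Kqt := FracField.tofrac ('X : {poly {poly rat}}).

Definition cK (n : nat) (eta : 'X_{1..n}) : Kqt :=
  dcst qq tt eta / (dpcst qq tt eta * ecst qq tt eta).

(* the family of terms of A^{(x)} B^{(y)} K_A, i.e. the terms
   c_eta (A E_eta(.;q,t))(x) (B E_eta(.;q^-1,t^-1))(y) *)
Definition KAterms (n : nat) (A B : laur Kqt n -> laur Kqt n) : family Kqt n :=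
  fun eta m =>
    cK eta * lcoef (A (lpoly (Emac qq tt eta))) m.1
           * lcoef (B (lpoly (Emac qq^-1 tt^-1 eta))) m.2.

(* Main.v *)
Require Import Defs.
From HB Require Import structures.
From mathcomp Require Import all_boot all_order all_algebra.
From mathcomp Require Import mpoly perm.
From mathcomp Require Import zify ring.
From Stdlib Require Import ClassicalEpsilon.

(* The relation t D_i = T_i D_{i+1} T_i reduces (c) to (a) and to the case i = n, and
   D_n = T_{n-1}^{-1} ... T_1^{-1} Phihat reduces that case to (a) and (b). So only T_i and Phihat
   have to be computed on the E_eta. Up to scalars Phihat sends E_{phi eta} to E_eta, where
   phi eta = (eta_2, ..., eta_n, eta_1 + 1), and T_i preserves the span of E_eta and E_{s_i eta};
   (a) and (b) then amount to the quotients of the coefficients d_eta / (d'_eta e_eta) at s_i eta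
   and at phi eta by the one at eta, where all but boundedly many node factors cancel.
   The E_eta exist because 1, T_i^{-1} and x_n omega generate joint eigenfunctions of the Y_i with
   every spectrum (t^{bar eta_i})_i. They are triangular and unique because, at a monomial nu that
   is maximal in the support of f, the coefficient of Y_i f is t^{bar nu_i} times that of f, so the
   eigenvalues determine the maximal monomials. The relations between the operators are identities
   of rational functions in x, proved in the fraction field of the polynomial ring. *)

Set Implicit Arguments.
Unset Strict Implicit.
Unset Printing Implicit Defensive.

Import GRing.Theory.
Local Open Scope ring_scope.

(* The s_i and omega acting on a field F of functions in x, with k : K -> F the constants. *)
Record affine_action (K F : fieldType) (n : nat) (k : {rmorphism K -> F}) (q : K)
    (X : nat -> F) (s : nat -> {rmorphism F -> F}) (om : {rmorphism F -> F}) : Prop :=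
  AffineAction {
  act_sk : forall i c, s i (k c) = k c;
  act_omk : forall c, om (k c) = k c;
  act_sX : forall i j, (0 < i < n)%N -> (0 < j <= n)%N -> s i (X j) = X (swapn i j);
  act_sK : forall i, (0 < i < n)%N -> involutive (s i);
  act_braid : forall i f, (0 < i)%N -> (i.+1 < n)%N ->
    s i (s i.+1 (s i f)) = s i.+1 (s i (s i.+1 f));
  act_comm : forall i j f, (0 < i)%N -> (i.+1 < j < n)%N -> s i (s j f) = s j (s i f);
  act_omX1 : om (X 1) = k q * X n;
  act_omXS : forall i, (0 < i < n)%N -> om (X i.+1) = X i;
  act_oms : forall i f, (0 < i)%N -> (i.+1 < n)%N -> om (s i.+1 f) = s i (om f);
  act_om2 : forall f, (1 < n)%N -> om (om (s 1 f)) = s n.-1 (om (om f));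
  act_neqX : forall i j, (0 < i <= n)%N -> (0 < j <= n)%N -> i != j -> X i != X j;
  act_X0 : forall i, (0 < i <= n)%N -> X i != 0 }.

Section Hecke.
Variables (K F : fieldType) (n : nat) (k : {rmorphism K -> F}) (q t : K).
Variables (X : nat -> F) (s : nat -> {rmorphism F -> F}) (om : {rmorphism F -> F}).
Hypothesis act : affine_action n k q X s om.
Hypothesis q0 : q != 0.
Hypothesis t0 : t != 0.

(* T_i, T_i^{-1}, and below Y_i, Phi' = x_n omega, T_{ij}^{-1} and D_i, over any such F. *)
Definition hT i f := k t * f + (k t * X i - X i.+1) / (X i - X i.+1) * (s i f - f).
Definition hTi i f := (k t^-1 - 1) * f + k t^-1 * hT i f.

Let kt0 : k t != 0. Proof. by rewrite fmorph_eq0. Qed.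

Lemma hT_D i f g : hT i (f + g) = hT i f + hT i g.
Proof. rewrite /hT rmorphD /=; ring. Qed.

Lemma hT_Z i c f : hT i (k c * f) = k c * hT i f.
Proof. rewrite /hT rmorphM /= (act_sk act); ring. Qed.

Lemma hTi_D i f g : hTi i (f + g) = hTi i f + hTi i g.
Proof. rewrite /hTi hT_D; ring. Qed.

Lemma hTi_Z i c f : hTi i (k c * f) = k c * hTi i f.
Proof. rewrite /hTi hT_Z; ring. Qed.

Lemma act_sXi i : (0 < i < n)%N -> s i (X i) = X i.+1.
Proof. by move=> h; rewrite (act_sX act) ?/swapn ?eqxx //; lia. Qed.

Lemma act_sXS i : (0 < i < n)%N -> s i (X i.+1) = X i.
Proof. move=> h; rewrite (act_sX act) ?/swapn ?eqxx //; last lia. by case: eqP => //; lia. Qed.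

Lemma act_sXn i j : (0 < i < n)%N -> (0 < j <= n)%N -> j != i -> j != i.+1 -> s i (X j) = X j.
Proof. by move=> h hj /negPf h1 /negPf h2; rewrite (act_sX act) // /swapn h1 h2. Qed.

Lemma subX_neq0 i j : (0 < i <= n)%N -> (0 < j <= n)%N -> i != j -> X i - X j != 0.
Proof. by move=> hi hj h; rewrite subr_eq0 (act_neqX act). Qed.

Lemma hT_quad i f : (0 < i < n)%N -> hT i (hT i f) = (k t - 1) * hT i f + k t * f.
Proof.
move=> hi; rewrite /hT.
rewrite !(rmorphD, rmorphN, rmorphM, fmorphV) /=.
rewrite !(act_sk act) act_sXi // act_sXS // (act_sK act) //.
have := @subX_neq0 i i.+1 ltac:(lia) ltac:(lia) ltac:(lia).
set x := X i; set y := X i.+1; set a := s i f => h.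
have h' : y - x != 0 by rewrite -opprB oppr_eq0.
field. by rewrite h h'.
Qed.

Lemma hTiK i f : (0 < i < n)%N -> hTi i (hT i f) = f.
Proof. by move=> hi; rewrite /hTi hT_quad // fmorphV; field. Qed.

Lemma hTKi i f : (0 < i < n)%N -> hT i (hTi i f) = f.
Proof.
move=> hi; rewrite /hTi hT_D !hT_Z -(rmorph1 k) -rmorphB hT_Z hT_quad //.
rewrite rmorphB rmorph1 fmorphV; by field.
Qed.

Lemma hT_hTi i f : hT i f = k t * hTi i f + (k t - 1) * f.
Proof. by rewrite /hTi fmorphV; field. Qed.

Lemma hT_braid i f : (0 < i)%N -> (i.+1 < n)%N ->
  hT i (hT i.+1 (hT i f)) = hT i.+1 (hT i (hT i.+1 f)).
Proof.
move=> hi hin; rewrite /hT.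
rewrite !(rmorphD, rmorphN, rmorphM, fmorphV) /=.
rewrite !(act_sk act).
rewrite !(act_sXi, act_sXS, @act_sXn i i.+2, @act_sXn i.+1 i) ?(act_sK act); try lia.
rewrite ?(act_braid act) ?(act_sK act); try lia.
have h1 := @subX_neq0 i i.+1 ltac:(lia) ltac:(lia) ltac:(lia).
have h2 := @subX_neq0 i i.+2 ltac:(lia) ltac:(lia) ltac:(lia).
have h3 := @subX_neq0 i.+1 i.+2 ltac:(lia) ltac:(lia) ltac:(lia).
move: h1 h2 h3.
set x := X i; set y := X i.+1; set z := X i.+2 => h1 h2 h3.
have h1' : y - x != 0 by rewrite -opprB oppr_eq0.
have h2' : z - x != 0 by rewrite -opprB oppr_eq0.
have h3' : z - y != 0 by rewrite -opprB oppr_eq0.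
field.
by rewrite ?h1 ?h2 ?h3 ?h1' ?h2' ?h3'.
Qed.

Lemma hT_comm i j f : (0 < i)%N -> (i.+1 < j < n)%N -> hT i (hT j f) = hT j (hT i f).
Proof.
move=> hi hj; rewrite /hT.
rewrite !(rmorphD, rmorphN, rmorphM, fmorphV) /=.
rewrite !(act_sk act).
rewrite !(@act_sXn i j, @act_sXn i j.+1, @act_sXn j i, @act_sXn j i.+1); try lia.
rewrite (act_comm act) //.
ring.
Qed.

Lemma hT_commT i j f : (0 < i < n)%N -> (0 < j < n)%N -> (i.+1 < j)%N || (j.+1 < i)%N ->
  hT i (hT j f) = hT j (hT i f).
Proof. by move=> hi hj /orP[]h; [|symmetry]; apply: hT_comm; lia. Qed.

Lemma hTi_commT i j f : (0 < i < n)%N -> (0 < j < n)%N -> (i.+1 < j)%N || (j.+1 < i)%N ->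
  hTi i (hT j f) = hT j (hTi i f).
Proof. by move=> hi hj h; rewrite -{1}(@hTKi i f) // -hT_commT // hTiK. Qed.

Lemma hT_inj i f g : (0 < i < n)%N -> hT i f = hT i g -> f = g.
Proof. by move=> hi h; rewrite -(@hTiK i f) // h hTiK. Qed.

Lemma hTi_braid i f : (0 < i)%N -> (i.+1 < n)%N ->
  hTi i (hTi i.+1 (hT i f)) = hT i.+1 (hTi i (hTi i.+1 f)).
Proof.
move=> hi hin; apply: (@hT_inj i); first lia.
rewrite hTKi; last lia.
apply: (@hT_inj i.+1); first lia.
rewrite hTKi; last lia.
rewrite -hT_braid // hTKi ?hTKi //; lia.
Qed.

Lemma hT_Xn i j f : (0 < i < n)%N -> (0 < j <= n)%N -> j != i -> j != i.+1 ->
  hT i (X j * f) = X j * hT i f.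
Proof. by move=> hi hj h1 h2; rewrite /hT rmorphM /= act_sXn //; ring. Qed.

Lemma hTi_Xn i j f : (0 < i < n)%N -> (0 < j <= n)%N -> j != i -> j != i.+1 ->
  hTi i (X j * f) = X j * hTi i f.
Proof. by move=> hi hj h1 h2; rewrite /hTi hT_Xn //; ring. Qed.

Lemma hT_Xi i f : (0 < i < n)%N -> hT i (X i * f) = k t * X i.+1 * hTi i f.
Proof.
move=> hi; rewrite /hTi /hT rmorphM /= act_sXi // fmorphV.
have := @subX_neq0 i i.+1 ltac:(lia) ltac:(lia) ltac:(lia).
set x := X i; set y := X i.+1; set a := s i f => h.
by field; rewrite h.
Qed.

Lemma hTi_XS i f : (0 < i < n)%N -> hTi i (X i.+1 * f) = k t^-1 * X i * hT i f.
Proof.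
move=> hi; apply: (@hT_inj i) => //; rewrite hTKi // -mulrA hT_Z hT_Xi // hTiK //.
by rewrite fmorphV; field.
Qed.

Lemma hT_XVS i f : (0 < i < n)%N -> hT i ((X i.+1)^-1 * f) = k t * (X i)^-1 * hTi i f.
Proof.
move=> hi; have hx : X i != 0 by apply: (act_X0 act); lia.
have hy : X i.+1 != 0 by apply: (act_X0 act); lia.
have := @hTi_XS i ((X i.+1)^-1 * f) hi; rewrite mulVKf // => ->.
by rewrite fmorphV; field; rewrite hx kt0.
Qed.

Lemma om_hT i f : (0 < i)%N -> (i.+1 < n)%N -> om (hT i.+1 f) = hT i (om f).
Proof.
move=> hi hin; rewrite /hT !(rmorphD, rmorphN, rmorphM, fmorphV) /= (act_omk act).
by rewrite (act_oms act) // !(act_omXS act) //; lia.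
Qed.

Lemma om_hTi i f : (0 < i)%N -> (i.+1 < n)%N -> om (hTi i.+1 f) = hTi i (om f).
Proof.
by move=> hi hin; rewrite /hTi -om_hT // rmorphD !rmorphM rmorphB rmorph1 !(act_omk act).
Qed.

Lemma om2_hT f : (1 < n)%N -> om (om (hT 1 f)) = hT n.-1 (om (om f)).
Proof.
move=> hn; rewrite /hT !(rmorphD, rmorphN, rmorphM, fmorphV) /= !(act_omk act).
rewrite (act_om2 act) //.
rewrite (act_omXS act (i := 1)) // (act_omX1 act) !rmorphM /= (act_omk act).
have e : n = n.-1.+1 by lia.
have eX : X n = X n.-1.+1 by rewrite -e.
rewrite !eX (act_omXS act (i := n.-1)); last lia.
have := @subX_neq0 n.-1 n.-1.+1 ltac:(lia) ltac:(lia) ltac:(lia).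
set x := X n.-1; set y := X n.-1.+1 => h.
have hq : k q != 0 by rewrite fmorph_eq0.
have h' : k q * x - k q * y != 0 by rewrite -mulrBr mulf_neq0.
field. by rewrite ?h' ?h.
Qed.

Lemma om2_hTi f : (1 < n)%N -> om (om (hTi 1 f)) = hTi n.-1 (om (om f)).
Proof.
move=> hn; rewrite /hTi -om2_hT //.
by rewrite rmorphD !rmorphM rmorphB rmorph1 !(act_omk act) rmorphD !rmorphM rmorphB rmorph1
  !(act_omk act).
Qed.

Lemma foldr_comm (A : F -> F) (G : nat -> F -> F) l f :
  (forall j g, j \in l -> A (G j g) = G j (A g)) -> A (foldr G f l) = foldr G (A f) l.
Proof.
elim: l => //= j l IH h; rewrite h ?mem_head // IH // => i g hi.
by rewrite h // in_cons hi orbT.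
Qed.

Lemma foldr_add (G : nat -> F -> F) l f g :
  (forall j, {morph G j : a b / a + b}) -> foldr G (f + g) l = foldr G f l + foldr G g l.
Proof. by move=> h; elim: l => //= j l ->; rewrite h. Qed.

Lemma foldr_Z (G : nat -> F -> F) l c f :
  (forall j c f, G j (k c * f) = k c * G j f) -> foldr G (k c * f) l = k c * foldr G f l.
Proof. by move=> h; elim: l => //= j l ->; rewrite h. Qed.

Lemma foldr_iotaS (G : nat -> F -> F) a m f :
  foldr G f (iota a m.+1) = foldr G (G (a + m)%N f) (iota a m).
Proof. by rewrite -addn1 iotaD foldr_cat. Qed.

Lemma foldr_shift (G : nat -> F -> F) a m j f :
  (forall i g, (0 < i)%N -> (i.+1 < n)%N -> G i (G i.+1 (hT i g)) = hT i.+1 (G i (G i.+1 g))) ->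
  (forall i j g, (0 < i < n)%N -> (0 < j < n)%N -> (i.+1 < j)%N || (j.+1 < i)%N ->
     G i (hT j g) = hT j (G i g)) ->
  (0 < a <= j)%N -> (j.+1 < a + m <= n)%N ->
  foldr G (hT j f) (iota a m) = hT j.+1 (foldr G f (iota a m)).
Proof.
move=> h1 h2 ha hj.
have -> : iota a m = iota a (j - a) ++ [:: j, j.+1 & iota j.+2 (m - (j - a) - 2)].
  have {1}-> : m = ((j - a) + (m - (j - a) - 2).+2)%N by lia.
  by rewrite iotaD /= subnKC //; lia.
rewrite !foldr_cat /= -(@foldr_comm (hT j)); last first.
  by move=> i g; rewrite mem_iota => hi; rewrite h2 //; lia.
rewrite h1; try lia.
rewrite -(@foldr_comm (hT j.+1)) //.
by move=> i g; rewrite mem_iota => hi; rewrite h2 //; lia.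
Qed.

Definition hY i f :=
  k (t ^- (n - i)) * foldr hT (om (foldr hTi f (iota 1 i.-1))) (iota i (n - i)).

Lemma hY_D i f g : hY i (f + g) = hY i f + hY i g.
Proof.
by rewrite /hY foldr_add ?rmorphD ?foldr_add /= ?mulrDr // => j a b; rewrite ?hT_D ?hTi_D.
Qed.

Lemma hY_Z i c f : hY i (k c * f) = k c * hY i f.
Proof.
rewrite /hY foldr_Z ?rmorphM /= ?(act_omk act) ?foldr_Z /=; first by rewrite mulrCA.
  by move=> *; rewrite hT_Z.
by move=> *; rewrite hTi_Z.
Qed.

Lemma hY_hT_comm i j f : (0 < i <= n)%N -> (0 < j < n)%N -> j != i -> j.+1 != i ->
  hY i (hT j f) = hT j (hY i f).
Proof.
move=> hi hj h1 h2; rewrite /hY hT_Z; congr (_ * _).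
case: (ltnP i j) => hij.
- rewrite -(@foldr_comm (hT j)); last first.
    by move=> l g; rewrite mem_iota => hl; rewrite hTi_commT //; lia.
  have e : j = j.-1.+1 by lia.
  rewrite e om_hT; try lia.
  rewrite foldr_shift //; try lia.
  - by move=> l g hl hl'; rewrite hT_braid.
  - by move=> l m g hl hm; exact: hT_commT.
- rewrite (@foldr_shift hTi) //; try lia; first last.
  - by move=> l m g hl hm; exact: hTi_commT.
  - by move=> l g hl hl'; exact: hTi_braid.
  rewrite om_hT; try lia.
  rewrite -(@foldr_comm (hT j)) //.
  by move=> l g; rewrite mem_iota => hl; rewrite hT_commT //; lia.
Qed.

Lemma hY_hTi_comm i j f : (0 < i <= n)%N -> (0 < j < n)%N -> j != i -> j.+1 != i ->
  hY i (hTi j f) = hTi j (hY i f).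
Proof.
by move=> hi hj h1 h2; apply: (@hT_inj j) => //; rewrite hTKi // -hY_hT_comm // hTKi.
Qed.

Lemma hT_hY_hT i f : (0 < i < n)%N -> hT i (hY i.+1 (hT i f)) = k t * hY i f.
Proof.
move=> hi; rewrite /hY hT_Z.
have e : (n - i = (n - i.+1).+1)%N by lia.
rewrite [in RHS]e /= mulrA -rmorphM; congr (k _ * hT i (foldr hT (om _) _)).
  by rewrite exprS invfM mulrA divff ?mul1r.
case: i hi {e} => // i hi.
by rewrite foldr_iotaS add1n hTiK.
Qed.

Lemma hY_hTi i f : (0 < i < n)%N -> hY i (hTi i f) = k t^-1 * hT i (hY i.+1 f).
Proof.
move=> hi; have := @hT_hY_hT i (hTi i f) hi; rewrite hTKi // => ->.
by rewrite mulrA fmorphV mulVf // mul1r.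
Qed.

Lemma hYS_hT i f : (0 < i < n)%N -> hY i.+1 (hT i f) = k t * hTi i (hY i f).
Proof.
by move=> hi; apply: (@hT_inj i) => //; rewrite hT_hY_hT // hT_Z hTKi.
Qed.

Definition hPhi f := X n * om f.

Lemma foldr_om (G : nat -> F -> F) a m f :
  (forall i g, (0 < i)%N -> (i.+1 < n)%N -> om (G i.+1 g) = G i (om g)) ->
  (0 < a)%N -> (a + m < n)%N || (m == 0%N) ->
  om (foldr G f (iota a.+1 m)) = foldr G (om f) (iota a m).
Proof.
move=> h; elim: m a => //= m IH a ha hm.
by rewrite h ?IH //; lia.
Qed.

Lemma hY_hPhi i f : (0 < i < n)%N -> hY i (hPhi f) = hPhi (hY i.+1 f).
Proof.
move=> hi; rewrite /hPhi /hY rmorphM /= (act_omk act).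
rewrite -(@foldr_comm (fun x => X n * x)); last first.
  by move=> j g; rewrite mem_iota => hj; rewrite hTi_Xn //; lia.
rewrite -(@foldr_om hTi); [|exact: om_hTi|by []|lia].
rewrite rmorphM /=.
have e : (n - i = (n - i.+1).+1)%N by lia.
have e2 : n = n.-1.+1 by lia.
have -> : om (X n) = X n.-1 by rewrite {1}e2 (act_omXS act) //; lia.
rewrite [in LHS]e foldr_iotaS.
have -> : (i + (n - i.+1) = n.-1)%N by lia.
rewrite hT_Xi; last lia.
rewrite -e2 -mulrA foldr_Z; last by move=> *; rewrite hT_Z.
rewrite -om2_hTi; last lia.
rewrite -(@foldr_comm (fun x => X n * x)); last first.
  by move=> j g; rewrite mem_iota => hj; rewrite hT_Xn //; lia.
rewrite (@foldr_om hT); [|exact: om_hT|lia|lia].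
case: i hi e => //= i hi e; rewrite exprS invfM rmorphM !fmorphV.
have : k (t ^+ (n - i.+2)) != 0 by rewrite fmorph_eq0 expf_neq0.
by move=> h; field; rewrite h kt0.
Qed.

Lemma foldr_hTi_X m g : (m < n)%N ->
  foldr hTi (X m.+1 * g) (iota 1 m) = k (t ^- m) * (X 1 * foldr hT g (iota 1 m)).
Proof.
elim: m g => [|m IH] g hm; first by rewrite /= invr1 rmorph1 mul1r.
rewrite !foldr_iotaS add1n hTi_XS //.
rewrite -mulrA foldr_Z; last by move=> *; rewrite hTi_Z.
rewrite IH; last lia.
by rewrite exprS invfM rmorphM mulrA.
Qed.

Lemma hY_hPhi_n f : (0 < n)%N -> hY n (hPhi f) = k q * hPhi (hY 1 f).
Proof.
move=> hn; rewrite /hPhi /hY subnn /= invr1 rmorph1 mul1r subn1.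
have {1}-> : n = n.-1.+1 by lia.
rewrite foldr_hTi_X; last lia.
rewrite !rmorphM /= !(act_omk act) (act_omX1 act); ring.
Qed.

Lemma foldr_revK (T : Type) (G H : nat -> T -> T) l f : (forall j g, j \in l -> G j (H j g) = g) ->
  foldr G (foldr H f l) (rev l) = f.
Proof.
elim: l f => //= j l IH f h; rewrite rev_cons foldr_rcons h ?mem_head // IH // => i g hi.
by apply: h; rewrite in_cons hi orbT.
Qed.

Definition hTij i j f :=
  foldr hTi f (iota i (j.-1 - i) ++ j.-1 :: rev (iota i (j.-1 - i))).
Definition hB i g :=
  g + k (t^-1 - 1) * (\sum_(j <- iota i.+1 (n - i)) k (t ^+ (j - i)) * hTij i j g).
Definition hD i f := (X i)^-1 * (f - k (t ^+ n.-1) * hB i (hY i f)).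

Lemma hTi_foldr_hTij i j f : (i.+1 < j)%N -> hTij i j f = hTi i (hTij i.+1 j (hTi i f)).
Proof.
move=> h; rewrite /hTij.
have -> : (j.-1 - i = (j.-1 - i.+1).+1)%N by lia.
by rewrite /= rev_cons !foldr_cat /= foldr_rcons.
Qed.

Lemma hTijS i f : hTij i i.+1 f = hTi i f.
Proof. by rewrite /hTij /= subnn. Qed.

Lemma hTi_sum i (I : Type) (r : seq I) (G : I -> F) :
  hTi i (\sum_(j <- r) G j) = \sum_(j <- r) hTi i (G j).
Proof.
have h0 : hTi i 0 = 0 by have := hTi_Z i 0 0; rewrite rmorph0 !mul0r.
by elim: r => [|j r IH]; rewrite ?big_nil // !big_cons hTi_D IH.
Qed.

Lemma hB_rec i g : (0 < i < n)%N -> hB i g = k t * hTi i (hB i.+1 (hTi i g)).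
Proof.
move=> hi; rewrite /hB hTi_D hTi_Z hTi_sum.
have -> : (n - i = (n - i.+1).+1)%N by lia.
rewrite /= big_cons hTijS.
have -> : (i.+1 - i = 1)%N by lia.
rewrite expr1 mulrDr.
have -> : \sum_(j <- iota i.+2 (n - i.+1)) k (t ^+ (j - i)) * hTij i j g =
  k t * (\sum_(j <- iota i.+2 (n - i.+1)) hTi i (k (t ^+ (j - i.+1)) * hTij i.+1 j (hTi i g))).
  rewrite big_distrr /=; apply: eq_big_seq => j; rewrite mem_iota => hj.
  rewrite hTi_Z -hTi_foldr_hTij; last lia.
  have -> : (j - i = (j - i.+1).+1)%N by lia.
  by rewrite exprS rmorphM mulrA.
set S := \sum_(j <- _) _.
have := hT_hTi i (hTi i g); rewrite hTKi // => {1}->.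
rewrite !rmorphB !rmorph1 fmorphV; by field.
Qed.

Lemma hD_rec i f : (0 < i < n)%N -> hD i f = k t^-1 * hT i (hD i.+1 (hT i f)).
Proof.
move=> hi; rewrite /hD hT_XVS // !mulrA fmorphV mulVf // mul1r; congr (_ * _).
rewrite hYS_hT // -[in RHS]mulNr -[in RHS]rmorphN hTi_D hTi_Z hTiK // rmorphN mulNr;
  congr (_ - _ * _).
have hBZ c g : hB i.+1 (k c * g) = k c * hB i.+1 g.
  rewrite /hB mulrDr; congr (_ + _); rewrite mulrCA; congr (_ * _).
  rewrite big_distrr /=; apply: eq_bigr => j _; rewrite /hTij foldr_Z; first by rewrite mulrCA.
  by move=> *; rewrite hTi_Z.
by rewrite hBZ hTi_Z -hB_rec.
Qed.

Lemma hD_n f : hD n f = (X n)^-1 * (f - k (t ^+ n.-1) * hY n f).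
Proof. by rewrite /hD /hB subnn /= big_nil mulr0 addr0. Qed.

Lemma hD_lin i c f g : hD i (k c * f + g) = k c * hD i f + hD i g.
Proof.
have hBl u v : hB i (k c * u + v) = k c * hB i u + hB i v.
  have hij j : hTij i j (k c * u + v) = k c * hTij i j u + hTij i j v.
    rewrite /hTij foldr_add; last by move=> l a b; rewrite hTi_D.
    by congr (_ + _); apply: foldr_Z => l a b; rewrite hTi_Z.
  rewrite /hB (eq_bigr (fun j =>
    k c * (k (t ^+ (j - i)) * hTij i j u) + k (t ^+ (j - i)) * hTij i j v)).
    by rewrite big_split -big_distrr /=; ring.
  by move=> j _; rewrite hij mulrDr mulrCA.
rewrite /hD hY_D hY_Z hBl; ring.
Qed.

Lemma hPhi_eigen f e : (0 < n)%N -> hY 1 f = k e * f ->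
  k e * foldr hTi f (rev (iota 1 n.-1)) = k (t ^- n.-1) * om f.
Proof.
move=> hn h; rewrite -foldr_Z; last by move=> *; rewrite hTi_Z.
rewrite -h /hY /= foldr_Z; last by move=> *; rewrite hTi_Z.
rewrite subn1 foldr_revK // => j g; rewrite mem_iota => hj.
by apply: hTiK; lia.
Qed.

Lemma hPhihat_eigen f g e al : (0 < n)%N -> al != 0 -> hY n f = k e * f ->
  k al * f = X n * foldr hTi g (rev (iota 1 n.-1)) ->
  foldr hT (hD n f) (iota 1 n.-1) = k (al^-1 * (1 - t ^+ n.-1 * e)) * g.
Proof.
move=> hn al0 he hf; have hX : X n != 0 by apply: (act_X0 act); lia.
have hk : k al != 0 by rewrite fmorph_eq0.
have -> : hD n f = k (al^-1 * (1 - t ^+ n.-1 * e)) * foldr hTi g (rev (iota 1 n.-1)).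
  apply: (mulfI hX); rewrite [RHS]mulrCA -hf hD_n he mulVKf //.
  by rewrite rmorphM rmorphB rmorphM rmorph1 fmorphV; field.
rewrite foldr_Z; last by move=> *; rewrite hT_Z.
have := @foldr_revK F hT hTi (rev (iota 1 n.-1)) g; rewrite revK => -> // j h.
by rewrite mem_rev mem_iota => hj; apply: hTKi; lia.
Qed.

Lemma hT_mono_ge i M G e : (0 < i < n)%N -> s i M = M ->
  (X i - X i.+1) * G = X i ^+ e * X i.+1 - X i * X i.+1 ^+ e ->
  hT i (M * X i ^+ e) = M * (X i.+1 ^+ e + (1 - k t) * G).
Proof.
move=> hi hM; rewrite /hT rmorphM rmorphXn /= hM act_sXi //.
have := @subX_neq0 i i.+1 ltac:(lia) ltac:(lia) ltac:(lia).
set x := X i; set y := X i.+1 => h hG.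
have -> : G = (x ^+ e * y - x * y ^+ e) / (x - y) by rewrite -hG mulrC mulKf.
by move: (x ^+ e) (y ^+ e) => xe ye; field.
Qed.

Lemma hT_mono_le i M G e : (0 < i < n)%N -> s i M = M ->
  (X i - X i.+1) * G = X i ^+ e * X i.+1 - X i * X i.+1 ^+ e ->
  hT i (M * X i.+1 ^+ e) = M * (k t * X i ^+ e + (k t - 1) * X i.+1 ^+ e + (k t - 1) * G).
Proof.
move=> hi hM; rewrite /hT rmorphM rmorphXn /= hM act_sXS //.
have := @subX_neq0 i i.+1 ltac:(lia) ltac:(lia) ltac:(lia).
set x := X i; set y := X i.+1 => h hG.
have -> : G = (x ^+ e * y - x * y ^+ e) / (x - y) by rewrite -hG mulrC mulKf.
by move: (x ^+ e) (y ^+ e) => xe ye; field.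
Qed.

Lemma hT_inv i M : s i M = M -> hT i M = k t * M.
Proof. by move=> hM; rewrite /hT hM subrr mulr0 addr0. Qed.
End Hecke.

Lemma geom_gap (R : comPzRingType) (x y : R) e : (0 < e)%N ->
  (x - y) * (\sum_(1 <= l < e) x ^+ (e - l) * y ^+ l) = x ^+ e * y - x * y ^+ e.
Proof.
move=> he; pose f l := - (x ^+ (e.+1 - l) * y ^+ l).
rewrite big_distrr /=.
transitivity (\sum_(1 <= l < e) (f l.+1 - f l)).
  apply: eq_big_nat => l hl; rewrite /f subSS.
  have -> : (e.+1 - l = (e - l).+1)%N by lia.
  rewrite !exprS; ring.
rewrite telescope_sumr // /f.
have -> : (e.+1 - e = 1)%N by lia.
by rewrite subn1 expr1 opprK addrC.
Qed.

Notation "x %:F" := (@FracField.tofrac _ x).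

Lemma sub_fractions (F : fieldType) (a b c d : F) : b != 0 -> d != 0 ->
  a / b - c / d = (a * d - c * b) / (b * d).
Proof. by move=> hb hd; field; rewrite hb hd. Qed.

Section FracLift.
Variables (R S : idomainType).

Lemma frac_repr (x : {fraction R}) : x = (\n_(repr x))%:F / (\d_(repr x))%:F.
Proof.
have d0 : (\d_(repr x))%:F != 0 by rewrite tofrac_eq0 denom_ratioP.
apply: (mulIf d0); rewrite divfK //.
rewrite -{1}[x]reprK; move: (repr x) => y {d0 x}.
have dy := denom_ratioP y.
unlock FracField.tofrac; rewrite -[LHS]FracField.pi_mul.
apply/eqmodP; rewrite /= FracField.equivfE /FracField.mulf.
by rewrite !numden_Ratio ?mulf_neq0 ?oner_neq0 // !mulr1 mulrC.
Qed.

Definition frac_lift (phi : {rmorphism R -> S}) (inj : injective phi) (x : {fraction R}) :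
  {fraction S} := (phi \n_(repr x))%:F / (phi \d_(repr x))%:F.

Variables (phi : {rmorphism R -> S}) (inj : injective phi).

Let phi_neq0 d : d != 0 -> (phi d)%:F != 0.
Proof. by rewrite tofrac_eq0 -[X in _ -> _ != X](rmorph0 phi) (inj_eq inj). Qed.

Lemma frac_lift_div (x : {fraction R}) n d : d != 0 -> x = n%:F / d%:F ->
  frac_lift inj x = (phi n)%:F / (phi d)%:F.
Proof.
move=> d0 e; rewrite /frac_lift; have := frac_repr x.
have := denom_ratioP (repr x).
move: (\n_(repr x)) (\d_(repr x)) => n' d' d'0; rewrite {}e => /eqP.
rewrite eqr_div ?tofrac_eq0 // -!tofracM tofrac_eq => /eqP e.
by apply/eqP; rewrite eqr_div ?phi_neq0 // -!tofracM -!rmorphM e.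
Qed.

Lemma frac_lift_tofrac p : frac_lift inj p%:F = (phi p)%:F.
Proof. by rewrite (@frac_lift_div _ p 1) ?rmorph1 ?tofrac1 ?divr1 // oner_neq0. Qed.

Lemma frac_lift_zmod : zmod_morphism (frac_lift inj).
Proof.
move=> x y; rewrite {2 3}/frac_lift.
have ex := frac_repr x; have ey := frac_repr y.
have := denom_ratioP (repr x); have := denom_ratioP (repr y).
move: (\n_(repr x)) (\d_(repr x)) (\n_(repr y)) (\d_(repr y)) ex ey => n d n' d' ex ey d'0 d0.
rewrite (@frac_lift_div _ (n * d' - n' * d) (d * d')) ?mulf_neq0 //.
  by rewrite !(rmorphB, rmorphM) /= sub_fractions ?phi_neq0.
by rewrite ex ey !(rmorphB, rmorphM) /= sub_fractions ?tofrac_eq0.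
Qed.

Lemma frac_lift_monoid : monoid_morphism (frac_lift inj).
Proof.
split; first by rewrite -tofrac1 frac_lift_tofrac rmorph1.
move=> x y; rewrite {2 3}/frac_lift.
have ex := frac_repr x; have ey := frac_repr y.
have := denom_ratioP (repr x); have := denom_ratioP (repr y).
move: (\n_(repr x)) (\d_(repr x)) (\n_(repr y)) (\d_(repr y)) ex ey => n d n' d' ex ey d'0 d0.
rewrite (@frac_lift_div _ (n * n') (d * d')); first by rewrite !rmorphM mulf_div.
  by rewrite mulf_neq0.
by rewrite ex ey !tofracM mulf_div.
Qed.

HB.instance Definition _ := GRing.isZmodMorphism.Build _ _ (frac_lift inj) frac_lift_zmod.
HB.instance Definition _ := GRing.isMonoidMorphism.Build _ _ (frac_lift inj) frac_lift_monoid.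
End FracLift.

Lemma frac_rmorph_ext (R : idomainType) (F : fieldType) (f g : {rmorphism {fraction R} -> F}) :
  (forall p : R, f p%:F = g p%:F) -> f =1 g.
Proof. by move=> h x; rewrite (frac_repr x) !fmorph_div !h. Qed.

Lemma mpoly_rmorph_ext (K : comNzRingType) (S : nzRingType) (n : nat)
  (f g : {rmorphism {mpoly K[n]} -> S}) :
  (forall c, f c%:MP = g c%:MP) -> (forall i, f 'X_i = g 'X_i) -> f =1 g.
Proof.
move=> hC hX p; rewrite [p]mpolyE !raddf_sum /=; apply: eq_bigr => m _.
rewrite -mul_mpolyC !rmorphM hC; congr (_ * _).
by rewrite mpolyXE_id !rmorph_prod; apply: eq_bigr => i _; rewrite !rmorphXn hX.
Qed.

Lemma swapnK i : involutive (swapn i).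
Proof. by move=> j; rewrite /swapn; do !case: eqP => //; lia. Qed.

Lemma swapn_bound n i j : (0 < i < n)%N -> (0 < j <= n)%N -> (0 < swapn i j <= n)%N.
Proof. by rewrite /swapn; do !case: eqP => //; lia. Qed.

Lemma swapnL i : swapn i i = i.+1.
Proof. by rewrite /swapn eqxx. Qed.

Lemma swapnR i : swapn i i.+1 = i.
Proof. by rewrite /swapn eqxx; case: eqP => //; lia. Qed.

Lemma swapnN i j : j != i -> j != i.+1 -> swapn i j = j.
Proof. by rewrite /swapn => /negPf -> /negPf ->. Qed.

Lemma swapn_braid i j : swapn i (swapn i.+1 (swapn i j)) = swapn i.+1 (swapn i (swapn i.+1 j)).
Proof.
have e1 : (i == i.+1) = false by lia. have e2 : (i.+1 == i) = false by lia.
have e3 : (i.+2 == i) = false by lia. have e4 : (i.+2 == i.+1) = false by lia.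
have e5 : (i == i.+2) = false by lia. have e6 : (i.+1 == i.+2) = false by lia.
case: (j =P i) => [->|/eqP/negPf h1]; first by rewrite /swapn;
  do 4! rewrite ?(eqxx, e1, e2, e3, e4, e5, e6) //=.
case: (j =P i.+1) => [->|/eqP/negPf h2]; first by rewrite /swapn;
  do 4! rewrite ?(eqxx, e1, e2, e3, e4, e5, e6) //=.
case: (j =P i.+2) => [->|/eqP/negPf h3]; first by rewrite /swapn;
  do 4! rewrite ?(eqxx, e1, e2, e3, e4, e5, e6) //=.
by rewrite /swapn; do 3! rewrite ?(h1, h2, h3) //=.
Qed.

Lemma swapn_comm i j l : (i.+1 < j)%N -> swapn i (swapn j l) = swapn j (swapn i l).
Proof.
move=> hij.
have e1 : (i == j) = false by lia. have e2 : (i.+1 == j) = false by lia.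
have e3 : (i == j.+1) = false by lia. have e4 : (i.+1 == j.+1) = false by lia.
have e5 : (j == i) = false by lia. have e6 : (j == i.+1) = false by lia.
have e9 : (i.+1 == i) = false by lia. have e10 : (j.+1 == j) = false by lia.
have e7 : (j.+1 == i) = false by lia. have e8 : (j.+1 == i.+1) = false by lia.
case: (l =P i) => [->|/eqP/negPf h1]; first by rewrite /swapn;
  do 3! rewrite ?(eqxx, e1, e2, e3, e4, e5, e6, e7, e8, e9, e10) //=.
case: (l =P i.+1) => [->|/eqP/negPf h2]; first by rewrite /swapn;
  do 3! rewrite ?(eqxx, e1, e2, e3, e4, e5, e6, e7, e8, e9, e10) //=.
case: (l =P j) => [->|/eqP/negPf h3]; first by rewrite /swapn;
  do 3! rewrite ?(eqxx, e1, e2, e3, e4, e5, e6, e7, e8, e9, e10) //=.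
case: (l =P j.+1) => [->|/eqP/negPf h4]; first by rewrite /swapn;
  do 3! rewrite ?(eqxx, e1, e2, e3, e4, e5, e6, e7, e8, e9, e10) //=.
by rewrite /swapn; do 2! rewrite ?(h1, h2, h3, h4) //=.
Qed.

Lemma swapn_pred i j : (0 < i)%N -> (1 < j)%N -> (swapn i.+1 j).-1 = swapn i j.-1.
Proof.
by move=> hi; case: j => [|[|j]] // _; rewrite /swapn /= !eqSS; case: eqP => // _; case: eqP.
Qed.

Lemma swapn_gt1 i j : (0 < i)%N -> (1 < j)%N -> (1 < swapn i.+1 j)%N.
Proof. by rewrite /swapn; case: eqP; [lia|case: eqP; lia]. Qed.

Section AffineActionIntro.
Variables (K F : fieldType) (n : nat) (kF : {rmorphism K -> F}) (q : K) (XF : nat -> F).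
Variables (sF : nat -> {rmorphism F -> F}) (om : {rmorphism F -> F}).
Hypothesis n0 : (0 < n)%N.
Hypothesis ext : forall f g : {rmorphism F -> F}, (forall c, f (kF c) = g (kF c)) ->
  (forall i, (0 < i <= n)%N -> f (XF i) = g (XF i)) -> f =1 g.
Hypothesis sF_k : forall i c, sF i (kF c) = kF c.
Hypothesis WF_k : forall c, om (kF c) = kF c.
Hypothesis sF_X : forall i j, (0 < i < n)%N -> (0 < j <= n)%N -> sF i (XF j) = XF (swapn i j).
Hypothesis WF_Xn : forall j, (0 < j <= n)%N ->
  om (XF j) = if j == 1%N then kF q * XF n else XF j.-1.
Hypothesis XD : forall i j, (0 < i <= n)%N -> (0 < j <= n)%N -> i != j -> XF i != XF j.
Hypothesis X0 : forall i, (0 < i <= n)%N -> XF i != 0.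

Lemma affine_action_intro : affine_action n kF q XF sF om.
Proof.
split.
- exact: sF_k.
- exact: WF_k.
- exact: sF_X.
- move=> i hi f; suff E : (sF i \o sF i) =1 idfun by exact: (E f).
  apply: ext => [c|j hj] /=.
    by rewrite !sF_k.
  by rewrite sF_X // sF_X ?swapn_bound // swapnK.
- move=> i f hi hin.
  suff E : sF i \o (sF i.+1 \o sF i) =1 sF i.+1 \o (sF i \o sF i.+1) by exact: (E f).
  apply: ext => [c|j hj] /=.
    by rewrite !sF_k.
  have hi1 : (0 < i < n)%N by lia.
  have hi2 : (0 < i.+1 < n)%N by lia.
  by rewrite !sF_X ?swapn_bound // swapn_braid.
- move=> i j f hi hj.
  suff E : sF i \o sF j =1 sF j \o sF i by exact: (E f).
  apply: ext => [c|l hl] /=; first by rewrite !sF_k.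
  have hi1 : (0 < i < n)%N by lia.
  have hi2 : (0 < j < n)%N by lia.
  by rewrite !sF_X ?swapn_bound // swapn_comm //; lia.
- by rewrite WF_Xn.
- move=> i hi; rewrite WF_Xn; try lia.
  by have -> : (i.+1 == 1)%N = false by lia.
- move=> i f hi hin.
  suff E : om \o sF i.+1 =1 sF i \o om by exact: (E f).
  apply: ext => [c|j hj] /=.
    by rewrite sF_k WF_k sF_k.
  have hi1 : (0 < i < n)%N by lia.
  have hi2 : (0 < i.+1 < n)%N by lia.
  rewrite sF_X // !WF_Xn ?swapn_bound //.
  case: (j =P 1%N) => [->|h1].
    rewrite rmorphM /= sF_k sF_X //; last lia.
    rewrite (@swapnN i.+1 1) ?(@swapnN i n) ?eqxx //; lia.
  rewrite sF_X //; last lia.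
  have h1' : (1 < j)%N by lia.
  by rewrite swapn_pred //; have -> : (swapn i.+1 j == 1)%N = false by have := swapn_gt1 hi h1';
    lia.
- move=> f hn.
  suff E : (om \o om) \o sF 1 =1 sF n.-1 \o (om \o om) by exact: (E f).
  apply: ext => [c|j hj] /=.
    by rewrite sF_k !WF_k sF_k.
  have hn1 : (0 < n.-1 < n)%N by lia.
  have W1 : om (XF 1) = kF q * XF n by rewrite WF_Xn.
  have W2 : om (XF 2) = XF 1 by rewrite WF_Xn.
  have Wn : om (XF n) = XF n.-1 by rewrite WF_Xn ?leqnn ?andbT; [case: eqP => //; lia|lia].
  have sn : sF n.-1 (XF n.-1) = XF n.
    by rewrite sF_X //; [rewrite swapnL; congr XF; lia|lia].
  have snn : sF n.-1 (XF n) = XF n.-1.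
    by rewrite -sn; have := @sF_X n.-1 _ hn1; rewrite !sF_X ?swapn_bound ?swapnK //; lia.
  rewrite sF_X //.
  case: (j =P 1%N) => [->|h1].
    by rewrite swapnL W2 W1 !rmorphM /= WF_k Wn sF_k sn.
  case: (j =P 2%N) => [->|h2].
    by rewrite swapnR W1 W2 rmorphM /= WF_k Wn W1 rmorphM /= sF_k snn.
  rewrite swapnN; try lia.
  have E : om (XF j) = XF j.-1 by rewrite WF_Xn //; case: eqP.
  have E2 : om (XF j.-1) = XF j.-2 by rewrite WF_Xn; [case: eqP => //; lia|lia].
  by rewrite E E2 sF_X ?swapnN //; lia.
- exact: XD.
- exact: X0.
Qed.
End AffineActionIntro.

Section Concrete.
Variables (K : fieldType) (n : nat).
Notation P := {mpoly K[n]}.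
Notation F := {fraction P}.
Notation xv := (xv K n).

Lemma xv_ord (j : 'I_n) : xv j.+1 = 'X_j.
Proof. by rewrite /Defs.xv /= valK. Qed.

Lemma xvE i (h : (0 < i <= n)%N) : exists2 j : 'I_n, i = j.+1 & xv i = 'X_j.
Proof.
have h' : (i.-1 < n)%N by lia.
exists (Ordinal h') => /=; first lia.
rewrite -(xv_ord (Ordinal h')); congr xv; rewrite /=; lia.
Qed.

Definition nsub (g : nat -> P) : P -> P := comp_mpoly [tuple g j.+1 | j < n].
HB.instance Definition _ g := GRing.RMorphism.on (nsub g).

Lemma nsub_xv g i : (0 < i <= n)%N -> nsub g (xv i) = g i.
Proof.
by move=> /xvE [j -> ->]; rewrite /nsub comp_mpolyXU -tnth_nth tnth_mktuple.
Qed.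

Lemma nsubC g c : nsub g c%:MP = c%:MP.
Proof. exact: comp_mpolyC. Qed.

Lemma nsubZ g c p : nsub g (c *: p) = c *: nsub g p.
Proof. by rewrite -!mul_mpolyC rmorphM /= nsubC. Qed.

Lemma nsubK g h : (forall i, (0 < i <= n)%N -> nsub h (g i) = xv i) -> cancel (nsub g) (nsub h).
Proof.
move=> e p; rewrite -[RHS]/(idfun p).
apply: (@mpoly_rmorph_ext _ _ _ (nsub h \o nsub g) idfun) => [c|j] /=; first by rewrite !nsubC.
by rewrite -xv_ord nsub_xv ?e // ltn_ord.
Qed.

Definition kF : {rmorphism K -> F} := @FracField.tofrac P \o @mpolyC n K.
Definition XF i : F := (xv i)%:F.

Lemma kFE c : kF c = c%:MP%:F.
Proof. by []. Qed.

#[global] Opaque kF.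
Lemma tofracZ c (p : P) : (c *: p)%:F = kF c * p%:F.
Proof. by rewrite -mul_mpolyC tofracM kFE. Qed.

Lemma F_rmorph_ext (S : fieldType) (f g : {rmorphism F -> S}) :
  (forall c, f (kF c) = g (kF c)) -> (forall i, (0 < i <= n)%N -> f (XF i) = g (XF i)) -> f =1 g.
Proof.
move=> hC hX; apply: frac_rmorph_ext => p.
apply: (@mpoly_rmorph_ext _ _ _ (f \o @FracField.tofrac P) (g \o @FracField.tofrac P)) => [c|j] /=.
  by rewrite -kFE hC.
by have := hX j.+1 (ltn_ord j); rewrite /XF xv_ord.
Qed.

Definition gs i j := if (0 < i < n)%N then xv (swapn i j) else xv j.
Lemma gs_inj i : injective (nsub (gs i)).
Proof.
apply: (can_inj (g := nsub (gs i))); apply: nsubK => j hj; rewrite /gs.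
case: ifP => hi; last by rewrite nsub_xv.
by rewrite nsub_xv ?swapn_bound // swapnK.
Qed.

Definition sF i : {rmorphism F -> F} := frac_lift (@gs_inj i).

Lemma sF_tofrac i p : sF i p%:F = (nsub (gs i) p)%:F.
Proof. exact: frac_lift_tofrac. Qed.

Section Om.
Variable q : K.
Hypothesis q0 : q != 0.
Definition gW m j := if j == 1%N then q *: xv m.+1 else if (j <= m.+1)%N then xv j.-1 else xv j.
Definition gV m j := if j == m.+1 then q^-1 *: xv 1 else if (j <= m)%N then xv j.+1 else xv j.
Lemma gW_inj m : injective (nsub (gW (minn m n.-1))).
Proof.
apply: (can_inj (g := nsub (gV (minn m n.-1)))); apply: nsubK => j hj; rewrite /gW.
case: eqP => [->|hj1].
  by rewrite nsubZ nsub_xv /gV ?eqxx ?scalerA ?mulfV ?scale1r //; lia.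
case: ifP => h; rewrite nsub_xv ?/gV; try lia.
  case: eqP; first lia.
  by case: ifP; [move=> *; congr xv; lia|lia].
case: eqP; first lia.
by case: ifP; [lia|].
Qed.

(* WF m is s_m ... s_1 tau_1, so that WF (n - 1) is omega; the minn only makes it injective
   for m >= n. *)
Definition WF m : {rmorphism F -> F} := frac_lift (@gW_inj m).

Lemma WF_tofrac m p : WF m p%:F = (nsub (gW (minn m n.-1)) p)%:F.
Proof. exact: frac_lift_tofrac. Qed.

#[global] Opaque kF sF WF.

Lemma sF_k i c : sF i (kF c) = kF c.
Proof. by rewrite kFE sF_tofrac nsubC. Qed.

Lemma WF_k m c : WF m (kF c) = kF c.
Proof. by rewrite kFE WF_tofrac nsubC. Qed.

Lemma sF_X i j : (0 < i < n)%N -> (0 < j <= n)%N -> sF i (XF j) = XF (swapn i j).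
Proof. by move=> hi hj; rewrite sF_tofrac nsub_xv // /gs hi. Qed.

Lemma WF_X m j : (0 < j <= n)%N -> (m < n)%N -> WF m (XF j) =
  if j == 1%N then kF q * XF m.+1 else if (j <= m.+1)%N then XF j.-1 else XF j.
Proof.
move=> hj hm; rewrite WF_tofrac nsub_xv // /gW.
have -> : minn m n.-1 = m by lia.
by do 2?case: ifP => _ //; rewrite tofracZ.
Qed.

Lemma WF_Xn j : (0 < j <= n)%N -> WF n.-1 (XF j) = if j == 1%N then kF q * XF n else XF j.-1.
Proof.
move=> hj; have e : n.-1.+1 = n by lia.
rewrite WF_X // e ?leqnn //; first by have -> : (j <= n)%N by lia.
Qed.

Lemma affine_action_F : (0 < n)%N -> affine_action n kF q XF sF (WF n.-1).
Proof.
move=> n0; apply: affine_action_intro => //.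
- exact: F_rmorph_ext.
- exact: sF_k.
- exact: WF_k.
- exact: sF_X.
- exact: WF_Xn.
- move=> i j hi hj hij; rewrite /XF tofrac_eq.
  have [a ea ->] := xvE hi; have [b eb ->] := xvE hj.
  apply/eqP => /mpolyP /(_ U_(a)%MM); rewrite !mcoeffXU eqxx.
  have /negPf -> : b != a by apply: contra hij => /eqP e; rewrite ea eb e.
  by move/eqP; rewrite oner_eq0.
- move=> i hi; rewrite /XF tofrac_eq0; have [a ea ->] := xvE hi.
  apply/eqP => /mpolyP /(_ U_(a)%MM); rewrite mcoeffXU eqxx mcoeff0.
  by move/eqP; rewrite oner_eq0.
Qed.
End Om.
End Concrete.

Section Laurent.
Variables (K : fieldType) (n : nat).
Notation P := {mpoly K[n]}.
Notation F := {fraction P}.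
Notation laur := (laur K n).
Notation kF := (kF K n).
Notation XF := (XF K n).
Notation sF := (sF K n).
Notation xprod := (xprod K n).

Lemma xprodE : xprod = 'X_[[multinom 1%N | _ < n]].
Proof.
rewrite /Defs.xprod mpolyXE_id; apply: eq_bigr => j _.
by rewrite mnmE expr1.
Qed.

Lemma xprodX m : xprod ^+ m = 'X_[[multinom m | _ < n]].
Proof.
rewrite xprodE mpolyXn; congr 'X_[_].
by apply/mnmP => j; rewrite mulmnE !mnmE mul1n.
Qed.

Lemma xprod_neq0 m : (xprod ^+ m)%:F != 0.
Proof.
rewrite tofrac_eq0 xprodX; apply/eqP => /mpolyP /(_ [multinom m | _ < n]).
by rewrite mcoeffX eqxx mcoeff0 => /eqP; rewrite oner_eq0.
Qed.

Lemma mcoeffMX_lt (p : P) w b : ~~ (w <= b)%MM -> (p * 'X_[w])@_b = 0.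
Proof.
move=> h; apply/eqP; rewrite mcoeff_eq0; apply: contra h.
rewrite (perm_mem (msuppMX p w)) => /mapP [m' _ ->].
exact: lem_addr.
Qed.

Lemma lcoef_shift k m (p : P) a : lcoef ((k + m)%N, p * xprod ^+ m) a = lcoef (k, p) a.
Proof.
rewrite /lcoef /=; case: ifP => [/forallP h1|/forallP h1]; last first.
  case: ifP => // /forallP h2; case: h1 => j; have := h2 j; lia.
rewrite xprodX; case: ifP => [/forallP h2|/forallP h2].
  set b := (X in (_ * _)@_X).
  have -> : b = ([multinom m | _ < n] + [multinom absz (tnth a j + k%:Z)%R | j < n])%MM.
    apply/mnmP => j; rewrite mnmDE !mnmE; have := h2 j; lia.
  exact: mcoeffMX.
apply: mcoeffMX_lt; apply/negP => /mnm_lepP h3; apply: h2 => j.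
by have := h3 j; have := h1 j; rewrite !mnmE; lia.
Qed.

(* A Laurent polynomial (k, p) as the rational function p / (x_1 ... x_n)^k. *)
Definition lval (f : laur) : F := f.2%:F / (xprod ^+ f.1)%:F.

Lemma leqL_lval f g : lval f = lval g -> leqL f g.
Proof.
case: f g => [k p] [k' p']; rewrite /lval /= => /eqP.
rewrite eqr_div ?xprod_neq0 // -!tofracM tofrac_eq => /eqP e a.
by rewrite -(lcoef_shift k k') e addnC lcoef_shift.
Qed.

Lemma leqL_lpoly (p p' : P) : leqL (lpoly p) (lpoly p') -> p = p'.
Proof.
move=> h; apply/mpolyP => m.
have := h [tuple (m j)%:Z | j < n]; rewrite /lcoef /=.
have -> : [forall j, (0 <= tnth [tuple (m j0)%:Z | j0 < n] j + 0%:Z)%R].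
  by apply/forallP => j; rewrite tnth_mktuple addr0.
have -> // : [multinom `|(tnth [tuple (m j0)%:Z | j0 < n] j + 0%:Z)%R|%N | j < n] = m.
by apply/mnmP => j; rewrite mnmE tnth_mktuple addr0.
Qed.

Lemma lval_lpoly (p : P) : lval (lpoly p) = p%:F.
Proof. by rewrite /lval /= tofrac1 divr1. Qed.

Lemma addf_div_mul (L : fieldType) (a b c d : L) : b != 0 -> d != 0 ->
  (a * d + c * b) / (b * d) = a / b + c / d.
Proof. by move=> hb hd; field; rewrite hb hd. Qed.

Lemma lval_add f g : lval (ladd f g) = lval f + lval g.
Proof.
by rewrite /lval /= tofracD !tofracM exprD tofracM addf_div_mul ?xprod_neq0.
Qed.

Lemma lval_scale c f : lval (lscale c f) = kF c * lval f.
Proof. by rewrite /lval /= tofracZ mulrA. Qed.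

Lemma lval_sub f g : lval (lsub f g) = lval f - lval g.
Proof. by rewrite lval_add lval_scale rmorphN1 mulN1r. Qed.

Lemma lval_mul f g : lval (lmul f g) = lval f * lval g.
Proof. by rewrite /lval /= tofracM exprD tofracM mulf_div. Qed.

Lemma lval_lmulX i f : lval (lmulX i f) = XF i * lval f.
Proof. by rewrite lval_mul lval_lpoly. Qed.

Lemma lval_linvX i f : (0 < i <= n)%N -> lval (linvX i f) = (XF i)^-1 * lval f.
Proof.
move=> hi; rewrite lval_mul; congr (_ * _); rewrite /lval /= expr1 /XF.
have [j ej ->] := xvE K hi.
have -> : \prod_(k < n | k.+1 != i) 'X_k = \prod_(k < n | k != j) 'X_k :> P.
  by apply: eq_bigl => k; rewrite ej eqSS.
set p := \prod_(_ < _ | _) _.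
have -> : xprod = 'X_j * p by rewrite /Defs.xprod (bigD1 j).
rewrite tofracM; have p0 : p%:F != 0.
  rewrite tofrac_eq0 /p; apply/prodf_neq0 => k _.
  apply/eqP => /mpolyP /(_ U_(k)%MM); rewrite mcoeffXU eqxx mcoeff0.
  by move/eqP; rewrite oner_eq0.
by rewrite invfM mulrCA divff ?mulr1.
Qed.

Lemma gs_xprod i : (0 < i < n)%N -> nsub (gs K n i) xprod = xprod.
Proof.
move=> hi; rewrite /Defs.xprod rmorph_prod /=.
have sb (j : 'I_n) : ((swapn i j.+1).-1 < n)%N.
  by have := @swapn_bound n i j.+1 hi (ltn_ord j); lia.
pose sw (j : 'I_n) := Ordinal (sb j).
have sw1 (j : 'I_n) : (sw j).+1 = swapn i j.+1.
  by rewrite /=; have := @swapn_bound n i j.+1 hi (ltn_ord j); lia.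
have swK : involutive sw.
  by move=> j; apply/ord_inj/succn_inj; rewrite !sw1 swapnK.
rewrite [RHS](reindex_inj (inv_inj swK)); apply: eq_bigr => j _.
by rewrite -xv_ord nsub_xv ?ltn_ord // /gs hi -sw1 xv_ord.
Qed.

Lemma ls_nsub i (f : laur) : (0 < i < n)%N -> ls i f = (f.1, nsub (gs K n i) f.2).
Proof.
move=> hi; rewrite /ls /nsub; congr (_, comp_mpoly _ _).
by apply: eq_from_tnth => j; rewrite !tnth_mktuple /gs hi.
Qed.

Lemma lval_ls i f : (0 < i < n)%N -> lval (ls i f) = sF i (lval f).
Proof.
move=> hi; rewrite ls_nsub // /lval fmorph_div !sF_tofrac /=.
have -> // : nsub (gs K n i) (xprod ^+ f.1) = xprod ^+ f.1 by rewrite rmorphXn /= gs_xprod.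
Qed.

Lemma nsub_divd i p : (0 < i < n)%N ->
  exists h, nsub (gs K n i) p - p = (xv K n i - xv K n i.+1) * h.
Proof.
move=> hi; set s := nsub _; set d := xv _ _ _ - _.
pose Q p := exists h, s p - p = d * h.
have QM a b : Q a -> Q b -> Q (a * b).
  move=> [h e] [h' e']; exists (h * s b + a * h').
  by rewrite /s rmorphM /= -/s mulrDr mulrA -e mulrCA -e' mulrBl mulrBr addrA subrK.
have Q1 : Q 1 by exists 0; rewrite /s rmorph1 subrr mulr0.
have QX j : Q 'X_j.
  rewrite -xv_ord /Q /s nsub_xv ?ltn_ord // /gs hi /swapn.
  case: eqP => [->|_]; first by exists (-1); rewrite mulrN1 opprB.
  case: eqP => [->|_]; first by exists 1; rewrite mulr1.
  by exists 0; rewrite subrr mulr0.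
have Qp : Q p.
  rewrite [p]mpolyE; apply: (big_ind Q) => [|a b [h e] [h' e']|m _].
  - by exists 0; rewrite /s rmorph0 subrr mulr0.
  - by exists (h + h'); rewrite /s rmorphD /= -/s opprD addrACA e e' mulrDr.
  - rewrite -mul_mpolyC; apply: (QM); first by exists 0; rewrite /s nsubC subrr mulr0.
    rewrite mpolyXE_id; apply: (big_ind Q) => [|a b ha hb|j _]; [exact: Q1|exact: QM|].
    by elim: (m j) => [|l IH]; rewrite ?expr0 // exprS; apply: (QM).
exact: Qp.
Qed.

Lemma pick0P (T : Type) (x0 : T) (Q : T -> Prop) : (exists x, Q x) -> Q (pick0 x0 Q).
Proof. exact: epsilon_spec. Qed.

Lemma lval_ldivd i f : XF i - XF i.+1 != 0 ->
  (exists h, f.2 = (xv K n i - xv K n i.+1) * h) ->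
  lval (ldivd i f) = lval f / (XF i - XF i.+1).
Proof.
move=> d0 /(pick0P 0) e; rewrite /lval /=; set h := pick0 _ _ in e *.
by rewrite e tofracM tofracB mulrAC [_ * h%:F]mulrC mulfK.
Qed.

Section Tau.
Variable q : K.
Hypothesis q0 : q != 0.

Lemma gW_xprod : (0 < n)%N -> nsub (gW n q 0) xprod = q *: xprod.
Proof.
move=> n0; have -> : xprod = 'X_(Ordinal n0) * \prod_(j < n | j != Ordinal n0) 'X_j.
  by rewrite /Defs.xprod (bigD1 (Ordinal n0)).
rewrite rmorphM rmorph_prod /= -(xv_ord K (Ordinal n0)) nsub_xv //.
rewrite {1}/gW eqxx -scalerAl; congr (_ *: (_ * _)); apply: eq_bigr => j hj.
rewrite -(xv_ord K j) nsub_xv ?ltn_ord // /gW.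
have -> : (j.+1 == 1%N) = false by apply/negbTE; apply: contra hj.
have -> // : (j.+1 <= 1)%N = false by move: hj; rewrite -val_eqE /=; lia.
Qed.

Lemma ltau_nsub (f : laur) : ltau q 1 f = (f.1, q ^- f.1 *: nsub (gW n q 0) f.2).
Proof.
rewrite /ltau /nsub; set u := mktuple _; set v := mktuple _.
suff -> : u = v by [].
apply: eq_from_tnth => j; rewrite !tnth_mktuple /gW; case: eqP => [->//|h].
by have -> : (j.+1 <= 1)%N = false by lia.
Qed.

Lemma lval_ltau f : (0 < n)%N -> lval (ltau q 1 f) = WF n q0 0 (lval f).
Proof.
move=> n0; rewrite ltau_nsub // /lval fmorph_div !WF_tofrac /= min0n.
have -> : nsub (gW n q 0) (xprod ^+ f.1) = q ^+ f.1 *: xprod ^+ f.1.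
  by rewrite rmorphXn /= gW_xprod // exprZn.
by rewrite !tofracZ fmorphV invfM mulrCA mulrA.
Qed.
End Tau.

Variables (q t : K).
Hypothesis q0 : q != 0.
Hypothesis n0 : (0 < n)%N.
Notation om := (WF n q0 n.-1).
Notation TF := (hT kF t XF sF).
Notation TiF := (hTi kF t XF sF).
Notation YF := (hY n kF t XF sF om).
Notation DF := (hD n kF t XF sF om).

Let act := affine_action_F q0 n0.

Lemma lval_lT i f : (0 < i < n)%N -> lval (lT t i f) = TF i (lval f).
Proof.
move=> hi; rewrite /lT lval_add lval_scale lval_mul lval_lpoly tofracB tofracZ.
rewrite lval_ldivd; last first.
- rewrite ls_nsub //=; have [h e] := nsub_divd f.2 hi.
  by exists (h * xprod ^+ f.1); rewrite mulrA -e mulrBl scaleN1r mulNr.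
- by apply: (subX_neq0 act); lia.
by rewrite lval_sub lval_ls // /hT [RHS]addrC mulrAC mulrA [RHS]addrC.
Qed.

Lemma lval_lTinv i f : (0 < i < n)%N -> lval (lTinv t i f) = TiF i (lval f).
Proof.
by move=> hi; rewrite /lTinv lval_add !lval_scale lval_lT // rmorphB rmorph1.
Qed.

Lemma lval_opprod (A : nat -> laur -> laur) (B : nat -> F -> F) l f :
  (forall i g, i \in l -> lval (A i g) = B i (lval g)) ->
  lval (opprod A l f) = foldr B (lval f) l.
Proof.
elim: l => //= i l IH h; rewrite h ?mem_head // IH // => j g hj.
by rewrite h // in_cons hj orbT.
Qed.

Lemma sF_WF m f : (m.+1 < n)%N -> sF m.+1 (WF n q0 m f) = WF n q0 m.+1 f.
Proof.
move=> hm.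
suff E : sF m.+1 \o WF n q0 m =1 WF n q0 m.+1 by exact: (E f).
apply: F_rmorph_ext => [c|i hi] /=;
  first by rewrite (WF_k n q0 m c) (sF_k n m.+1 c) (WF_k n q0 m.+1 c).
have hm1 : (m < n)%N by lia.
rewrite (WF_X q0 hi hm1) (WF_X q0 hi hm).
have hs : (0 < m.+1 < n)%N by lia.
case: eqP => [_|h1].
  by rewrite rmorphM /= (sF_k n m.+1 q) (sF_X K hs) ?swapnL //; lia.
case: ifP => h2.
  have -> : (i <= m.+2)%N by lia.
  rewrite (sF_X K hs); last lia.
  by rewrite swapnN //; lia.
rewrite (sF_X K hs) //; case: ifP => h3; last by rewrite swapnN //; lia.
have -> : i = m.+2 by lia.
by rewrite swapnR.
Qed.

Lemma lval_lomega f : lval (lomega q f) = om (lval f).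
Proof.
rewrite /lomega (lval_opprod (B := sF)); last first.
  by move=> i g; rewrite mem_rev mem_iota => hi; apply: lval_ls; lia.
rewrite (lval_ltau q0) //.
have : (n.-1 < n)%N by lia.
elim: n.-1 => [//|m IH] hm.
have -> : iota 1 m.+1 = rcons (iota 1 m) m.+1 by rewrite -cats1; have := iotaD 1 m 1;
  rewrite addn1 add1n.
rewrite rev_rcons /= IH; last lia.
exact: sF_WF.
Qed.

Lemma lval_lY i f : (0 < i <= n)%N -> lval (lY q t i f) = YF i (lval f).
Proof.
move=> hi; rewrite /lY lval_scale (lval_opprod (B := TF)); last first.
  by move=> j g; rewrite mem_iota => hj; apply: lval_lT; lia.
rewrite lval_lomega (lval_opprod (B := TiF)) // => j g.
by rewrite mem_iota => hj; apply: lval_lTinv; lia.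
Qed.

Lemma lval_lTijinv i j f : (0 < i < j)%N -> (j <= n)%N ->
  lval (lTijinv t i j f) = hTij kF t XF sF i j (lval f).
Proof.
move=> hi hj; rewrite /lTijinv (lval_opprod (B := TiF)) // => l g.
rewrite mem_cat in_cons mem_rev mem_iota => hl; apply: lval_lTinv; lia.
Qed.

Lemma lval_lD i f : (0 < i <= n)%N -> lval (lD q t i f) = DF i (lval f).
Proof.
move=> hi; rewrite /lD lval_linvX // lval_sub lval_scale lval_add lval_scale lval_lY //.
rewrite /hD /hB; congr (_ * (_ - _ * (_ + _ * _))).
have : forall j, j \in iota i.+1 (n - i) -> (0 < i < j)%N && (j <= n)%N.
  by move=> j; rewrite mem_iota; lia.
elim: (iota _ _) => [|j l IH] h; first by rewrite big_nil lval_lpoly tofrac0.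
rewrite big_cons /= lval_add IH; last by move=> l' hl; apply: h; rewrite in_cons hl orbT.
have /andP[h1 h2] := h j (mem_head _ _).
by rewrite lval_scale lval_lTijinv // lval_lY.
Qed.

Lemma lval_lPhi f : lval (lPhi t f) = XF n * foldr TiF (lval f) (rev (iota 1 n.-1)).
Proof.
rewrite /lPhi lval_lmulX (lval_opprod (B := TiF)) // => j g.
by rewrite mem_rev mem_iota => hj; apply: lval_lTinv; lia.
Qed.

Lemma lval_lPhihat f : lval (lPhihat q t f) = foldr TF (DF n (lval f)) (iota 1 n.-1).
Proof.
rewrite /lPhihat (lval_opprod (B := TF)) ?lval_lD //; first lia.
by move=> j g; rewrite mem_iota => hj; apply: lval_lT; lia.
Qed.
End Laurent.

Section Dominance.
Local Open Scope nat_scope.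
Variable n : nat.
Implicit Types nu eta mu : 'X_{1..n}.

Definition ple nu eta : Prop :=
  domle n (dplus nu) (dplus eta) /\ (dplus nu = dplus eta -> domle n nu eta).

Lemma domleP (s r : seq nat) :
  reflect (forall p, p <= n -> sumn (take p s) <= sumn (take p r)) (domle n s r).
Proof.
apply: (iffP forallP) => h p; last by apply: h; rewrite -ltnS.
by move=> hp; have := h (inord p); rewrite inordK.
Qed.

Lemma domle_refl s : domle n s s. Proof. by apply/domleP. Qed.

Lemma domle_trans r s u : domle n s r -> domle n r u -> domle n s u.
Proof.
by move=> /domleP h1 /domleP h2; apply/domleP => p hp; apply: leq_trans (h1 p hp) (h2 p hp).
Qed.

Lemma sumn_takeS (s : seq nat) p : sumn (take p.+1 s) = sumn (take p s) + nth 0 s p.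
Proof.
elim: s p => [|x s IH] [|p] //=; first by rewrite take0 /= addn0.
by rewrite IH addnA.
Qed.

Lemma domle_anti s r : size s = n -> size r = n -> domle n s r -> domle n r s -> s = r.
Proof.
move=> hs hr /domleP h1 /domleP h2.
have h p : p <= n -> sumn (take p s) = sumn (take p r).
  by move=> hp; apply/eqP; rewrite eqn_leq h1 ?h2.
apply: (@eq_from_nth _ 0); first by rewrite hs hr.
move=> p; rewrite hs => hp; have := h _ hp.
by rewrite !sumn_takeS h ?(ltnW hp) // => /addnI.
Qed.

Lemma size_dplus nu : size (dplus nu) = n.
Proof. by rewrite size_sort size_tuple. Qed.

Lemma ple_refl nu : ple nu nu.
Proof. by split=> [|_]; exact: domle_refl. Qed.

Lemma ple_trans mu nu eta : ple nu mu -> ple mu eta -> ple nu eta.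
Proof.
move=> [h1 h2] [h3 h4]; split; first exact: domle_trans h1 h3.
move=> e; have e' : dplus nu = dplus mu.
  by apply: domle_anti; rewrite ?size_dplus // e.
by apply: domle_trans (h2 e') (h4 _); rewrite -e'.
Qed.

Lemma ple_anti nu eta : ple nu eta -> ple eta nu -> nu = eta.
Proof.
move=> [h1 h2] [h3 h4]; have e : dplus nu = dplus eta by apply: domle_anti; rewrite ?size_dplus.
apply/val_inj/val_inj; apply: domle_anti; rewrite ?size_tuple //; first exact: h2.
exact: h4.
Qed.

Lemma ple_prec nu eta : ple nu eta -> nu = eta \/ prec nu eta.
Proof.
move=> [h1 h2]; case: (nu =P eta) => [|h]; [by left|right; split=> //].
by case: (dplus nu =P dplus eta) => e; [right; split=> //; apply: h2|left].
Qed.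

Lemma sumn_take_mnm nu p : sumn (take p nu) = \sum_(j < n | j < p) nu j.
Proof.
elim: p => [|p IH]; first by rewrite take0 big_pred0.
rewrite sumn_takeS IH; case: (ltnP p n) => hp; last first.
  rewrite nth_default ?size_tuple // addn0; apply: eq_bigl => j.
  by have := ltn_ord j; lia.
rewrite [in RHS](bigD1 (Ordinal hp)) //= addnC (mnm_nth 0); congr (_ + _).
by apply: eq_bigl => j; rewrite -val_eqE /=; lia.
Qed.

Definition excess c nu := \sum_(j < n) (nu j - c).

Lemma excess_seq c nu : excess c nu = sumn [seq x - c | x <- dplus nu].
Proof.
have -> : sumn [seq x - c | x <- dplus nu] = sumn [seq x - c | x <- (nu : seq nat)].
  by apply: perm_sumn; apply: perm_map; rewrite perm_sort.
have -> : (nu : seq nat) = [seq nu j | j <- enum 'I_n].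
  apply: (@eq_from_nth _ 0); first by rewrite size_map size_enum_ord size_tuple.
  move=> p; rewrite size_tuple => hp.
  by rewrite (nth_map (Ordinal hp)) ?size_enum_ord // (mnm_nth 0) nth_enum_ord.
by rewrite -map_comp sumnE big_map big_enum.
Qed.

Lemma sumn_take_le_excess (s : seq nat) p c :
  sumn (take p s) <= p * c + sumn [seq x - c | x <- s].
Proof.
elim: s p => [|x s IH] [|p] //=.
by have := IH p; rewrite mulSn; lia.
Qed.

Lemma sumn_take_excess (s : seq nat) p : sorted geq s -> p <= size s ->
  sumn (take p s) = p * nth 0 s p + sumn [seq x - nth 0 s p | x <- s].
Proof.
elim: s p => [|x s IH] [|p] //= hs hp.
- have : all (geq x) s by apply: order_path_min hs => a b c; rewrite /geq /=; lia.
  rewrite subnn !add0n; elim: s {IH hs hp} => //= y s IH /andP[h1 h2].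
  by rewrite -IH //; move: h1; rewrite /geq /=; lia.
- rewrite (IH p) //; last exact: path_sorted hs.
  have : nth 0 s p <= x.
    case: (ltnP p (size s)) => h; last by rewrite nth_default.
    have : all (geq x) s by apply: order_path_min hs => a b c; rewrite /geq /=; lia.
    by move/all_nthP => /(_ 0 p h).
  by rewrite mulSn; lia.
Qed.

Lemma excess_domle nu eta : (forall c, excess c nu <= excess c eta) ->
  domle n (dplus nu) (dplus eta).
Proof.
move=> h; apply/domleP => p hp.
have hsort : sorted geq (dplus eta).
  by apply: sort_sorted => a b; rewrite /geq /=; lia.
rewrite (sumn_take_excess hsort) ?size_dplus //.
apply: leq_trans (sumn_take_le_excess _ _ (nth 0 (dplus eta) p)) _.
by rewrite leq_add2l -!excess_seq.
Qed.

(* [mu] is obtained from [eta] by moving the entries at [a], [b] strictly closer together *)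
Definition inner (a b : 'I_n) eta mu : Prop :=
  [/\ forall j, j != a -> j != b -> mu j = eta j, mu a + mu b = eta a + eta b &
      maxn (mu a) (mu b) < maxn (eta a) (eta b)].

Lemma excess_split c nu (a b : 'I_n) : a != b ->
  excess c nu = (nu a - c) + ((nu b - c) + \sum_(j < n | (j != a) && (j != b)) (nu j - c)).
Proof.
move=> hab; rewrite /excess (bigD1 a) //=; congr (_ + _).
by rewrite (bigD1 b) 1?eq_sym.
Qed.

Lemma inner_ple a b eta mu : a != b -> inner a b eta mu -> ple mu eta /\ dplus mu <> dplus eta.
Proof.
move=> hab [h1 h2 h3].
have e c : \sum_(j < n | (j != a) && (j != b)) (mu j - c) =
           \sum_(j < n | (j != a) && (j != b)) (eta j - c).
  by apply: eq_bigr => j /andP[ha hb]; rewrite h1.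
have hex c : excess c mu <= excess c eta.
  by rewrite !(@excess_split _ _ a b) // e !addnA leq_add2r; lia.
have hne : dplus mu <> dplus eta.
  move=> ed; have : excess (maxn (eta a) (eta b)).-1 mu = excess (maxn (eta a) (eta b)).-1 eta.
    by rewrite !excess_seq ed.
  by rewrite !(@excess_split _ _ a b) // e !addnA => /addIn; lia.
by split=> //; split; first exact: excess_domle.
Qed.

Definition mswap (a b : 'I_n) eta : 'X_{1..n} := [multinom eta (tperm a b j) | j < n].

Lemma dplus_mswap a b eta : dplus (mswap a b eta) = dplus eta.
Proof.
apply: domle_anti; rewrite ?size_dplus //; apply: excess_domle => c; rewrite /excess.
  rewrite [X in _ <= X](reindex_inj (@perm_inj _ (tperm a b))) /=.
  by apply: leq_sum => j _; rewrite mnmE.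
rewrite (reindex_inj (@perm_inj _ (tperm a b))) /=.
by apply: leq_sum => j _; rewrite mnmE.
Qed.

Lemma mswap_ple (a b : 'I_n) eta : a < b -> eta b < eta a -> ple (mswap a b eta) eta.
Proof.
move=> hab h; split; first by rewrite dplus_mswap domle_refl.
move=> _; apply/domleP => p hp; rewrite !sumn_take_mnm.
case: (boolP (a < p <= b)) => hp'.
- rewrite (bigD1 a) /=; last by case/andP: hp'.
  rewrite [X in _ <= X](bigD1 a) /=; last by case/andP: hp'.
  rewrite mnmE tpermL leq_add ?(ltnW h) //; apply: leq_sum => j /andP[hj ja].
  rewrite mnmE tpermD // 1?eq_sym //; apply/eqP => e; move: hj hp'; rewrite e; lia.
- rewrite [X in _ <= X](reindex_inj (@perm_inj _ (tperm a b))) /=.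
  rewrite [X in _ <= X](eq_bigl (fun j : 'I_n => j < p)) => [|j].
    by apply: leq_sum => j _; rewrite mnmE.
  by case: tpermP => [->|->|//]; move: hp' hab; lia.
Qed.

End Dominance.

Section Lin.
Variables (K : fieldType) (n : nat).
Notation P := {mpoly K[n]}.
Definition lin (A : P -> P) := forall c p r, A (c *: p + r) = c *: A p + A r.
Variable A : P -> P.
Hypothesis hA : lin A.
Lemma lin0 : A 0 = 0.
Proof.
have := hA 1 0 0; rewrite !scale1r addr0 => /eqP.
by rewrite -subr_eq subrr => /eqP.
Qed.

Lemma linD p r : A (p + r) = A p + A r.
Proof. by have := hA 1 p r; rewrite !scale1r. Qed.

Lemma linZ c p : A (c *: p) = c *: A p.
Proof. by have := hA c p 0; rewrite lin0 !addr0. Qed.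

Lemma lin_sum (I : Type) (r : seq I) (Q : pred I) (G : I -> P) :
  A (\sum_(i <- r | Q i) G i) = \sum_(i <- r | Q i) A (G i).
Proof. by apply: (big_morph A linD lin0). Qed.

Lemma lin_mpolyE p : A p = \sum_(m <- msupp p) p@_m *: A 'X_[m].
Proof. by rewrite {1}[p]mpolyE lin_sum; apply: eq_bigr => m _; rewrite linZ. Qed.

Lemma lin_coef p mu : (A p)@_mu = \sum_(m <- msupp p) p@_m * (A 'X_[m])@_mu.
Proof.
by rewrite lin_mpolyE raddf_sum /=; apply: eq_bigr => m _; rewrite mcoeffZ.
Qed.

Lemma lin_coef_neq0 p mu : (A p)@_mu != 0 -> exists2 m, p@_m != 0 & (A 'X_[m])@_mu != 0.
Proof.
rewrite lin_coef => h.
case: (boolP (has (fun m => (A 'X_[m])@_mu != 0) (msupp p))) => [/hasP [m hm hm']|/hasPn h'].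
  by exists m => //; rewrite -mcoeff_msupp.
move: h; rewrite big_seq big1 ?eqxx // => m hm.
by have := h' m hm; rewrite negbK => /eqP ->; rewrite mulr0.
Qed.

Lemma lin_coef1 p mu m0 :
  (forall m, p@_m != 0 -> (A 'X_[m])@_mu != 0 -> m = m0) ->
  (A p)@_mu = p@_m0 * (A 'X_[m0])@_mu.
Proof.
move=> h; rewrite lin_coef; case: (boolP (m0 \in msupp p)) => hm0.
  rewrite (bigD1_seq m0) ?msupp_uniq //= big_seq_cond big1 ?addr0 // => m /andP[hm hne].
  case: (eqVneq (A 'X_[m])@_mu 0) => [->|hA']; first by rewrite mulr0.
  by move: hne; rewrite (h m) ?eqxx // -mcoeff_msupp.
rewrite (memN_msupp_eq0 hm0) mul0r big_seq big1 // => m hm.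
case: (eqVneq (A 'X_[m])@_mu 0) => [->|hA']; first by rewrite mulr0.
by move: hm0; rewrite -(h m) ?hm // -mcoeff_msupp.
Qed.
End Lin.

Section Poly.
Variables (K : fieldType) (n : nat).
Notation P := {mpoly K[n]}.
Notation F := {fraction P}.
Notation kF := (kF K n).
Notation XF := (XF K n).
Notation sF := (sF K n).
Variables (q t : K).
Hypothesis q0 : q != 0.
Hypothesis t0 : t != 0.
Hypothesis n0 : (0 < n)%N.
Notation om := (WF n q0 n.-1).
Notation TF := (hT kF t XF sF).
Notation TiF := (hTi kF t XF sF).
Notation YF := (hY n kF t XF sF om).
Let act := affine_action_F q0 n0.

Lemma tofrac_inj : injective (@FracField.tofrac P).
Proof. by move=> p r /eqP; rewrite tofrac_eq => /eqP. Qed.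

(* The operators preserve polynomials; [locked] keeps unification from computing with them. *)
Definition pT i (p : P) : P := locked (lT t i (lpoly p)).2.
Definition pTi i (p : P) : P := locked (lTinv t i (lpoly p)).2.
Definition pY i (p : P) : P := locked (lY q t i (lpoly p)).2.
Definition pom (p : P) : P := locked (nsub (gW n q n.-1) p).

Lemma lval0 (f : laur K n) : f.1 = 0%N -> lval f = f.2%:F.
Proof. by rewrite /lval => ->; rewrite expr0 tofrac1 divr1. Qed.

Lemma tofrac_pT i p : (0 < i < n)%N -> (pT i p)%:F = TF i p%:F.
Proof. by move=> hi; rewrite /pT -lock -(lval_lpoly p) -(lval_lT t q0 n0 _ hi) lval0. Qed.

Lemma tofrac_pTi i p : (0 < i < n)%N -> (pTi i p)%:F = TiF i p%:F.
Proof. by move=> hi; rewrite /pTi -lock -(lval_lpoly p) -(lval_lTinv t q0 n0 _ hi) lval0. Qed.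

Lemma opprod0 (A : nat -> laur K n -> laur K n) l f :
  (forall i g, g.1 = 0%N -> (A i g).1 = 0%N) -> f.1 = 0%N -> (opprod A l f).1 = 0%N.
Proof. by move=> h hf; elim: l => //= i l IH; apply: h. Qed.

Lemma lT0 i (f : laur K n) : f.1 = 0%N -> (lT t i f).1 = 0%N.
Proof. by rewrite /lT /= => ->. Qed.

Lemma lTi0 i (f : laur K n) : f.1 = 0%N -> (lTinv t i f).1 = 0%N.
Proof. by rewrite /lTinv /= => ->. Qed.

Lemma lY0 i (f : laur K n) : f.1 = 0%N -> (lY q t i f).1 = 0%N.
Proof.
move=> hf; rewrite /lY /=; apply: opprod0; first exact: lT0.
rewrite /lomega; apply: opprod0; first by [].
by rewrite /=; apply: opprod0 => //; exact: lTi0.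
Qed.

Lemma lY_lpoly i p : lY q t i (lpoly p) = lpoly (pY i p).
Proof. by rewrite /pY -lock /lpoly; have := @lY0 i (lpoly p) erefl;
  case: (lY _ _ _ _) => a b /= ->. Qed.

Lemma tofrac_pY i p : (0 < i <= n)%N -> (pY i p)%:F = YF i p%:F.
Proof. by move=> hi; rewrite /pY -lock -(lval_lpoly p) -(lval_lY t q0 n0 _ hi) lval0 // lY0. Qed.

Lemma pomE p : pom p = nsub (gW n q n.-1) p.
Proof. by rewrite /pom -lock. Qed.

Lemma tofrac_pom p : (pom p)%:F = om p%:F.
Proof. by rewrite pomE WF_tofrac minnn. Qed.

Lemma pom_lin : lin pom.
Proof. by move=> c p r; rewrite /pom -!lock rmorphD /= nsubZ. Qed.

Lemma pT_lin i : (0 < i < n)%N -> lin (pT i).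
Proof.
move=> hi c p r; apply: tofrac_inj.
by rewrite tofrac_pT // !tofracD !tofracZ !tofrac_pT // hT_D (hT_Z t act).
Qed.

Lemma pTi_lin i : (0 < i < n)%N -> lin (pTi i).
Proof.
move=> hi c p r; apply: tofrac_inj.
by rewrite tofrac_pTi // !tofracD !tofracZ !tofrac_pTi // hTi_D (hTi_Z t act).
Qed.

Lemma pY_lin i : (0 < i <= n)%N -> lin (pY i).
Proof.
move=> hi c p r; apply: tofrac_inj.
by rewrite tofrac_pY // !tofracD !tofracZ !tofrac_pY // hY_D (hY_Z t act).
Qed.

Lemma pTiE i p : (0 < i < n)%N -> pTi i p = (t^-1 - 1) *: p + t^-1 *: pT i p.
Proof.
move=> hi; apply: tofrac_inj.
by rewrite tofrac_pTi // tofracD !tofracZ tofrac_pT // rmorphB rmorph1.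
Qed.

Lemma tofrac_foldr (A : nat -> P -> P) (B : nat -> F -> F) l p :
  (forall i r, i \in l -> (A i r)%:F = B i r%:F) -> (foldr A p l)%:F = foldr B p%:F l.
Proof.
elim: l => //= i l IH h; rewrite h ?mem_head // IH // => j r hj.
by rewrite h // in_cons hj orbT.
Qed.

Lemma pYE i p : (0 < i <= n)%N ->
  pY i p = t ^- (n - i) *: foldr pT (pom (foldr pTi p (iota 1 i.-1))) (iota i (n - i)).
Proof.
move=> hi; apply: tofrac_inj.
rewrite tofrac_pY // tofracZ (tofrac_foldr (B := TF)); last first.
  by move=> j r; rewrite mem_iota => hj; apply: tofrac_pT; lia.
rewrite tofrac_pom (tofrac_foldr (B := TiF)) // => j r.
by rewrite mem_iota => hj; apply: tofrac_pTi; lia.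
Qed.

Section Mono.
Variables a b : 'I_n.
Hypothesis ab : b = a.+1 :> nat.
Let hi : (0 < a.+1 < n)%N.
Proof. by have := ltn_ord b; lia. Qed.
Let a_neq_b : a != b.
Proof. by rewrite -val_eqE /=; lia. Qed.

Definition repl (ka : 'X_{1..n}) u v : 'X_{1..n} :=
  [multinom if j == a then u else if j == b then v else ka j | j < n].

Lemma mpolyX_repl ka m u v :
  'X_[repl ka (m + u) (m + v)] = 'X_[repl ka m m] * ('X_a ^+ u * 'X_b ^+ v) :> P.
Proof.
rewrite !mpolyXn -!mpolyXD; congr 'X_[_]; apply/mnmP => j.
rewrite !(mnmDE, mulmnE, mnmE, mnm1E) ![_ == j]eq_sym.
case: eqP => [->|_]; first by rewrite (negPf a_neq_b) mul1n mul0n addn0.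
by case: eqP => [_|_]; rewrite ?mul1n ?mul0n ?addn0 ?add0n.
Qed.

Lemma repl_id ka : repl ka (ka a) (ka b) = ka.
Proof. by apply/mnmP => j; rewrite mnmE; case: eqP => [->//|_]; case: eqP => [->|]. Qed.

Lemma mswap_repl ka u v : mswap a b (repl ka u v) = repl ka v u.
Proof.
apply/mnmP => j; rewrite !mnmE; case: tpermP => [->|->|/eqP/negPf -> /eqP/negPf -> //].
  by rewrite !eqxx eq_sym (negPf a_neq_b).
by rewrite !eqxx eq_sym (negPf a_neq_b).
Qed.

Lemma nsub_gsX ka : nsub (gs K n a.+1) 'X_[ka] = 'X_[mswap a b ka].
Proof.
rewrite !mpolyXE_id rmorph_prod /= [RHS](reindex_inj (@perm_inj _ (tperm a b))) /=.
apply: eq_bigr => j _; rewrite rmorphXn /= -xv_ord nsub_xv ?ltn_ord // /gs hi mnmE tpermK.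
congr (_ ^+ _); rewrite -xv_ord; congr (Defs.xv _ _ _); rewrite /swapn !eqSS -ab.
have E (c d : 'I_n) : (nat_of_ord c == d) = (c == d) by [].
rewrite !E; case: tpermP => [->|->|/eqP/negPf -> /eqP/negPf -> //]; rewrite eqxx //.
by rewrite eq_sym (negPf a_neq_b).
Qed.

Lemma pT_mono ka : exists2 g : P,
  pT a.+1 'X_[ka] = (if (ka a <= ka b)%N then t else 1) *: 'X_[mswap a b ka]
     + (if (ka a < ka b)%N then t - 1 else 0) *: 'X_[ka] + g &
  forall mu, g@_mu != 0 -> inner a b ka mu.
Proof.
pose m := minn (ka a) (ka b); pose e := (maxn (ka a) (ka b) - m)%N.
pose G : P := \sum_(1 <= l < e) 'X_a ^+ (e - l) * 'X_b ^+ l.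
pose M : P := 'X_[repl ka m m].
have hG mu (c : K) : (c *: (M * G))@_mu != 0 -> inner a b ka mu.
  rewrite mcoeffZ mulf_eq0 negb_or => /andP[_]; rewrite big_distrr raddf_sum /= => h.
  have : has (fun l => (M * ('X_a ^+ (e - l) * 'X_b ^+ l))@_mu != 0) (index_iota 1 e).
    apply: contraNT h => /hasPn h; rewrite big_seq big1 // => l hl.
    by apply/eqP; have := h l hl; rewrite negbK.
  move=> /hasP [l]; rewrite mem_index_iota => hl.
  rewrite -mpolyX_repl mcoeffX; case: (_ =P mu) => [<- _|_]; last by rewrite eqxx.
  split.
  - by move=> j /negPf ja /negPf jb; rewrite mnmE ja jb.
  - by rewrite !mnmE !eqxx eq_sym (negPf a_neq_b); rewrite /e /m in hl *; lia.
  - by rewrite !mnmE !eqxx eq_sym (negPf a_neq_b); rewrite /e /m in hl *; lia.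
have sM : sF a.+1 M%:F = M%:F by rewrite sF_tofrac nsub_gsX mswap_repl.
have Xa : XF a.+1 = ('X_a : P)%:F by rewrite /XF xv_ord.
have Xb : XF a.+2 = ('X_b : P)%:F by rewrite /XF -ab xv_ord.
have hGF : (0 < e)%N -> (XF a.+1 - XF a.+2) * G%:F =
   XF a.+1 ^+ e * XF a.+2 - XF a.+1 * XF a.+2 ^+ e.
  move=> he; have := geom_gap ('X_a : P) 'X_b he; rewrite -/G => /(congr1 (@FracField.tofrac P)).
  by rewrite tofracM !tofracB !tofracM !tofracXn -Xa -Xb.
have hX : 'X_[mswap a b ka] = M * ('X_a ^+ (ka b - m) * 'X_b ^+ (ka a - m)).
  rewrite -mpolyX_repl -[in LHS](repl_id ka) mswap_repl; congr 'X_[repl _ _ _]; rewrite /m; lia.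
have hX' : 'X_[ka] = M * ('X_a ^+ (ka a - m) * 'X_b ^+ (ka b - m)).
  rewrite -mpolyX_repl -[in LHS](repl_id ka); congr 'X_[repl _ _ _]; rewrite /m; lia.
case: (ltngtP (ka a) (ka b)) => hab.
- exists ((t - 1) *: (M * G)); last by move=> mu; apply: hG.
  have e1 : (ka a - m = 0)%N by rewrite /m; lia.
  have e2 : (ka b - m = e)%N by rewrite /e /m; lia.
  apply: tofrac_inj; rewrite tofrac_pT // hX' hX e1 e2 !expr0 mul1r mulr1.
  rewrite tofracM tofracXn -Xb (hT_mono_le act q0 t0 (G := G%:F)) //; last by apply: hGF; lia.
  rewrite !tofracD !tofracZ !tofracM !tofracXn -Xa -Xb !mulrDr rmorphB rmorph1.
  by congr (_ + _ + _); rewrite mulrCA.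
- exists ((1 - t) *: (M * G)); last by move=> mu; apply: hG.
  have e1 : (ka b - m = 0)%N by rewrite /m; lia.
  have e2 : (ka a - m = e)%N by rewrite /e /m; lia.
  apply: tofrac_inj; rewrite tofrac_pT // hX' hX e1 e2 !expr0 mul1r mulr1 scale0r addr0 scale1r.
  rewrite tofracM tofracXn -Xa (hT_mono_ge act q0 t0 (G := G%:F)) //; last by apply: hGF; lia.
  rewrite !tofracD !tofracZ !tofracM !tofracXn -Xb !mulrDr rmorphB rmorph1.
  by congr (_ + _); rewrite mulrCA.
- exists 0; last by move=> mu; rewrite mcoeff0 eqxx.
  have e1 : (ka a - m = 0)%N by rewrite /m; lia.
  have e2 : (ka b - m = 0)%N by rewrite /m; lia.
  apply: tofrac_inj; rewrite tofrac_pT // hX' hX e1 e2 !expr0 !mulr1 scale0r !addr0.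
  by rewrite tofracZ hT_inv.
Qed.
End Mono.
End Poly.

Definition cycn i m k : nat := if k == m then i else bump i (unbump m k).

Lemma cycn_bound n i m k : (i < n)%N -> (m < n)%N -> (k < n)%N -> (cycn i m k < n)%N.
Proof. by rewrite /cycn /bump /unbump; case: eqP; lia. Qed.

Lemma cycnK i m : cancel (cycn i m) (cycn m i).
Proof.
move=> k; rewrite /cycn; case: (k =P m) => [->|h]; first by rewrite eqxx.
case: eqP; rewrite /bump /unbump; lia.
Qed.

Lemma cycn_id i k : cycn i i k = k.
Proof. by rewrite /cycn /bump /unbump; case: eqP => //; lia. Qed.

Lemma cycn_m i m : cycn i m m = i.
Proof. by rewrite /cycn eqxx. Qed.

Lemma cycn_mS i m : cycn i m m.+1 = cycn i m.+1 m.
Proof.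
rewrite /cycn /bump /unbump; have -> : (m.+1 == m) = false by lia.
have -> : (m == m.+1) = false by lia.
have -> : (m.+1 < m)%N = false by lia.
by rewrite ltnSn subn1 subn0.
Qed.

Lemma cycn_other i m k : k != m -> k != m.+1 -> cycn i m k = cycn i m.+1 k.
Proof.
rewrite /cycn /bump /unbump => /negPf h1 /negPf h2; rewrite h1 h2.
suff -> : (m < k)%N = (m.+1 < k)%N by [].
lia.
Qed.

Lemma cycn_rot i n k : (k.+1 < n)%N -> cycn i 0 k.+1 = cycn i n.-1 k.
Proof.
rewrite /cycn /bump /unbump => h; have -> : (k == n.-1) = false by lia.
have -> : (n.-1 < k)%N = false by lia.
by rewrite /= subn1 subn0.
Qed.

Lemma cycn_S i m : cycn i m.+1 m = bump i m.
Proof.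
rewrite /cycn /unbump; have -> : (m == m.+1) = false by lia.
have -> : (m.+1 < m)%N = false by lia.
by rewrite subn0.
Qed.

Section Tri.
Variables (K : fieldType) (n : nat).
Notation P := {mpoly K[n]}.
Variables (q t : K).
Hypothesis q0 : q != 0.
Hypothesis t0 : t != 0.
Hypothesis n0 : (0 < n)%N.
Notation pT := (@pT K n t).
Notation pTi := (@pTi K n t).
Notation pY := (@pY K n q t).
Notation pom := (@pom K n q).

Section Step.
Variables a b : 'I_n.
Hypothesis ab : b = a.+1 :> nat.
Let hi : (0 < a.+1 < n)%N.
Proof. by have := ltn_ord b; lia. Qed.

Lemma mswap_neq (ka : 'X_{1..n}) : ka a != ka b -> (ka == mswap a b ka) = false.
Proof. by apply: contraNF => /eqP /mnmP /(_ a); rewrite mnmE tpermL => ->. Qed.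

Lemma inner_mswap ka : ~ inner a b ka (mswap a b ka).
Proof. by case=> _ _; rewrite !mnmE tpermL tpermR maxnC ltnn. Qed.

Lemma mswap_eq (ka : 'X_{1..n}) : ka a = ka b -> mswap a b ka = ka.
Proof. by move=> e; apply/mnmP => j; rewrite mnmE; case: tpermP => [->|->|]. Qed.

Lemma pT_supp ka mu : (pT a.+1 'X_[ka])@_mu != 0 ->
  [\/ mu = mswap a b ka, mu = ka /\ (ka a < ka b)%N | inner a b ka mu].
Proof.
have [g -> hg] := pT_mono q0 t0 n0 ab ka.
case: (mu =P mswap a b ka) => [|h1 h]; first by constructor 1.
case: (boolP (g@_mu == 0)) => [/eqP hg0|/hg]; last by constructor 3.
constructor 2; move: h; rewrite !mcoeffD !mcoeffZ !mcoeffX hg0 addr0.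
have -> : (mswap a b ka == mu) = false by apply/eqP => e; apply: h1.
rewrite mulr0 add0r; case: (ka =P mu) => [->|_]; last by rewrite mulr0 eqxx.
by case: ifP => //; rewrite mul0r eqxx.
Qed.

Lemma pT_swap ka : (pT a.+1 'X_[ka])@_(mswap a b ka) = if (ka a <= ka b)%N then t else 1.
Proof.
have [g -> hg] := pT_mono q0 t0 n0 ab ka.
have hg0 : g@_(mswap a b ka) = 0.
  by apply/eqP; apply/negPn/negP => /hg; exact: inner_mswap.
rewrite !mcoeffD !mcoeffZ !mcoeffX hg0 addr0 eqxx mulr1.
case: (ltngtP (ka a) (ka b)) => hab; rewrite ?mul0r ?addr0 //.
by rewrite mswap_neq ?mulr0 ?addr0 // neq_ltn hab.
Qed.

Lemma pTi_supp ka mu : (pTi a.+1 'X_[ka])@_mu != 0 ->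
  [\/ mu = mswap a b ka, mu = ka /\ (ka b < ka a)%N | inner a b ka mu].
Proof.
rewrite (pTiE t q0 n0 _ hi) mcoeffD !mcoeffZ mcoeffX.
have [g -> hg] := pT_mono q0 t0 n0 ab ka.
case: (mu =P mswap a b ka) => [|h1 h]; first by constructor 1.
case: (boolP (g@_mu == 0)) => [/eqP hg0|/hg]; last by constructor 3.
constructor 2; move: h; rewrite !mcoeffD !mcoeffZ !mcoeffX hg0 addr0.
have -> : (mswap a b ka == mu) = false by apply/eqP => e; apply: h1.
rewrite mulr0 add0r; case: (ka =P mu) => [e|_]; last by rewrite !mulr0 addr0 eqxx.
rewrite !mulr1 -e; case: (ltngtP (ka a) (ka b)) => // hab.
  by rewrite mulrBr mulVf // mulr1 addrC subrKA subrr eqxx.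
by move: h1; rewrite mswap_eq // e.
Qed.

Lemma pTi_swap ka : (pTi a.+1 'X_[ka])@_(mswap a b ka) = if (ka b <= ka a)%N then t^-1 else 1.
Proof.
rewrite (pTiE t q0 n0 _ hi) mcoeffD !mcoeffZ mcoeffX pT_swap.
case: (ltngtP (ka a) (ka b)) => hab.
- by rewrite mswap_neq ?neq_ltn ?hab // mulr0 add0r mulVf.
- by rewrite mswap_neq ?neq_ltn ?hab ?orbT // mulr0 add0r mulr1.
- by rewrite mswap_eq // eqxx mulr1 mulVf // subrK.
Qed.
End Step.

(* Y_{i+1} is a chain of T_j and omega that moves the i-th entry of an exponent step by step
   through all positions. [max_along phi nu c f] is the property propagated along the chain: after
   the positions have been permuted by phi, the coefficient of nu is c and no larger monomial
   occurs. *)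
Definition max_along (phi : 'X_{1..n} -> 'X_{1..n}) nu c (f : P) : Prop :=
  f@_(phi nu) = c /\ forall mu, f@_(phi mu) != 0 -> ple nu mu -> mu = nu.

Lemma max_along_step (A : P -> P) phi phi' alpha nu c f : lin A ->
  (forall ka, exists la, ka = phi la) ->
  (forall la mu, (A 'X_[phi la])@_(phi' mu) != 0 -> ple mu la) ->
  (A 'X_[phi nu])@_(phi' nu) = alpha ->
  max_along phi nu c f -> max_along phi' nu (c * alpha) (A f).
Proof.
move=> hA hphi h1 h2 [h3 h4]; split.
  rewrite (lin_coef1 (m0 := phi nu) hA) ?h2 ?h3 // => m hm hm'.
  have [la e] := hphi m; rewrite e in hm hm' *.
  by rewrite (h4 la) //; apply: h1.
move=> mu /(lin_coef_neq0 hA) [m hm hm'] hle.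
have [la e] := hphi m; rewrite e in hm hm'.
have hla := h1 _ _ hm'; have e2 : la = nu by apply: h4 => //; apply: ple_trans hle hla.
by apply: ple_anti => //; rewrite -e2.
Qed.

Definition mcyc i m (nu : 'X_{1..n}) : 'X_{1..n} := [multinom nth 0%N nu (cycn i m j) | j < n].

Lemma nth_mcyc i m nu j : (j < n)%N -> nth 0%N (mcyc i m nu) j = nth 0%N nu (cycn i m j).
Proof. by move=> hj; rewrite -(mnm_nth 0%N _ (Ordinal hj)) mnmE. Qed.

Lemma mcycK i m : (i < n)%N -> (m < n)%N -> cancel (mcyc i m) (mcyc m i).
Proof.
move=> hi hm nu; apply/mnmP => j; rewrite mnmE nth_mcyc ?cycn_bound ?ltn_ord // cycnK.
by rewrite -mnm_nth.
Qed.

Lemma mcyc_inj i m : (i < n)%N -> (m < n)%N -> injective (mcyc i m).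
Proof. by move=> hi hm; apply: can_inj (mcycK hi hm). Qed.

Lemma mcyc_surj i m ka : (i < n)%N -> (m < n)%N -> exists la, ka = mcyc i m la.
Proof. by move=> hi hm; exists (mcyc m i ka); rewrite mcycK. Qed.

Lemma mcyc_id i nu : mcyc i i nu = nu.
Proof. by apply/mnmP => j; rewrite mnmE cycn_id -mnm_nth. Qed.

Section CycStep.
Variables (i m : nat).
Hypothesis hi : (i < n)%N.
Hypothesis hm : (m.+1 < n)%N.
Let a := Ordinal (ltnW hm).
Let b := Ordinal hm.
Let hp : (cycn i m.+1 m < n)%N.
Proof. by apply: cycn_bound => //; exact: ltnW. Qed.
Let p := Ordinal hp.
Let io := Ordinal hi.
Let io_p : io != p.
Proof. by rewrite -val_eqE /= cycn_S neq_bump. Qed.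

Lemma mcyc_S_a la : mcyc i m.+1 la a = la p.
Proof. by rewrite mnmE [RHS](mnm_nth 0%N). Qed.

Lemma mcyc_S_b la : mcyc i m.+1 la b = la io.
Proof. by rewrite mnmE [RHS](mnm_nth 0%N) /= cycn_m. Qed.

Lemma mcyc_a la : mcyc i m la a = la io.
Proof. by rewrite mnmE [RHS](mnm_nth 0%N) /= cycn_m. Qed.

Lemma mcyc_b la : mcyc i m la b = la p.
Proof. by rewrite mnmE [RHS](mnm_nth 0%N) /= cycn_mS. Qed.

Lemma mswap_mcyc la : mswap a b (mcyc i m.+1 la) = mcyc i m la.
Proof.
apply/mnmP => j; rewrite mnmE; case: tpermP => [->|->|/eqP ja /eqP jb].
- by rewrite mcyc_S_b mcyc_a.
- by rewrite mcyc_S_a mcyc_b.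
- by rewrite !mnmE (@cycn_other i m) // -?val_eqE.
Qed.

Lemma mcyc_S_eq la mu : mcyc i m mu = mcyc i m.+1 la -> mu = mswap io p la.
Proof.
move=> e; apply: (@mcyc_inj i m) => //; first exact: ltnW.
rewrite e; apply/mnmP => j.
case: (j =P a) => [->|/eqP ja]; first by rewrite mcyc_S_a mcyc_a mnmE tpermL.
case: (j =P b) => [->|/eqP jb]; first by rewrite mcyc_S_b mcyc_b mnmE tpermR.
have hj : (cycn i m j < n)%N by apply: cycn_bound => //; exact: ltnW.
rewrite !mnmE -!(mnm_nth 0%N _ (Ordinal hj)) -(@cycn_other i m) ?mnmE -?val_eqE //.
rewrite -(mnm_nth 0%N _ (Ordinal hj)) tpermD //.
- apply: contra ja; rewrite -!val_eqE /= => /eqP e'.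
  by rewrite -(cycnK i m j) -e' cycn_m.
- apply: contra jb; rewrite -!val_eqE /= => /eqP e'.
  by rewrite -(cycnK i m j) -e' -cycn_mS cycnK.
Qed.

Lemma inner_mcyc la mu : inner a b (mcyc i m.+1 la) (mcyc i m mu) -> inner io p la mu.
Proof.
case; rewrite !mcyc_a !mcyc_b !mcyc_S_a !mcyc_S_b => h1 h2 h3; split; try lia.
move=> l li lp.
have hm' := ltnW hm.
have hj : (cycn m i l < n)%N by apply: cycn_bound.
have := h1 (Ordinal hj); rewrite !mnmE /=.
have hK : cycn i m (cycn m i l) = l by exact: cycnK.
have ja : cycn m i l != m.
  by apply: contra li => /eqP e; rewrite -val_eqE /= -hK e cycn_m.
have jb : cycn m i l != m.+1.
  by apply: contra lp => /eqP e; rewrite -val_eqE /= -hK e cycn_mS.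
rewrite -(@cycn_other i m) // hK -!mnm_nth; apply; by rewrite -val_eqE.
Qed.

Lemma pT_max_along nu c f : (i <= m)%N -> max_along (mcyc i m.+1) nu c f ->
  max_along (mcyc i m) nu (c * (if (nth 0%N nu m.+1 <= nth 0%N nu i)%N then t else 1)) (pT m.+1 f).
Proof.
move=> him; have hp' : p = m.+1 :> nat by rewrite /= cycn_S /bump him.
apply: max_along_step.
- by apply: (pT_lin t q0 n0); lia.
- by move=> ka; apply: mcyc_surj.
- move=> la mu /(@pT_supp a b erefl) [].
  + rewrite mswap_mcyc => /mcyc_inj -> //; [exact: ple_refl|exact: ltnW].
  + rewrite mcyc_S_a mcyc_S_b => -[/mcyc_S_eq -> h]; apply: mswap_ple => //.
    by rewrite hp' /=; lia.
  + by move=> /inner_mcyc /(inner_ple io_p) [].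
- have := @pT_swap a b erefl (mcyc i m.+1 nu).
  by rewrite mswap_mcyc mcyc_S_a mcyc_S_b !(mnm_nth 0%N) hp' => ->.
Qed.

Lemma pTi_max_along nu c f : (m < i)%N -> max_along (mcyc i m.+1) nu c f ->
  max_along (mcyc i m) nu (c * (if (nth 0%N nu i <= nth 0%N nu m)%N then t^-1 else 1)) (pTi m.+1 f).
Proof.
move=> him; have hp' : p = m :> nat by rewrite /= cycn_S /bump leqNgt him.
apply: max_along_step.
- by apply: (pTi_lin t q0 n0); lia.
- by move=> ka; apply: mcyc_surj.
- move=> la mu /(@pTi_supp a b erefl) [].
  + rewrite mswap_mcyc => /mcyc_inj -> //; [exact: ple_refl|exact: ltnW].
  + rewrite mcyc_S_a mcyc_S_b => -[/mcyc_S_eq -> h]; rewrite /mswap tpermC; apply: mswap_ple => //.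
    by rewrite hp' /=; lia.
  + by move=> /inner_mcyc /(inner_ple io_p) [].
- have := @pTi_swap a b erefl (mcyc i m.+1 nu).
  by rewrite mswap_mcyc mcyc_S_a mcyc_S_b !(mnm_nth 0%N) hp' => ->.
Qed.
End CycStep.

Definition mrot (ka : 'X_{1..n}) : 'X_{1..n} := [multinom ka (ordS j) | j < n].

Lemma pom_var (j : 'I_n) : pom 'X_j = (if j == 0%N :> nat then q else 1) *: 'X_(ord_pred j).
Proof.
rewrite pomE -xv_ord nsub_xv ?ltn_ord // /gW eqSS prednK // ltn_ord.
case: eqP => [e|h]; last first.
  rewrite scale1r -xv_ord; congr (Defs.xv _ _ _) => /=.
  have -> : (j + n).-1 = (j.-1 + n)%N by lia.
  by rewrite modnDr modn_small; have := ltn_ord j; lia.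
rewrite -xv_ord; congr (_ *: Defs.xv _ _ _) => /=.
by rewrite e add0n modn_small; lia.
Qed.

Lemma pom_mono ka : pom 'X_[ka] = q ^+ (nth 0%N ka 0) *: 'X_[mrot ka].
Proof.
rewrite mpolyXE_id pomE rmorph_prod /=.
have -> : \prod_(j < n) nsub (gW n q n.-1) ('X_j ^+ ka j) =
  \prod_(j < n) ((if j == 0%N :> nat then q else 1) ^+ ka j *: ('X_(ord_pred j) ^+ ka j : P)).
  by apply: eq_bigr => j _; rewrite rmorphXn /= -pomE pom_var exprZn.
rewrite scaler_prod; congr (_ *: _).
  rewrite (bigD1 (Ordinal n0)) //= big1 ?mulr1 ?(mnm_nth 0%N) // => j hj.
  case: eqP => [e|_]; last by rewrite expr1n.
  by move: hj; rewrite -val_eqE /= e eqxx.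
rewrite [RHS]mpolyXE_id [RHS](reindex_inj (can_inj (@ord_predK n))).
by apply: eq_bigr => j _; rewrite mnmE ord_predK.
Qed.

Lemma mrot_mcyc i nu : (i < n)%N -> mrot (mcyc i 0 nu) = mcyc i n.-1 nu.
Proof.
move=> hi; apply/mnmP => j; rewrite !mnmE /=; congr nth.
case: (j =P n.-1 :> nat) => [e|h].
  have -> : j.+1 = n by lia.
  by rewrite modnn e !cycn_m.
have hj : (j.+1 < n)%N by have := ltn_ord j; lia.
by rewrite modn_small // (@cycn_rot i n).
Qed.

Lemma pom_max_along i nu c f : (i < n)%N -> max_along (mcyc i 0) nu c f ->
  max_along (mcyc i n.-1) nu (c * q ^+ (nth 0%N nu i)) (pom f).
Proof.
have hn1 : (n.-1 < n)%N by lia.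
move=> hi; apply: max_along_step.
- exact: pom_lin.
- by move=> ka; apply: mcyc_surj.
- move=> la mu; rewrite pom_mono mcoeffZ mcoeffX mrot_mcyc //.
  case: (_ =P mcyc _ _ mu) => [/mcyc_inj -> //|_]; last by rewrite mulr0 eqxx.
  by move=> _; exact: ple_refl.
- by rewrite pom_mono mcoeffZ mcoeffX mrot_mcyc // eqxx mulr1 nth_mcyc // cycn_m.
Qed.

Lemma chain_pTi i nu c f m : (i < n)%N -> (m <= i)%N -> max_along (mcyc i i) nu c f ->
  max_along (mcyc i (i - m)%N) nu
    (c * \prod_(l <- iota (i - m)%N m) (if (nth 0%N nu i <= nth 0%N nu l)%N then t^-1 else 1))
    (foldr pTi f (iota (i - m)%N.+1 m)).
Proof.
move=> hi; elim: m => [|m IH] hm hf; first by rewrite subn0 big_nil mulr1.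
have e : (i - m = (i - m.+1).+1)%N by lia.
have := IH (ltnW hm) hf; rewrite e /= => hf'.
rewrite big_cons mulrCA mulrC; apply: pTi_max_along => //; lia.
Qed.

Lemma chain_pT i nu c f m : (i < n)%N -> (m <= n.-1 - i)%N -> max_along (mcyc i n.-1) nu c f ->
  max_along (mcyc i (n.-1 - m)%N) nu
    (c * \prod_(l <- iota (n.-1 - m)%N m) (if (nth 0%N nu l.+1 <= nth 0%N nu i)%N then t else 1))
    (foldr pT f (iota (n.-1 - m)%N.+1 m)).
Proof.
move=> hi; elim: m => [|m IH] hm hf; first by rewrite subn0 big_nil mulr1.
have e : (n.-1 - m = (n.-1 - m.+1).+1)%N by lia.
have := IH (ltnW hm) hf; rewrite e /= => hf'.
rewrite big_cons mulrCA mulrC; apply: pT_max_along => //; lia.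
Qed.

Lemma prod_if (R : comNzRingType) (x : R) (I : Type) (r : seq I) (B : pred I) :
  \prod_(l <- r) (if B l then x else 1) = x ^+ (\sum_(l <- r) B l).
Proof.
elim: r => [|l r IH]; first by rewrite !big_nil.
by rewrite !big_cons IH exprD; case: (B l).
Qed.

Lemma pY_coef_max i nu f : (i < n)%N -> (forall mu, f@_mu != 0 -> ple nu mu -> mu = nu) ->
  (pY i.+1 f)@_nu = evY q t nu i.+1 * f@_nu.
Proof.
move=> hi hf.
have : max_along (mcyc i i) nu f@_nu f.
  by split=> [|mu]; rewrite mcyc_id // => h; apply: hf.
move=> /(chain_pTi hi (leqnn i)); rewrite subnn => /(pom_max_along hi).
move=> /(chain_pT hi (leqnn _)).
have e1 : (n.-1 - (n.-1 - i) = i)%N by lia.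
have e2 : (n.-1 - i = n - i.+1)%N by lia.
rewrite e1 e2 => -[]; rewrite mcyc_id => h _.
rewrite (pYE q0 t0 n0); last lia.
rewrite mcoeffZ /= h !prod_if /evY /ev /=.
have -> : lp nu i.+1 = (\sum_(l <- iota 0 i) (nth 0%N nu i <= nth 0%N nu l)%N +
   \sum_(l <- iota i (n - i.+1)) (nth 0%N nu i < nth 0%N nu l.+1)%N)%N.
  rewrite /lp /ev !big_add1 /index_iota subn0.
  by have -> : (n - i.+1 = n.-1 - i)%N by lia.
set A := (\sum_(l <- iota 0 i) _)%N; set C := (\sum_(l <- iota i _) (_ < _))%N.
set B := (\sum_(l <- iota i _) (_ <= _))%N.
have hBC : (n - i.+1 = B + C)%N.
  rewrite -big_split /= -[LHS](size_iota i) -sum1_size; apply: eq_bigr => l _.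
  by case: leqP.
rewrite hBC !exprD !invfM -!exprVn.
have hB : t ^+ B != 0 by rewrite expf_neq0.
rewrite [LHS](_ : _ = (t^-1 ^+ B * t ^+ B) * (t^-1 ^+ C * t^-1 ^+ A * q ^+ nth 0%N nu i * f@_nu));
  last by ring.
by rewrite exprVn mulVf //; ring.
Qed.
End Tri.

Section Combin.
Variable n : nat.
Implicit Types nu eta mu : 'X_{1..n}.

Definition pleb nu eta :=
  domle n (dplus nu) (dplus eta) && ((dplus nu == dplus eta) ==> domle n nu eta).
Lemma plebP nu eta : reflect (ple nu eta) (pleb nu eta).
Proof.
apply: (iffP andP) => -[h1 h2]; split=> //.
  by move=> e; move: h2; rewrite e eqxx.
by apply/implyP => /eqP; exact: h2.
Qed.

Lemma exists_ple_max (s : seq 'X_{1..n}) mu : mu \in s ->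
  exists nu, [/\ nu \in s, ple mu nu & forall ka, ka \in s -> ple nu ka -> ka = nu].
Proof.
have [m] := ubnP (count (pleb mu) s); elim: m => // m IH in mu *.
move=> hm hs; case: (boolP (has (fun ka => pleb mu ka && (ka != mu)) s)); last first.
  move=> /hasPn h; exists mu; split=> //; first exact: ple_refl.
  by move=> ka hka /plebP hle; have := h _ hka; rewrite hle /= negbK => /eqP.
move=> /hasP [ka hka /andP[/plebP h1 h2]].
have [|//|nu [h3 h4 h5]] := IH ka; last by exists nu; split=> //; apply: ple_trans h1 h4.
rewrite ltnS in hm; apply: leq_trans hm.
have hsub : subpred (pleb ka) (pleb mu).
  by move=> la /plebP h; apply/plebP; apply: ple_trans h1 h.
have hmu : pleb ka mu = false.
  by apply/negbTE/negP => /plebP h; move/eqP: h2; apply; apply: ple_anti.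
have refl : pleb mu mu by apply/plebP; exact: ple_refl.
elim: s hs {hka IH} => //= x s IHs; rewrite in_cons => /orP[/eqP <-|hx].
  by rewrite hmu refl add0n add1n ltnS; exact: sub_count.
rewrite -addnS; apply: leq_add; last exact: IHs.
by have := hsub x; case: (pleb ka x) => // ->.
Qed.

(* [msw i] and [mphi] are the actions of the simple transposition and of the affine generator
   on compositions: (eta_1, ..., eta_n) |-> (eta_2, ..., eta_n, eta_1 + 1) *)
Definition msw i eta : 'X_{1..n} := [multinom ev eta (swapn i j.+1) | j < n].
Definition mphi eta : 'X_{1..n} :=
  [multinom if j.+1 == n then (ev eta 1).+1 else ev eta j.+2 | j < n].

Lemma ev_ord eta (j : 'I_n) : ev eta j.+1 = eta j.
Proof. by rewrite /ev /= -mnm_nth. Qed.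

Lemma ev_mk (f : nat -> nat) i : (0 < i <= n)%N -> ev [multinom f j.+1 | j < n] i = f i.
Proof.
move=> hi; have hi' : (i.-1 < n)%N by lia.
have {1}-> : i = (Ordinal hi').+1 by rewrite /=; lia.
by rewrite ev_ord mnmE /= prednK //; lia.
Qed.

Lemma ev_ext eta nu : (forall i, (0 < i <= n)%N -> ev eta i = ev nu i) -> eta = nu.
Proof. by move=> h; apply/mnmP => j; rewrite -!ev_ord h ?ltn_ord. Qed.

Lemma ev_msw i j eta : (0 < j <= n)%N -> ev (msw i eta) j = ev eta (swapn i j).
Proof. by move=> hj; rewrite /msw (ev_mk (fun j => ev eta (swapn i j))). Qed.

Lemma ev_mphi j eta : (0 < j < n)%N -> ev (mphi eta) j = ev eta j.+1.
Proof.
move=> hj; rewrite /mphi (ev_mk (fun j => if j == n then (ev eta 1).+1 else ev eta j.+1)); last lia.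
by case: eqP => //; lia.
Qed.

Lemma ev_mphi_n eta : (0 < n)%N -> ev (mphi eta) n = (ev eta 1).+1.
Proof.
move=> hn; rewrite /mphi (ev_mk (fun j => if j == n then (ev eta 1).+1 else ev eta j.+1)); last lia.
by rewrite eqxx.
Qed.

Lemma mswK i : (0 < i < n)%N -> involutive (msw i).
Proof.
by move=> hi eta; apply: ev_ext => j hj; rewrite !ev_msw ?swapn_bound // swapnK.
Qed.

Lemma sum_nat_ord (F : nat -> nat) : (\sum_(1 <= k < n.+1) F k = \sum_(k < n) F k.+1)%N.
Proof. by rewrite big_add1 big_mkord. Qed.

Section SwapIndex.
Variables (i : nat) (hi : (0 < i < n)%N).
Lemma sw_bound (j : 'I_n) : ((swapn i j.+1).-1 < n)%N.
Proof. by have := @swapn_bound n i j.+1 hi (ltn_ord j); lia. Qed.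

Definition sw_ord j := Ordinal (sw_bound j).
Lemma sw_ordE j : (sw_ord j).+1 = swapn i j.+1.
Proof. by rewrite /=; have := @swapn_bound n i j.+1 hi (ltn_ord j); lia. Qed.

Lemma sw_ordK : involutive sw_ord.
Proof. by move=> j; apply/ord_inj/succn_inj; rewrite !sw_ordE swapnK. Qed.

Lemma big_swapn (R : Type) (idx : R) (op : Monoid.com_law idx) (F : nat -> R) :
  \big[op/idx]_(k < n) F (swapn i k.+1) = \big[op/idx]_(k < n) F k.+1.
Proof.
rewrite [RHS](reindex_inj (inv_inj sw_ordK)); apply: eq_bigr => k _.
by rewrite sw_ordE.
Qed.
End SwapIndex.

Lemma mdeg_ev eta : mdeg eta = (\sum_(k < n) ev eta k.+1)%N.
Proof. by rewrite mdegE; apply: eq_bigr => k _; rewrite ev_ord. Qed.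

Lemma mdeg_msw i eta : (0 < i < n)%N -> mdeg (msw i eta) = mdeg eta.
Proof.
move=> hi; rewrite !mdeg_ev -(big_swapn hi addn (fun k => ev eta k)).
by apply: eq_bigr => k _; rewrite ev_msw ?ltn_ord.
Qed.

Lemma sum_rot (F : nat -> nat) : (0 < n)%N ->
  (\sum_(1 <= k < n) F k.+1 + F 1 = \sum_(1 <= k < n.+1) F k)%N.
Proof.
move=> hn; rewrite [RHS]big_ltn // addnC; congr (_ + _)%N.
by rewrite [RHS]big_add1.
Qed.

Lemma mdeg_mphi eta : (0 < n)%N -> mdeg (mphi eta) = (mdeg eta).+1.
Proof.
move=> hn; rewrite !mdeg_ev -(sum_nat_ord (ev (mphi eta))) -(sum_nat_ord (ev eta)).
rewrite -(sum_rot (ev eta) hn).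
rewrite big_nat_recr //= ev_mphi_n // addnS; congr (_ + _).+1.
by apply: eq_big_nat => k hk; rewrite ev_mphi.
Qed.

Lemma mphi_inj : (0 < n)%N -> injective mphi.
Proof.
move=> n0 eta nu e; apply: ev_ext => i hi.
case: i hi => // -[_|i hi].
  by apply: succn_inj; rewrite -!ev_mphi_n // e.
have hi' : (0 < i.+1 < n)%N by lia.
by rewrite -(ev_mphi eta hi') -(ev_mphi nu hi') e.
Qed.

Lemma mphi_surj eta : (0 < n)%N -> (0 < ev eta n)%N -> exists nu, eta = mphi nu.
Proof.
move=> n0 h; pose g j := if j == 1%N then (ev eta n).-1 else ev eta j.-1.
exists [multinom g j.+1 | j < n]; apply: ev_ext => j hj.
case: (j =P n) => [->|hjn].
  by rewrite ev_mphi_n // (ev_mk g) // /g eqxx prednK.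
rewrite ev_mphi; last lia.
rewrite (ev_mk g); last lia.
by rewrite /g; case: eqP => //; lia.
Qed.

Definition lp_term eta k j : nat :=
  if (k < j)%N then (ev eta j <= ev eta k)%N else (ev eta j < ev eta k)%N.
Lemma lpE eta j : (0 < j <= n)%N -> lp eta j = (\sum_(1 <= k < n.+1) lp_term eta k j)%N.
Proof.
move=> hj; rewrite (@big_cat_nat _ _ _ j) /=; try lia.
rewrite [in RHS](@big_ltn _ _ _ j); last lia.
rewrite {2}/lp_term !ltnn add0n; congr (_ + _)%N; apply: eq_big_nat => k hk; rewrite /lp_term.
  by have -> : (k < j)%N by lia.
by have -> : (k < j)%N = false by lia.
Qed.

Lemma lp_msw i j eta : (0 < i < n)%N -> ev eta i != ev eta i.+1 -> (0 < j <= n)%N ->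
  lp (msw i eta) j = lp eta (swapn i j).
Proof.
move=> hi hne hj; rewrite !lpE ?swapn_bound // !sum_nat_ord.
rewrite -(big_swapn hi addn (fun k => lp_term eta k (swapn i j))) /=.
apply: eq_bigr => k _; rewrite /lp_term !ev_msw ?ltn_ord //.
move: (k.+1) => l.
case: (l =P i) => [->|/eqP h1].
- rewrite swapnL; case: (j =P i) => [->|/eqP h2]; first by rewrite swapnL !ltnn.
  case: (j =P i.+1) => [->|/eqP h3].
    by rewrite swapnR ltnSn (ltnNge i.+1) leqnSn /= ltn_neqAle hne.
  by rewrite swapnN //; have -> : (i < j)%N = (i.+1 < j)%N by lia.
case: (l =P i.+1) => [->|/eqP h3].
- rewrite swapnR; case: (j =P i) => [->|/eqP h2].
    by rewrite swapnL ltnSn (ltnNge i.+1) leqnSn /= ltn_neqAle eq_sym hne.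
  case: (j =P i.+1) => [->|/eqP h4]; first by rewrite swapnR !ltnn.
  by rewrite swapnN //; have -> : (i < j)%N = (i.+1 < j)%N by lia.
rewrite (swapnN h1 h3); case: (j =P i) => [->|/eqP h2].
  by rewrite swapnL; have -> : (l < i)%N = (l < i.+1)%N by lia.
case: (j =P i.+1) => [->|/eqP h4]; last by rewrite swapnN.
by rewrite swapnR; have -> : (l < i)%N = (l < i.+1)%N by lia.
Qed.

Lemma lp_mphi j eta : (0 < j < n)%N -> lp (mphi eta) j = lp eta j.+1.
Proof.
move=> hj; have hn : (0 < n)%N by lia.
rewrite !lpE; try lia.
rewrite -(sum_rot (lp_term eta ^~ j.+1) hn) big_nat_recr //=; congr (_ + _)%N.
  by apply: eq_big_nat => k hk; rewrite /lp_term ltnS !ev_mphi.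
rewrite /lp_term ev_mphi_n // ev_mphi // ltnS.
have -> : (n < j)%N = false by lia.
by have -> : (1 < j.+1)%N by lia.
Qed.

Lemma lp_mphi_n eta : (0 < n)%N -> lp (mphi eta) n = lp eta 1.
Proof.
move=> hn; rewrite !lpE; try lia.
rewrite -(sum_rot (lp_term eta ^~ 1%N) hn) big_nat_recr //=; congr (_ + _)%N;
  last by rewrite /lp_term !ltnn.
by apply: eq_big_nat => k hk; rewrite /lp_term ev_mphi_n // ev_mphi //; case/andP: hk => h ->.
Qed.
End Combin.

Section Eigen.
Variables (K : fieldType) (n : nat).
Notation P := {mpoly K[n]}.
Variables (q t : K).
Hypothesis q0 : q != 0.
Hypothesis t0 : t != 0.
Hypothesis n0 : (0 < n)%N.
Hypothesis qt_gen : forall a b c d : nat, q ^+ a * t ^+ b = q ^+ c * t ^+ d -> a = c /\ b = d.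
Notation pT := (@pT K n t).
Notation pTi := (@pTi K n t).
Notation pY := (@pY K n q t).
Notation pom := (@pom K n q).
Notation evY := (@evY K n q t).
Let act := affine_action_F q0 n0.

Lemma qt_gen_div a b c d : q ^+ a * t ^- b = q ^+ c * t ^- d -> a = c /\ b = d.
Proof.
move=> e; have [-> ->] : a = c /\ d = b; last by [].
apply: qt_gen; move/(congr1 (fun x => x * (t ^+ b * t ^+ d))): e.
have hb : t ^+ b != 0 by rewrite expf_neq0.
have hd : t ^+ d != 0 by rewrite expf_neq0.
rewrite mulrA divfK // => ->; rewrite [t ^+ b * _]mulrC mulrA divfK //.
Qed.

Lemma evY_inj eta nu : (forall i, (0 < i <= n)%N -> evY eta i = evY nu i) -> eta = nu.
Proof. by move=> h; apply: ev_ext => i hi; have /qt_gen_div [] := h i hi. Qed.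

Definition eigen (e : nat -> K) (f : P) : Prop :=
  forall i, (0 < i <= n)%N -> pY i f = e i *: f.

Lemma eigen_max e f mu : eigen e f -> f@_mu != 0 -> exists nu,
  [/\ f@_nu != 0, ple mu nu & forall i, (0 < i <= n)%N -> evY nu i = e i].
Proof.
move=> he; rewrite -mcoeff_msupp => /exists_ple_max [nu [h1 h2 h3]].
rewrite mcoeff_msupp in h1; exists nu; split=> // i hi.
have hi' : (i.-1 < n)%N by lia.
have hm la : f@_la != 0 -> ple nu la -> la = nu.
  by rewrite -mcoeff_msupp; exact: h3.
have := pY_coef_max q0 t0 n0 hi' hm; rewrite prednK; last by case/andP: hi.
by rewrite he // mcoeffZ => /(mulIf h1).
Qed.

Lemma eigen_supp eta f mu : eigen (evY eta) f -> f@_mu != 0 -> ple mu eta /\ f@_eta != 0.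
Proof.
move=> he /(eigen_max he) [nu [h1 h2 h3]].
by have e : nu = eta by [apply: evY_inj]; rewrite -e.
Qed.

Lemma eigen0 e f : eigen e f -> (forall nu, (forall i, (0 < i <= n)%N -> evY nu i = e i) ->
  f@_nu = 0) ->
  f = 0.
Proof.
move=> he h; apply/mpolyP => mu; rewrite mcoeff0; apply/eqP/negPn/negP.
by move=> /(eigen_max he) [nu [h1 _ /h h2]]; rewrite h2 eqxx in h1.
Qed.

Lemma eigen_lin e c f g : eigen e f -> eigen e g -> eigen e (c *: f + g).
Proof.
move=> hf hg i hi; rewrite (pY_lin t q0 n0 hi) hf // hg // scalerDr !scalerA mulrC.
by [].
Qed.

Lemma eigen_uniq eta f g : eigen (evY eta) f -> eigen (evY eta) g -> g@_eta = 1 ->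
  f = f@_eta *: g.
Proof.
move=> hf hg h1; apply/eqP; rewrite -subr_eq0; apply/eqP.
apply: (@eigen0 (evY eta)).
  by rewrite addrC -scaleNr; apply: eigen_lin.
move=> nu /evY_inj ->; by rewrite mcoeffB mcoeffZ h1 mulr1 subrr.
Qed.

Lemma pT_pTi i f : (0 < i < n)%N -> pT i f = t *: pTi i f + (t - 1) *: f.
Proof.
move=> hi; rewrite (pTiE t q0 n0 _ hi) scalerDr !scalerA mulrBr mulfV // mulr1 scale1r.
rewrite addrAC -scalerDl; have -> : 1 - t + (t - 1) = 0 by ring.
by rewrite scale0r add0r.
Qed.

Lemma pY_pTi_comm i j f : (0 < i <= n)%N -> (0 < j < n)%N -> j != i -> j.+1 != i ->
  pY i (pTi j f) = pTi j (pY i f).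
Proof.
move=> hi hj h1 h2; apply: tofrac_inj.
rewrite (tofrac_pY t q0 n0 _ hi) (tofrac_pTi t q0 n0 _ hj) (tofrac_pTi t q0 n0 _ hj).
by rewrite (tofrac_pY t q0 n0 _ hi) (hY_hTi_comm act q0 t0).
Qed.

Lemma pY_pTi i f : (0 < i < n)%N -> pY i (pTi i f) = t^-1 *: pT i (pY i.+1 f).
Proof.
move=> hi; have hi1 : (0 < i <= n)%N by lia.
have hi2 : (0 < i.+1 <= n)%N by lia.
apply: tofrac_inj; rewrite (tofrac_pY t q0 n0 _ hi1) (tofrac_pTi t q0 n0 _ hi).
rewrite tofracZ (tofrac_pT t q0 n0 _ hi) (tofrac_pY t q0 n0 _ hi2).
exact: (hY_hTi act q0 t0).
Qed.

Lemma pYS_pT i f : (0 < i < n)%N -> pY i.+1 (pT i f) = t *: pTi i (pY i f).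
Proof.
move=> hi; have hi1 : (0 < i <= n)%N by lia.
have hi2 : (0 < i.+1 <= n)%N by lia.
apply: tofrac_inj; rewrite (tofrac_pY t q0 n0 _ hi2) (tofrac_pT t q0 n0 _ hi).
rewrite tofracZ (tofrac_pTi t q0 n0 _ hi) (tofrac_pY t q0 n0 _ hi1).
exact: (hYS_hT act q0 t0).
Qed.

Definition pPhi (f : P) : P := locked (xv K n n * pom f).
Lemma tofrac_pPhi f : (pPhi f)%:F = hPhi n (XF K n) (WF n q0 n.-1) f%:F.
Proof. by rewrite /pPhi -lock tofracM (tofrac_pom q0). Qed.

Lemma pY_pPhi i f : (0 < i < n)%N -> pY i (pPhi f) = pPhi (pY i.+1 f).
Proof.
move=> hi; have hi1 : (0 < i <= n)%N by lia.
have hi2 : (0 < i.+1 <= n)%N by lia.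
apply: tofrac_inj; rewrite (tofrac_pY t q0 n0 _ hi1) !tofrac_pPhi (tofrac_pY t q0 n0 _ hi2).
exact: (hY_hPhi act q0 t0).
Qed.

Lemma pY_pPhi_n f : pY n (pPhi f) = q *: pPhi (pY 1 f).
Proof.
have hi1 : (0 < n <= n)%N by lia.
have hi2 : (0 < 1 <= n)%N by lia.
apply: tofrac_inj; rewrite (tofrac_pY t q0 n0 _ hi1) tofracZ !tofrac_pPhi (tofrac_pY t q0 n0 _ hi2).
exact: (hY_hPhi_n act q0 t0).
Qed.

Lemma pPhi_lin : lin pPhi.
Proof. by move=> c f g; rewrite /pPhi -!lock (@pom_lin K n q) mulrDr scalerAr. Qed.

Lemma lmod_comb (V : lmodType K) (a b c d : K) (u v : V) : a = c -> b = d ->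
  a *: u + b *: v = c *: u + d *: v.
Proof. by move=> -> ->. Qed.

Lemma pYS_pTi i e f : (0 < i < n)%N -> eigen e f ->
  pY i.+1 (pTi i f) = ((t^-1 - 1) * e i.+1) *: f + e i *: pTi i f.
Proof.
move=> hi hf; have hS : (0 < i.+1 <= n)%N by lia.
rewrite {1}(pTiE t q0 n0 _ hi) (pY_lin t q0 n0 hS) (linZ (pY_lin t q0 n0 hS)) hf // pYS_pT //.
rewrite hf; last lia.
by rewrite (linZ (pTi_lin t q0 n0 hi)) !scalerA mulVf // mul1r.
Qed.

Lemma pYi_pTi i e f : (0 < i < n)%N -> eigen e f ->
  pY i (pTi i f) = e i.+1 *: pTi i f + (e i.+1 * (1 - t^-1)) *: f.
Proof.
move=> hi hf; rewrite pY_pTi // hf; last lia.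
rewrite (linZ (pT_lin t q0 n0 hi)) pT_pTi // !scalerDr !scalerA.
by apply: lmod_comb; field.
Qed.

(* T_i^{-1} f satisfies the eigenvalue equations of s_i e up to multiples of f, which c removes. *)
Lemma swap_eigen i e f c : (0 < i < n)%N -> e i.+1 != e i ->
  c = e i.+1 * (1 - t^-1) / (e i.+1 - e i) ->
  eigen e f -> eigen (fun j => e (swapn i j)) (c *: f + pTi i f).
Proof.
move=> hi hne hc hf j hj; have hd : e i.+1 - e i != 0 by rewrite subr_eq0.
rewrite (pY_lin t q0 n0 hj) hf //.
case: (j =P i) => [->|/eqP h1].
  rewrite swapnL (pYi_pTi hi hf) scalerA addrCA -scalerDl scalerDr scalerA addrC.
  by apply: lmod_comb => //; rewrite hc; field; rewrite t0 hd.
case: (j =P i.+1) => [->|/eqP h2].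
  rewrite swapnR (pYS_pTi hi hf) scalerA addrA -scalerDl scalerDr scalerA.
  by apply: lmod_comb => //; rewrite hc; field; rewrite t0 hd.
have h1' : i != j by rewrite eq_sym.
have h2' : i.+1 != j by rewrite eq_sym.
rewrite swapnN // pY_pTi_comm //.
by rewrite hf // (linZ (pTi_lin t q0 n0 hi)) scalerDr !scalerA mulrC.
Qed.

Lemma phi_eigen e f : eigen e f ->
  eigen (fun j => if j == n then q * e 1%N else e j.+1) (pPhi f).
Proof.
move=> hf j hj; case: eqP => [->|h].
  have h1 : (0 < 1 <= n)%N by lia.
  by rewrite pY_pPhi_n (hf 1%N h1) [pPhi (_ *: _)](linZ pPhi_lin) scalerA.
by rewrite pY_pPhi ?hf ?(linZ pPhi_lin) //; lia.
Qed.

Lemma evY_msw i j eta : (0 < i < n)%N -> ev eta i != ev eta i.+1 -> (0 < j <= n)%N ->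
  evY (msw i eta) j = evY eta (swapn i j).
Proof. by move=> hi hne hj; rewrite /Defs.evY ev_msw // lp_msw. Qed.

Lemma evY_mphi j eta : (0 < j <= n)%N ->
  evY (mphi eta) j = if j == n then q * evY eta 1 else evY eta j.+1.
Proof.
move=> hj; rewrite /Defs.evY; case: eqP => [->|h].
  by rewrite ev_mphi_n // lp_mphi_n // exprS mulrA.
by rewrite ev_mphi ?lp_mphi //; lia.
Qed.

Lemma evY_neq i eta : (0 < i < n)%N -> ev eta i != ev eta i.+1 -> evY eta i.+1 != evY eta i.
Proof. by move=> hi; apply: contra => /eqP /qt_gen_div [-> _]. Qed.

Lemma evY_neq_eq i eta : (0 < i < n)%N -> evY eta i.+1 != evY eta i.
Proof.
move=> hi; apply/eqP => /qt_gen_div [e1 e2].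
move: e2; rewrite !lpE; try lia.
rewrite !(@big_cat_nat _ _ _ i 1 n.+1) /=; try lia.
rewrite !(@big_ltn _ _ _ i); try lia.
rewrite !(@big_ltn _ _ _ i.+1); try lia.
have h k : (i.+2 <= k < n.+1)%N -> lp_term eta k i.+1 = lp_term eta k i.
  by move=> hk; rewrite /lp_term e1;
    have [-> ->] : (k < i.+1)%N = false /\ (k < i)%N = false by lia.
have h' k : (1 <= k < i)%N -> lp_term eta k i.+1 = lp_term eta k i.
  by move=> hk; rewrite /lp_term e1; have [-> ->] : (k < i.+1)%N /\ (k < i)%N by lia.
rewrite (eq_big_nat _ _ h) (eq_big_nat _ _ h') /lp_term e1 !ltnn ltnSn leqnn ltnNge leqnSn /=.
lia.
Qed.

Definition is_homogeneous d (f : P) := forall mu, f@_mu != 0 -> mdeg mu = d.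

Lemma is_homogeneousD d (f g : P) : is_homogeneous d f -> is_homogeneous d g ->
  is_homogeneous d (f + g).
Proof.
move=> hf hg mu; rewrite mcoeffD; case: (eqVneq f@_mu 0) => [->|h _]; last exact: hf.
by rewrite add0r; exact: hg.
Qed.

Lemma ishomZ d c (f : P) : is_homogeneous d f -> is_homogeneous d (c *: f).
Proof. by move=> hf mu; rewrite mcoeffZ mulf_eq0 negb_or => /andP[_]; exact: hf. Qed.

Lemma mdeg_mswap (a b : 'I_n) eta : mdeg (mswap a b eta) = mdeg eta.
Proof.
rewrite !mdegE [RHS](reindex_inj (@perm_inj _ (tperm a b))) /=.
by apply: eq_bigr => j _; rewrite mnmE.
Qed.

Lemma mdeg_inner (a b : 'I_n) eta mu : a != b -> inner a b eta mu -> mdeg mu = mdeg eta.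
Proof.
move=> hab [h1 h2 _].
have E nu : mdeg nu = (nu a + nu b + \sum_(j < n | (j != a) && (j != b)) nu j)%N.
  by rewrite mdegE (bigD1 a) //= (bigD1 b) 1?eq_sym //= addnA.
rewrite !E h2.
by congr (_ + _)%N; apply: eq_bigr => j /andP[ha hb]; rewrite h1.
Qed.

Lemma ishom_pTi i d f : (0 < i < n)%N -> is_homogeneous d f -> is_homogeneous d (pTi i f).
Proof.
move=> hi hf mu /(lin_coef_neq0 (pTi_lin t q0 n0 hi)) [m /hf <-].
have hi1 : (i.-1 < n)%N by lia.
have hi2 : (i < n)%N by lia.
pose a := Ordinal hi1; pose b := Ordinal hi2.
have ab : b = a.+1 :> nat by rewrite /=; lia.
have {1}-> : i = a.+1 by rewrite /=; lia.
have hab : a != b by rewrite -val_eqE /=; lia.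
move=> /(pTi_supp q0 t0 n0 ab) [->|[-> //]|/(mdeg_inner hab) //].
exact: mdeg_mswap.
Qed.

Lemma pPhi_mono ka : pPhi 'X_[ka] = q ^+ (ev ka 1) *: 'X_[mphi ka].
Proof.
have hn : (n.-1 < n)%N by lia.
have e : xv K n n = 'X_(Ordinal hn) by rewrite -xv_ord /= prednK.
rewrite /pPhi -lock (pom_mono q0 t0 n0) e -scalerAr -mpolyXD; congr (_ *: 'X_[_]).
apply/mnmP => j; rewrite mnmDE mnm1E !mnmE -val_eqE /=.
case: (j.+1 =P n) => h.
  have -> : (n.-1 == j) by lia.
  by rewrite (mnm_nth 0%N) /= h modnn.
have -> : (n.-1 == j) = false by lia.
by rewrite (mnm_nth 0%N) /= modn_small //; have := ltn_ord j; lia.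
Qed.

Lemma pPhi_coef f nu : (pPhi f)@_(mphi nu) = q ^+ (ev nu 1) * f@_nu.
Proof.
rewrite (lin_coef1 (m0 := nu) pPhi_lin);
  first by rewrite pPhi_mono mcoeffZ mcoeffX eqxx mulr1 mulrC.
move=> m _; rewrite pPhi_mono mcoeffZ mcoeffX; case: (_ =P mphi nu) => [/(mphi_inj n0) //|_].
by rewrite mulr0 eqxx.
Qed.

Lemma ishom_pPhi d f : is_homogeneous d f -> is_homogeneous d.+1 (pPhi f).
Proof.
move=> hf mu /(lin_coef_neq0 pPhi_lin) [m /hf <-].
rewrite pPhi_mono mcoeffZ mcoeffX; case: (_ =P mu) => [<- _|_]; last by rewrite mulr0 eqxx.
exact: mdeg_mphi.
Qed.
End Eigen.

Section Emac.
Variables (K : fieldType) (n : nat).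
Notation P := {mpoly K[n]}.
Variables (q t : K).
Hypothesis q0 : q != 0.
Hypothesis t0 : t != 0.
Hypothesis n0 : (0 < n)%N.
Hypothesis qt_gen : forall a b c d : nat, q ^+ a * t ^+ b = q ^+ c * t ^+ d -> a = c /\ b = d.
Notation pT := (@pT K n t).
Notation pTi := (@pTi K n t).
Notation pPhi := (@pPhi K n q).
Notation evY := (@evY K n q t).
Notation eigen := (@eigen K n q t).
Implicit Types eta nu mu : 'X_{1..n}.

Lemma isE_eigen eta (f : P) : isE q t eta f -> eigen (evY eta) f.
Proof.
move=> [_ [_ h]] i hi; apply: leqL_lpoly.
by have := h i hi; rewrite lY_lpoly.
Qed.

Lemma eigen_isE eta (f : P) : f@_eta = 1 -> eigen (evY eta) f -> isE q t eta f.
Proof.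
move=> h1 h; split=> //; split=> [nu hnu|i hi]; last by rewrite lY_lpoly h.
by have [/ple_prec] := eigen_supp q0 t0 n0 qt_gen h hnu.
Qed.

Lemma mswap_msw (a b : 'I_n) eta : b = a.+1 :> nat -> mswap a b eta = msw b eta.
Proof.
move=> ab; apply/mnmP => j; rewrite !mnmE -ev_ord; congr (ev eta _).
have -> : swapn b j.+1 = if j == a then b.+1 else if j == b then b : nat else j.+1.
  by rewrite /swapn {1}ab !eqSS.
case: tpermP => [->|->|/eqP/negPf -> /eqP/negPf -> //]; rewrite eqxx //.
by have -> : (b == a) = false by rewrite -val_eqE /= ab; lia.
Qed.

Lemma ple_msw i eta : (0 < i < n)%N -> (ev eta i < ev eta i.+1)%N -> ple eta (msw i eta).
Proof.
move=> hi hlt; have hi1 : (i.-1 < n)%N by lia.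
have hi2 : (i < n)%N by lia.
pose a := Ordinal hi1; pose b := Ordinal hi2.
have ab : b = a.+1 :> nat by rewrite /=; lia.
rewrite -{1}(mswK hi eta) -[X in ple (msw X _) _]/(nat_of_ord b) -(mswap_msw _ ab).
apply: mswap_ple; first by rewrite ab.
have ea : a.+1 = i by rewrite /=; lia.
rewrite -!ev_ord ea -[b.+1]/(i.+1) !ev_msw ?swapnL ?swapnR //; lia.
Qed.

Lemma pTi_coef i eta f c : (0 < i < n)%N -> (ev eta i < ev eta i.+1)%N ->
  f@_eta = 1 -> eigen (evY eta) f -> (c *: f + pTi i f)@_(msw i eta) = 1.
Proof.
move=> hi hlt h1 hf; have hi1 : (i.-1 < n)%N by lia.
have hi2 : (i < n)%N by lia.
pose a := Ordinal hi1; pose b := Ordinal hi2.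
have ab : b = a.+1 :> nat by rewrite /=; lia.
have ea : a.+1 = i by rewrite /=; lia.
have hsw := mswap_msw eta ab; rewrite [X in msw X _]/= in hsw.
rewrite mcoeffD mcoeffZ.
have -> : f@_(msw i eta) = 0.
  apply/eqP/negPn/negP => /(eigen_supp q0 t0 n0 qt_gen hf) [h _].
  have e : msw i eta = eta by apply: ple_anti => //; exact: ple_msw.
  have := @ev_msw n i i eta ltac:(lia); rewrite e swapnL; lia.
rewrite mulr0 add0r (lin_coef1 (m0 := eta) (pTi_lin t q0 n0 hi)).
  have := pTi_swap q0 t0 n0 ab eta; rewrite ea hsw h1 mul1r => ->.
  by rewrite -!ev_ord ea -[b.+1]/(i.+1) leqNgt hlt.
move=> m /(eigen_supp q0 t0 n0 qt_gen hf) [h2 _].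
have := @pTi_supp K n q t q0 t0 n0 a b ab m (msw i eta); rewrite ea => H /H [].
- rewrite -hsw; by move=> /(congr1 (mswap a b)); rewrite !(mswap_msw _ ab) !mswK.
- move=> [e _]; exfalso; have e2 : msw i eta = eta.
    by apply: ple_anti; [rewrite e|exact: ple_msw].
  have := @ev_msw n i i eta ltac:(lia); rewrite e2 swapnL; lia.
- move=> /inner_ple [|h3 _]; first by rewrite -val_eqE /=; lia.
  exfalso; have e2 : msw i eta = eta.
    apply: ple_anti; [exact: ple_trans h3 h2|exact: ple_msw].
  have := @ev_msw n i i eta ltac:(lia); rewrite e2 swapnL; lia.
Qed.

Definition is_nsmac eta (f : P) := [/\ f@_eta = 1, is_homogeneous (mdeg eta) f & eigen (evY eta) f].

Definition swap_coef eta i := evY eta i.+1 * (1 - t^-1) / (evY eta i.+1 - evY eta i).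

Lemma eigen_ext e e' f : (forall i, (0 < i <= n)%N -> e i = e' i) -> eigen e f -> eigen e' f.
Proof. by move=> h hf i hi; rewrite hf // h. Qed.

Lemma is_nsmac_swap i eta f : (0 < i < n)%N -> (ev eta i < ev eta i.+1)%N ->
  is_nsmac eta f -> is_nsmac (msw i eta) (swap_coef eta i *: f + pTi i f).
Proof.
move=> hi hlt [h1 h2 h3]; have hne : ev eta i != ev eta i.+1 by rewrite neq_ltn hlt.
split; first exact: pTi_coef.
  by rewrite mdeg_msw //; apply: is_homogeneousD; [apply: ishomZ|apply: (ishom_pTi q0 t0 n0)].
apply: eigen_ext (swap_eigen q0 t0 n0 hi (evY_neq t0 qt_gen hi hne) (erefl (swap_coef eta i)) h3).
by move=> j hj; rewrite evY_msw.
Qed.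

Lemma is_nsmac_phi eta f : is_nsmac eta f -> is_nsmac (mphi eta) (q ^- (ev eta 1) *: pPhi f).
Proof.
move=> [h1 h2 h3]; split.
- by rewrite mcoeffZ (pPhi_coef q0 t0 n0) h1 mulr1 mulVf // expf_neq0.
- by rewrite mdeg_mphi //; apply: ishomZ; apply: (ishom_pPhi q0 t0 n0).
- have := phi_eigen q0 t0 n0 h3; set e' := (fun j => _) => h.
  have he : eigen (evY (mphi eta)) (pPhi f).
    by apply: eigen_ext h => j hj; rewrite (evY_mphi q t0 n0).
  by move=> j hj; rewrite (linZ (pY_lin t q0 n0 hj)) he // !scalerA mulrC.
Qed.

Lemma foldr_scale (A : nat -> P -> P) c a l f : (forall i, i \in l -> lin (A i)) ->
  (forall i, i \in l -> A i f = c *: f) -> foldr A (a *: f) l = (a * c ^+ size l) *: f.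
Proof.
elim: l => [|i l IH] hA h /=; first by rewrite mulr1.
rewrite IH.
- rewrite (linZ (hA i (mem_head _ _))) h ?mem_head // scalerA exprS.
  by congr (_ *: _); rewrite -mulrA [_ * c]mulrC.
- by move=> j hj; apply: hA; rewrite in_cons hj orbT.
- by move=> j hj; apply: h; rewrite in_cons hj orbT.
Qed.

Lemma is_nsmac0 : is_nsmac 0%MM 1.
Proof.
have ev0 i : ev (0%MM : 'X_{1..n}) i = 0%N.
  rewrite /ev; case: (ltnP i.-1 n) => h; last by rewrite nth_default ?size_tuple.
  by rewrite -(mnm_nth 0%N _ (Ordinal h)) mnm0E.
split; first by rewrite mcoeff1 eqxx.
  by move=> mu; rewrite mcoeff1; case: (mu =P 0%MM) => [->//|_]; rewrite eqxx.
have T1 i : (0 < i < n)%N -> pT i 1 = t *: 1.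
  move=> hi; apply: tofrac_inj; rewrite (tofrac_pT t q0 n0 _ hi) tofracZ tofrac1.
  by rewrite hT_inv // rmorph1.
have Ti1 i : (0 < i < n)%N -> pTi i 1 = t^-1 *: 1.
  move=> hi; rewrite (pTiE t q0 n0 _ hi) T1 // scalerA -scalerDl mulVf //.
  by rewrite subrK.
have om1 c : pom q (c *: 1 : P) = c *: 1.
  rewrite (linZ (@pom_lin K n q)); congr (_ *: _).
  by rewrite /pom -lock rmorph1.
move=> i hi; rewrite (pYE q0 t0 n0 _ hi).
rewrite -[in foldr pTi _](scale1r (1 : P)) (@foldr_scale pTi t^-1); first last.
- by move=> j; rewrite mem_iota => hj; apply: Ti1; lia.
- by move=> j; rewrite mem_iota => hj; apply: (pTi_lin t q0 n0); lia.
rewrite om1 (@foldr_scale pT t); first last.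
- by move=> j; rewrite mem_iota => hj; apply: T1; lia.
- by move=> j; rewrite mem_iota => hj; apply: (pT_lin t q0 n0); lia.
rewrite !size_iota scalerA mul1r /Defs.evY ev0 expr0 mul1r; congr (_ *: _).
have -> : lp (0%MM : 'X_{1..n}) i = i.-1.
  rewrite /lp (eq_big_nat _ _ (F2 := fun=> 1%N)); last by move=> k _; rewrite !ev0.
  rewrite [X in (_ + X)%N]big1; last by move=> k _; rewrite !ev0.
  by rewrite sum_nat_const_nat muln1 addn0 subn1.
by rewrite mulrCA mulVf ?mulr1 ?exprVn // expf_neq0.
Qed.
End Emac.

Section Emac.
Variables (K : fieldType) (n : nat).
Notation P := {mpoly K[n]}.
Notation F := {fraction P}.
Notation kF := (kF K n).
Notation XF := (XF K n).
Notation sF := (sF K n).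
Variables (q t : K).
Hypothesis q0 : q != 0.
Hypothesis t0 : t != 0.
Hypothesis n0 : (0 < n)%N.
Hypothesis qt_gen : forall a b c d : nat, q ^+ a * t ^+ b = q ^+ c * t ^+ d -> a = c /\ b = d.
Notation om := (WF n q0 n.-1).
Notation TF := (hT kF t XF sF).
Notation TiF := (hTi kF t XF sF).
Notation DF := (hD n kF t XF sF om).
Notation pTi := (@pTi K n t).
Notation pPhi := (@pPhi K n q).
Notation evY := (@evY K n q t).
Let act := affine_action_F q0 n0.
Implicit Types eta nu mu : 'X_{1..n}.
Notation is_nsmac := (is_nsmac q t).

(* A composition with eta_n = 0 has a descent to a zero entry; swapping there decreases wdeg, and
   eta_n > 0 means that eta is in the image of mphi. *)
Definition wdeg eta := (\sum_(k < n) (n - k.+1) * ev eta k.+1)%N.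

Lemma wdeg_msw i eta : (0 < i < n)%N -> (0 < ev eta i)%N -> ev eta i.+1 = 0%N ->
  (wdeg (msw i eta) < wdeg eta)%N.
Proof.
move=> hi h1 h2; rewrite /wdeg.
have -> : (\sum_(k < n) (n - k.+1) * ev (msw i eta) k.+1 =
           \sum_(k < n) (n - swapn i k.+1) * ev eta k.+1)%N.
  rewrite -(big_swapn hi addn (fun k => (n - swapn i k) * ev eta k)%N) /=.
  by apply: eq_bigr => k _; rewrite swapnK ev_msw ?ltn_ord.
have hi1 : (i.-1 < n)%N by lia.
rewrite !(bigD1 (Ordinal hi1) (P := predT)) //=.
have -> : i.-1.+1 = i by lia.
rewrite swapnL -addSn leq_add //; first by rewrite ltn_mul2r h1; lia.
apply: leq_sum => k hk; rewrite leq_mul2r.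
case: (k.+1 =P i.+1) => [->|/eqP hk1]; first by rewrite h2.
rewrite swapnN ?leqnn ?orbT //.
by apply: contra hk => /eqP e; rewrite -val_eqE /=; lia.
Qed.

Lemma exists_descent eta : eta <> 0%MM -> ev eta n = 0%N ->
  exists2 i, (0 < i < n)%N & (0 < ev eta i)%N && (ev eta i.+1 == 0%N).
Proof.
move=> h0 hn.
case: (boolP (has (fun i => (0 < ev eta i)%N && (ev eta i.+1 == 0%N)) (iota 1 n.-1))).
  by move=> /hasP [i]; rewrite mem_iota => hi h; exists i => //; lia.
move=> /hasPn h; case: h0; apply: ev_ext => i hi.
have -> : ev (0%MM : 'X_{1..n}) i = 0%N.
  rewrite /ev; have hi' : (i.-1 < n)%N by lia.
  by rewrite -(mnm_nth 0%N _ (Ordinal hi')) mnm0E.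
have [d hd] : exists d, (i + d = n)%N by exists (n - i)%N; lia.
elim: d i hi hd => [|d IH] i hi hd; first by rewrite -hn; congr ev; lia.
have e := IH i.+1 ltac:(lia) ltac:(lia).
have := h i; rewrite mem_iota e eqxx andbT -eqn0Ngt => h'; apply/eqP; apply: h'.
lia.
Qed.

Lemma exists_nsmac eta : exists f, is_nsmac eta f.
Proof.
have [d] := ubnP (mdeg eta); elim: d => // d IHd in eta *.
have [w] := ubnP (wdeg eta); elim: w => // w IHw in eta *.
move=> hw hd; case: (eta =P 0%MM) => [->|h0]; first by exists 1; apply: (is_nsmac0 q0 t0 n0).
case: (posnP (ev eta n)) => [hn|/(mphi_surj n0) [nu e]].
  have [i hi /andP[h1 /eqP h2]] := exists_descent h0 hn.
  have [] := IHw (msw i eta) _ _; rewrite ?mdeg_msw //.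
    by apply: leq_trans (wdeg_msw hi h1 h2) _; rewrite -ltnS.
  move=> f hf; rewrite -[eta](mswK hi).
  have hlt : (ev (msw i eta) i < ev (msw i eta) i.+1)%N.
    rewrite !ev_msw ?swapnL ?swapnR ?h2 //; lia.
  by exists (swap_coef q t (msw i eta) i *: f + pTi i f);
    exact: (is_nsmac_swap q0 t0 n0 qt_gen hi hlt hf).
have [|f hf] := IHd nu; first by move: hd; rewrite e mdeg_mphi.
by rewrite e; exists (q ^- (ev nu 1) *: pPhi f); exact: (is_nsmac_phi q0 t0 n0 hf).
Qed.

Notation E := (@Emac K n q t).

Lemma Emac_nsmac eta : is_nsmac eta (E eta).
Proof.
have [f hf] := exists_nsmac eta; have [f1 f2 f3] := hf.
have hE : isE q t eta (E eta).
  by apply: pick0P; exists f; apply: (eigen_isE q0 t0 n0 qt_gen).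
have [E1 _] := hE; have E3 := isE_eigen hE.
by have := eigen_uniq q0 t0 n0 qt_gen E3 f3 f1; rewrite E1 scale1r => ->.
Qed.

Lemma nsmac_unique eta f : is_nsmac eta f -> f = E eta.
Proof.
move=> [f1 f2 f3]; have [E1 E2 E3] := Emac_nsmac eta.
by have := eigen_uniq q0 t0 n0 qt_gen f3 E3 E1; rewrite f1 scale1r.
Qed.

Lemma E_swap i eta : (0 < i < n)%N -> (ev eta i < ev eta i.+1)%N ->
  pTi i (E eta) = E (msw i eta) - swap_coef q t eta i *: E eta.
Proof.
move=> hi hlt; rewrite -(nsmac_unique (is_nsmac_swap q0 t0 n0 qt_gen hi hlt (Emac_nsmac eta))).
by rewrite addrC addKr.
Qed.

Lemma E_phi eta : pPhi (E eta) = q ^+ (ev eta 1) *: E (mphi eta).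
Proof.
rewrite -(nsmac_unique (is_nsmac_phi q0 t0 n0 (Emac_nsmac eta))) scalerA mulfV ?scale1r //.
by rewrite expf_neq0.
Qed.

Lemma E_eq i eta : (0 < i < n)%N -> ev eta i = ev eta i.+1 -> pTi i (E eta) = t^-1 *: E eta.
Proof.
move=> hi e; have [E1 E2 E3] := Emac_nsmac eta.
have hz : swap_coef q t eta i *: E eta + pTi i (E eta) = 0.
  apply: (eigen0 q0 t0 n0 (swap_eigen q0 t0 n0 hi (evY_neq_eq t0 n0 qt_gen eta hi)
    (erefl (swap_coef q t eta i)) E3)).
  move=> nu h; exfalso; have enu : nu = eta.
    apply: ev_ext => j hj; have [-> _] := qt_gen_div t0 qt_gen (h j hj).
    case: (j =P i) => [->|/eqP h1]; first by rewrite swapnL.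
    case: (j =P i.+1) => [->|/eqP h2]; first by rewrite swapnR.
    by rewrite swapnN.
  have hi' : (0 < i <= n)%N by lia.
  have := h i hi'; rewrite enu swapnL => /esym/eqP.
  by apply/negP; apply: (evY_neq_eq t0 n0 qt_gen).
have hc : (pTi i (E eta))@_eta = t^-1.
  have hi1 : (i.-1 < n)%N by lia.
  have hi2 : (i < n)%N by lia.
  pose a := Ordinal hi1; pose b := Ordinal hi2.
  have ab : b = a.+1 :> nat by rewrite /=; lia.
  have ea : a.+1 = i by rewrite /=; lia.
  have eab : eta a = eta b by rewrite -!ev_ord ea e.
  have hab : a != b by rewrite -val_eqE /=; lia.
  rewrite (lin_coef1 (m0 := eta) (pTi_lin t q0 n0 hi)) => [|m /(eigen_supp q0 t0 n0 qt_gen E3)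
    [h2 _]].
    have := pTi_swap q0 t0 n0 ab eta; rewrite ea mswap_eq // => ->.
    by rewrite eab leqnn E1 mul1r.
  have := @pTi_supp K n q t q0 t0 n0 a b ab m eta; rewrite ea => H /H [].
  - move=> e2; have := congr1 (mswap a b) e2; rewrite (mswap_eq eab) e2 => ->.
    by apply/mnmP => j; rewrite !mnmE tpermK.
  - by case.
  - by move=> /(inner_ple hab) [h3 _]; apply: ple_anti.
have := congr1 (mcoeff eta) hz; rewrite mcoeffD mcoeffZ E1 mulr1 hc mcoeff0 => hcE.
have -> : t^-1 = - swap_coef q t eta i by apply/eqP; rewrite -addr_eq0 addrC hcE.
by apply/eqP; rewrite scaleNr -addr_eq0 addrC hz.
Qed.

Lemma PhiF eta : XF n * foldr TiF (E eta)%:F (rev (iota 1 n.-1)) =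
  kF (t ^+ (lp eta 1) * t ^- n.-1) * (E (mphi eta))%:F.
Proof.
have [E1 E2 E3] := Emac_nsmac eta.
have h1 : (0 < 1 <= n)%N by [].
have hY1 : hY n kF t XF sF om 1 (E eta)%:F = kF (evY eta 1) * (E eta)%:F.
  by rewrite -(tofrac_pY t q0 n0 _ h1) E3 // tofracZ.
have := hPhi_eigen act q0 t0 n0 hY1.
have hev : evY eta 1 != 0 by rewrite mulf_neq0 ?invr_neq0 ?expf_neq0.
set S := foldr _ _ _ => hS.
have -> : S = kF ((evY eta 1)^-1 * t ^- n.-1) * om (E eta)%:F.
  rewrite rmorphM -mulrA -hS mulrA -rmorphM mulVf // rmorph1 mul1r //.
have hP := congr1 (@FracField.tofrac P) (E_phi eta).
rewrite mulrCA -[XF n * _]/(hPhi n XF om (E eta)%:F) -tofrac_pPhi hP tofracZ mulrA -rmorphM.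
congr (kF _ * _); rewrite /Defs.evY.
have : q ^+ (ev eta 1) != 0 by rewrite expf_neq0.
have : t ^+ (lp eta 1) != 0 by rewrite expf_neq0.
move: (t ^- n.-1) (q ^+ _) (t ^+ lp _ _) => w u v hv hu.
by field; rewrite hu hv.
Qed.

Lemma PhihatF eta : foldr TF (DF n (E (mphi eta))%:F) (iota 1 n.-1) =
  kF ((t ^+ (lp eta 1) * t ^- n.-1)^-1 * (1 - t ^+ n.-1 * evY (mphi eta) n)) * (E eta)%:F.
Proof.
have [E1 E2 E3] := Emac_nsmac (mphi eta).
have hn : (0 < n <= n)%N by rewrite n0 leqnn.
apply: (hPhihat_eigen act q0 t0 n0).
- by rewrite mulf_neq0 ?invr_neq0 ?expf_neq0.
- by rewrite -(tofrac_pY t q0 n0 _ hn) E3 // tofracZ.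
- by rewrite PhiF.
Qed.

Lemma PhihatF0 eta : ev eta n = 0%N -> foldr TF (DF n (E eta)%:F) (iota 1 n.-1) = 0.
Proof.
move=> h0; have [E1 E2 E3] := Emac_nsmac eta.
have hn : (0 < n <= n)%N by rewrite n0 leqnn.
have hY1 : hY n kF t XF sF om n (E eta)%:F = kF (evY eta n) * (E eta)%:F.
  by rewrite -(tofrac_pY t q0 n0 _ hn) E3 // tofracZ.
have hlp : lp eta n = n.-1.
  rewrite /lp [X in (_ + X)%N]big_geq // addn0 h0.
  by rewrite (eq_big_nat _ _ (F2 := fun=> 1%N)) // sum_nat_const_nat muln1 subn1.
have -> : DF n (E eta)%:F = kF 0 * 0.
  rewrite hD_n hY1 mulrA -rmorphM /Defs.evY h0 hlp expr0 mul1r mulfV ?expf_neq0 //.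
  by rewrite rmorph1 mul1r subrr !mulr0.
rewrite foldr_Z ?rmorph0 ?mul0r // => j c f.
exact: (hT_Z t act).
Qed.
End Emac.

Section Legs.
Variable n : nat.
Implicit Types eta nu : 'X_{1..n}.

Definition leg_term eta k i j : bool :=
  if (k < i)%N then ((j <= (ev eta k).+1) && ((ev eta k).+1 <= ev eta i))%N
  else if k == i then false else ((j <= ev eta k) && (ev eta k <= ev eta i))%N.

Lemma legE eta i j : (0 < i <= n)%N -> leg eta i j = (\sum_(1 <= k < n.+1) leg_term eta k i j)%N.
Proof.
move=> hi; rewrite (@big_cat_nat _ _ _ i) /=; try lia.
rewrite [in RHS](@big_ltn _ _ _ i); last lia.
rewrite {2}/leg_term ltnn eqxx add0n /leg addnC; congr (_ + _)%N; apply: eq_big_nat => k hk;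
  rewrite /leg_term.
  by have -> : (k < i)%N by lia.
have -> : (k < i)%N = false by lia.
by have -> : (k == i) = false by lia.
Qed.

Lemma colegE eta i : coleg eta i = lp eta i.
Proof. by rewrite /coleg addnC. Qed.

Section Phi.
Hypothesis n0 : (0 < n)%N.

Lemma leg_mphi eta i j : (0 < i < n)%N -> leg (mphi eta) i j = leg eta i.+1 j.
Proof.
move=> hi; rewrite !legE; try lia.
rewrite -(sum_rot (fun k => leg_term eta k i.+1 j) n0) big_nat_recr //=; congr (_ + _)%N.
  by apply: eq_big_nat => k hk; rewrite /leg_term ltnS eqSS !ev_mphi.
rewrite /leg_term ev_mphi_n // ev_mphi //.
have -> : (n < i)%N = false by lia.
have -> : (n == i) = false by lia.
by have -> : (1 < i.+1)%N by lia.
Qed.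

Lemma leg_mphi_n eta j : (0 < j)%N -> leg (mphi eta) n j.+1 = leg eta 1 j.
Proof.
move=> hj; rewrite !legE; try lia.
rewrite -(sum_rot (fun k => leg_term eta k 1 j) n0) big_nat_recr //=; congr (_ + _)%N; last first.
  by rewrite /leg_term ltnn !eqxx.
apply: eq_big_nat => k hk; rewrite /leg_term ev_mphi_n // ev_mphi // !ltnS.
by case/andP: (hk) => h ->; case: k hk h.
Qed.

Lemma leg_mphi_n1 eta : (leg (mphi eta) n 1 = n.-1 - lp eta 1)%N.
Proof.
rewrite -[leg _ _ _](addnK (lp eta 1)); congr (_ - _)%N.
rewrite legE ?lpE; try lia.
rewrite -(sum_rot (fun k => lp_term eta k 1) n0) big_nat_recr //=.
rewrite {2}/leg_term ltnn eqxx addn0 {2}/lp_term ltnn ltnn addn0 -big_split /=.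
rewrite (eq_big_nat _ _ (F2 := fun=> 1%N)); first by rewrite sum_nat_const_nat muln1 subn1.
move=> k hk; rewrite /leg_term /lp_term ev_mphi_n // ev_mphi //.
case/andP: (hk) => h ->; rewrite /= ltnS.
by case: leqP.
Qed.

Variable (R : comNzRingType).
Definition noderow (G : nat -> nat ->
  R) eta i := \prod_(1 <= j < (ev eta i).+1) G (arm eta i j) (leg eta i j).
Definition nodeprodG G eta := \prod_(1 <= i < n.+1) noderow G eta i.

Lemma prod_rot (F : nat -> R) :
  \prod_(1 <= k < n) F k.+1 * F 1%N = \prod_(1 <= k < n.+1) F k.
Proof. by rewrite [RHS]big_ltn // mulrC; congr (_ * _); rewrite [RHS]big_add1. Qed.

Lemma nodeprodG_mphi G eta :
  nodeprodG G (mphi eta) = nodeprodG G eta * G (ev eta 1) (n.-1 - lp eta 1)%N.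
Proof.
rewrite /nodeprodG big_nat_recr //= -(prod_rot (noderow G eta)) -mulrA; congr (_ * _).
  apply: eq_big_nat => k hk; rewrite /noderow ev_mphi //; apply: eq_bigr => j _.
  by rewrite /arm ev_mphi // leg_mphi.
rewrite /noderow ev_mphi_n // big_ltn // mulrC leg_mphi_n1 /arm ev_mphi_n // subSS subn0.
rewrite big_add1; congr (_ * _); apply: eq_big_nat => j hj.
by rewrite subSS leg_mphi_n //; lia.
Qed.

Lemma lprod_mphi (H : nat -> nat -> R) eta :
  \prod_(1 <= i < n.+1) \prod_(1 <= j < (ev (mphi eta) i).+1) H j (lp (mphi eta) i) =
  (\prod_(1 <= i < n.+1) \prod_(1 <= j < (ev eta i).+1) H j (lp eta i))
    * H (ev eta 1).+1 (lp eta 1).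
Proof.
rewrite big_nat_recr //= -(prod_rot (fun i => \prod_(1 <= j < (ev eta i).+1) H j (lp eta i))).
rewrite -mulrA; congr (_ * _).
  by apply: eq_big_nat => k hk; rewrite ev_mphi // lp_mphi.
by rewrite ev_mphi_n // lp_mphi_n // big_nat_recr.
Qed.

End Phi.

Section Swap.
Variables (i : nat) (eta : 'X_{1..n}).
Hypothesis hi : (0 < i < n)%N.
Hypothesis hlt : (ev eta i < ev eta i.+1)%N.
Let sg := msw i eta.
Let p := ev eta i.
Let r := ev eta i.+1.

Let hi1 : (0 < i <= n)%N. Proof. by lia. Qed.
Let hi2 : (0 < i.+1 <= n)%N. Proof. by lia. Qed.

Lemma leg_msw x j : (0 < x <= n)%N -> x != i -> leg sg x j = leg eta (swapn i x) j.
Proof.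
move=> hx hxi; rewrite !legE ?swapn_bound // !sum_nat_ord.
rewrite -(big_swapn hi addn (fun k => leg_term eta k (swapn i x) j)) /=.
apply: eq_bigr => k _; rewrite /leg_term !ev_msw ?ltn_ord // (inj_eq (inv_inj (swapnK i))).
have hk := ltn_ord k; move: {k}(k.+1) hk => k hk.
case: (x =P i.+1) => [->|/eqP hx2].
  rewrite swapnR; case: (k =P i) => [->|/eqP h1].
    rewrite swapnL ltnSn (ltnNge i.+1) leqnSn /=.
    have -> : (i == i.+1) = false by lia.
    by rewrite (leqNgt (ev eta i.+1).+1) ltnS (ltnW hlt) (leqNgt (ev eta i.+1)) hlt !andbF.
  case: (k =P i.+1) => [->|/eqP h2]; first by rewrite swapnR !ltnn.
  by rewrite swapnN //; have -> : (k < i.+1)%N = (k < i)%N by lia.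
rewrite (swapnN hxi hx2); case: (k =P i) => [->|/eqP h1].
  by rewrite swapnL; have -> : (i.+1 < x)%N = (i < x)%N by lia.
case: (k =P i.+1) => [->|/eqP h2]; last by rewrite swapnN.
by rewrite swapnR; have -> : (i.+1 < x)%N = (i < x)%N by lia.
Qed.

Lemma leg_msw_i j : (leg eta i.+1 j = leg sg i j + (j == p.+1))%N.
Proof.
rewrite !legE // !sum_nat_ord.
rewrite -(big_swapn hi addn (fun k => leg_term eta k i.+1 j)) /=.
have -> : nat_of_bool (j == p.+1) =
  (\sum_(k < n) (if k.+1 == i.+1 then nat_of_bool (j == p.+1) else 0))%N.
  have h : (i < n)%N by lia.
  rewrite (bigD1 (Ordinal h)) //= eqxx big1 ?addn0 // => k hk.
  by rewrite eqSS; case: eqP => // e; move: hk; rewrite -val_eqE /= e eqxx.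
rewrite -big_split /=; apply: eq_bigr => k _; rewrite /leg_term !ev_msw ?ltn_ord // swapnL.
move: (k.+1) => {}k.
have e1 : (i.+1 < i)%N = false by lia.
have e2 : (i.+1 == i) = false by lia.
case: (k =P i) => [->|/eqP h1].
  by rewrite swapnL !ltnn eqxx; have -> : (i == i.+1) = false by lia.
case: (k =P i.+1) => [->|/eqP h2]; last first.
  rewrite swapnN // addn0 (negPf h2).
  by have -> : (k < i.+1)%N = (k < i)%N by lia.
rewrite swapnR ltnSn e1 hlt andbT (ltnW hlt) andbT /p.
by case: (ltngtP j (ev eta i).+1); lia.
Qed.

Lemma lp_msw_leg : (lp eta i = lp eta i.+1 + leg sg i p.+1 + 1)%N.
Proof.
rewrite !lpE // legE // !sum_nat_ord.
have -> : 1%N = (\sum_(k < n) (k.+1 == i.+1))%N.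
  have h : (i < n)%N by lia.
  rewrite (bigD1 (Ordinal h)) //= eqxx big1 ?addn0 // => k hk.
  by rewrite eqSS; case: eqP => // e; move: hk; rewrite -val_eqE /= e eqxx.
rewrite -!big_split /=; apply: eq_bigr => k _;
  rewrite /leg_term /lp_term !ev_msw ?ltn_ord // swapnL.
move: (k.+1) => {}k; rewrite /p.
have e1 : (i.+1 < i)%N = false by lia.
have e2 : (i.+1 == i) = false by lia.
case: (k =P i) => [->|/eqP h1].
  have -> : (i == i.+1) = false by lia.
  by rewrite !ltnn ltnSn leqNgt hlt.
case: (k =P i.+1) => [->|/eqP h2].
  by rewrite !ltnn e1 ?e2 swapnR ?eqxx hlt ?ltnn.
rewrite swapnN // ?(negPf h1) ?(negPf h2).
have -> : (k < i.+1)%N = (k < i)%N by lia.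
by case: ifP => _; lia.
Qed.

Variable (R : comNzRingType).

Lemma nodeprodG_msw (G : nat -> nat -> R) (l := leg sg i p.+1) (a := (r - p.+1)%N) :
  nodeprodG G eta * G a l = nodeprodG G sg * G a l.+1.
Proof.
have row_other x : (0 < x <= n)%N -> x != i -> noderow G sg x = noderow G eta (swapn i x).
  move=> hx hxi; rewrite /noderow ev_msw //; apply: eq_bigr => j _.
  by rewrite /arm ev_msw // leg_msw.
have row_i : noderow G eta i.+1 * G a l = noderow G sg i * G a l.+1.
  rewrite /noderow ev_msw // swapnL.
  have hp : p.+1 \in index_iota 1 r.+1 by rewrite mem_index_iota; rewrite /p /r; lia.
  rewrite (bigD1_seq p.+1) ?iota_uniq //= [in RHS](bigD1_seq p.+1) ?iota_uniq //=.
  rewrite leg_msw_i eqxx addn1 /arm !ev_msw // swapnL mulrAC [RHS]mulrAC; congr (_ * _).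
    by rewrite mulrC.
  apply: eq_bigr => j hj; rewrite leg_msw_i (negPf hj).
  by rewrite addn0.
rewrite /nodeprodG !big_add1 !big_mkord.
rewrite -(big_swapn hi (GRing.mul : Monoid.com_law 1) (fun k => noderow G eta k)).
have h : (i.-1 < n)%N by lia.
rewrite !(bigD1 (Ordinal h) (P := predT)) //=.
have -> : i.-1.+1 = i by lia.
rewrite swapnL mulrAC row_i mulrAC; congr (_ * _ * _).
apply: eq_bigr => k hk; rewrite row_other ?ltn_ord //.
by apply: contra hk => /eqP e; rewrite -val_eqE /=; lia.
Qed.

Lemma lprod_msw (H : nat -> nat -> R) :
  \prod_(1 <= i < n.+1) \prod_(1 <= j < (ev sg i).+1) H j (lp sg i) =
  \prod_(1 <= i < n.+1) \prod_(1 <= j < (ev eta i).+1) H j (lp eta i).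
Proof.
rewrite !big_add1 !big_mkord.
rewrite -(big_swapn hi (GRing.mul : Monoid.com_law 1)
  (fun k => \prod_(1 <= j < (ev eta k).+1) H j (lp eta k))).
apply: eq_bigr => k _; rewrite ev_msw ?ltn_ord // lp_msw ?ltn_ord //.
by rewrite neq_ltn hlt.
Qed.
End Swap.
End Legs.

Section KernelPairs.
Variables (K F : fieldType) (n : nat) (kF : {rmorphism K -> F}).
Notation P := {mpoly K[n]}.
Variables (c : 'X_{1..n} -> K) (E : 'X_{1..n} -> F) (Eb : 'X_{1..n} -> P).

(* [kernel_pair e A B] is the identity A^(x) K_A = B^(y) K_A, read off at each monomial in y and
   truncated to total degree < N; e is the amount by which A lowers the degree *)
Definition kernel_pair (e : nat) (A : F -> F) (B : P -> P) : Prop := forall N m,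
  \sum_(eta : 'X_{1..n < (N + e)%N}) kF (c eta * (Eb eta)@_m) * A (E eta) =
  \sum_(eta : 'X_{1..n < N}) kF (c eta * (B (Eb eta))@_m) * E eta.

Definition linF (A : F -> F) := forall a f g, A (kF a * f + g) = kF a * A f + A g.

Lemma linF_sum A (I : Type) (r : seq I) (a : I -> K) (f : I -> F) : linF A ->
  A (\sum_(i <- r) kF (a i) * f i) = \sum_(i <- r) kF (a i) * A (f i).
Proof.
move=> hA; elim: r => [|i r IH]; last by rewrite !big_cons hA IH.
have := hA 0 0 0; rewrite !big_nil rmorph0 !mul0r addr0 add0r => h.
have := hA 1 0 0; rewrite rmorph1 !mul1r addr0 => /eqP.
by rewrite -subr_eq subrr => /eqP.
Qed.

Lemma lin_coef_bound (B : P -> P) p D m : lin B -> (msize p <= D)%N ->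
  (B p)@_m = \sum_(mu : 'X_{1..n < D}) p@_mu * (B 'X_[mu])@_m.
Proof.
move=> hB hp; rewrite {1}(mpolywE hp) (lin_sum hB) raddf_sum /=.
by apply: eq_bigr => mu _; rewrite (linZ hB) mcoeffZ.
Qed.

Lemma kernel_pair_comp e e' A B A' B' : linF A -> lin B' -> kernel_pair e A B ->
  kernel_pair e' A' B' ->
  kernel_pair (e + e')%N (A \o A') (B' \o B).
Proof.
move=> hA hB h h' N m; rewrite addnA /=.
rewrite -(linF_sum _ _ _ hA) h' (linF_sum _ _ _ hA).
pose D := maxn (\max_(eta : 'X_{1..n < (N + e)%N}) msize (Eb eta))
               (\max_(eta : 'X_{1..n < N}) msize (B (Eb eta))).
have hD1 (eta : 'X_{1..n < (N + e)%N}) : (msize (Eb eta) <= D)%N.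
  by rewrite leq_max (leq_bigmax (F := fun eta : 'X_{1..n < (N + e)%N} => msize (Eb eta))).
have hD2 (eta : 'X_{1..n < N}) : (msize (B (Eb eta)) <= D)%N.
  by rewrite leq_max (leq_bigmax (F := fun eta : 'X_{1..n < N} => msize (B (Eb eta)))) orbT.
transitivity (\sum_(mu : 'X_{1..n < D}) kF (B' 'X_[mu])@_m *
    \sum_(eta : 'X_{1..n < (N + e)%N}) kF (c eta * (Eb eta)@_mu) * A (E eta)).
  under [RHS]eq_bigr => mu _ do rewrite big_distrr /=.
  rewrite exchange_big /=; apply: eq_bigr => eta _.
  rewrite (lin_coef_bound m hB (hD1 eta)) big_distrr rmorph_sum big_distrl /=.
  apply: eq_bigr => mu _; rewrite !rmorphM; ring.
transitivity (\sum_(mu : 'X_{1..n < D}) \sum_(eta : 'X_{1..n < N})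
    kF (B' 'X_[mu])@_m * (kF (c eta * (B (Eb eta))@_mu) * E eta)).
  by apply: eq_bigr => mu _; rewrite h big_distrr.
rewrite exchange_big /=; apply: eq_bigr => eta _.
rewrite (lin_coef_bound m hB (hD2 eta)) big_distrr rmorph_sum big_distrl /=.
apply: eq_bigr => mu _; rewrite !rmorphM; ring.
Qed.

Lemma kernel_pair_ext e A B A' B' : (forall eta, A (E eta) = A' (E eta)) ->
  (forall eta, B (Eb eta) = B' (Eb eta)) -> kernel_pair e A B -> kernel_pair e A' B'.
Proof.
move=> hA hB h N m; under eq_bigr => eta _ do rewrite -hA.
by under [RHS]eq_bigr => eta _ do rewrite -hB.
Qed.

Lemma kernel_pair_id : kernel_pair 0 id id.
Proof. by move=> N m; rewrite addn0. Qed.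

Lemma kernel_pair_lc e a b A B A' B' : kernel_pair e A B -> kernel_pair e A' B' ->
  kernel_pair e (fun f => kF a * A f + kF b * A' f) (fun p => a *: B p + b *: B' p).
Proof.
move=> h h' N m.
under eq_bigr => eta _ do rewrite mulrDr !(mulrCA (kF (c _ * _))).
under [RHS]eq_bigr => eta _ do rewrite mcoeffD !mcoeffZ mulrDr !(mulrCA (c _)) rmorphD
  !(rmorphM _ _ (_ * _)) mulrDl -!mulrA.
by rewrite !big_split -!big_distrr /= h h'.
Qed.

Lemma kernel_pair_foldr (A : nat -> F -> F) (B : nat -> P -> P) (l : seq nat) :
  (forall i, i \in l -> kernel_pair 0 (A i) (B i)) -> (forall i, i \in l -> linF (A i)) ->
  (forall i, i \in l -> lin (B i)) ->
  kernel_pair 0 (fun f => foldr A f l) (fun p => foldr B p (rev l)).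
Proof.
elim: l => [|i l IH] h hA hB; first exact: kernel_pair_id.
have hl j : j \in l -> j \in i :: l by rewrite in_cons => ->; rewrite orbT.
have linl r : {subset r <= l} -> lin (fun p => foldr B p r).
  elim: r => // j r IHr hr c' p p' /=; rewrite IHr; last by move=> x hx; apply: hr;
    rewrite in_cons hx orbT.
  by rewrite hB // hl // hr // mem_head.
have hlin : lin (fun p => foldr B p (rev l)) by apply: linl => x; rewrite mem_rev.
have := kernel_pair_comp (hA i (mem_head _ _)) hlin (h i (mem_head _ _))
  (IH (fun j hj => h j (hl j hj)) (fun j hj => hA j (hl j hj)) (fun j hj => hB j (hl j hj))).
apply: kernel_pair_ext => // eta.
by rewrite rev_cons foldr_rcons.
Qed.

(* the two matrices of [A] and [B] in the bases E, Eb are transposed up to the weights c *)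
Lemma kernel_pair_swap i u v w A B : (0 < i < n)%N ->
  (forall eta, A (E eta) = kF (u eta) * E eta + kF (v eta) * E (msw i eta)) ->
  (forall eta, B (Eb eta) = u eta *: Eb eta + w eta *: Eb (msw i eta)) ->
  (forall eta, c eta * v eta = c (msw i eta) * w (msw i eta)) -> kernel_pair 0 A B.
Proof.
move=> hi hA hB hc N m; rewrite addn0.
under eq_bigr => eta _ do rewrite hA mulrDr !mulrA -!rmorphM.
under [RHS]eq_bigr => eta _ do rewrite hB mcoeffD !mcoeffZ mulrDr rmorphD mulrDl.
rewrite !big_split /=; congr (_ + _).
  by apply: eq_bigr => eta _; congr (kF _ * _); ring.
have hb (eta : 'X_{1..n < N}) : (mdeg (msw i eta) < N)%N by rewrite mdeg_msw // bmdeg.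
pose h (eta : 'X_{1..n < N}) := BMultinom (hb eta).
have hK : involutive h by move=> eta; apply: val_inj; rewrite /= mswK.
rewrite (reindex_inj (inv_inj hK)) /=; apply: eq_bigr => eta _.
have e := hc (msw i eta); rewrite mswK // in e *.
by congr (kF _ * _); rewrite mulrAC e; ring.
Qed.

Lemma kernel_pair_phi (v w : 'X_{1..n} -> K) A B : (0 < n)%N ->
  (forall eta, ev eta n = 0%N -> A (E eta) = 0) ->
  (forall eta, A (E (mphi eta)) = kF (v eta) * E eta) ->
  (forall eta, B (Eb eta) = w eta *: Eb (mphi eta)) ->
  (forall eta, c (mphi eta) * v eta = c eta * w eta) -> kernel_pair 1 A B.
Proof.
move=> n0 h0 hA hB hc N m; rewrite addn1.
have hb (eta : 'X_{1..n < N}) : (mdeg (mphi eta) < N.+1)%N by rewrite mdeg_mphi // ltnS bmdeg.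
pose h (eta : 'X_{1..n < N}) := BMultinom (hb eta).
have hinj : injective h by move=> eta nu /(congr1 val) /= /(mphi_inj n0) /val_inj.
rewrite (bigID (mem (h @: [set: 'X_{1..n < N}]))) /= [X in _ + X]big1 ?addr0; last first.
  move=> eta heta; case: (posnP (ev eta n)) => [/h0 ->|]; first by rewrite mulr0.
  move=> /(mphi_surj n0) [nu e]; case/negP: heta.
  have hnu : (mdeg nu < N)%N by have := bmdeg eta; rewrite e mdeg_mphi.
  apply/imsetP; exists (BMultinom hnu); first by rewrite inE.
  by apply/eqP; rewrite bmeqP /= e.
rewrite big_imset /=; last by move=> eta nu _ _; exact: hinj.
apply: eq_big => [eta|eta _]; first by rewrite inE.
by rewrite hA hB mcoeffZ mulrA -rmorphM; congr (kF _ * _); rewrite mulrAC hc; ring.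
Qed.
End KernelPairs.

Section TAction.
Variables (K : fieldType) (n : nat).
Variables (q t : K).
Hypothesis q0 : q != 0.
Hypothesis t0 : t != 0.
Hypothesis n0 : (0 < n)%N.
Hypothesis qt_gen : forall a b c d : nat, q ^+ a * t ^+ b = q ^+ c * t ^+ d -> a = c /\ b = d.
Notation pT := (@pT K n t).
Notation pTi := (@pTi K n t).
Let act := affine_action_F q0 n0.
Implicit Types eta nu mu : 'X_{1..n}.
Notation E := (@Emac K n q t).
Variable i : nat.
Hypothesis hi : (0 < i < n)%N.

Lemma pT_quad f : pT i (pT i f) = (t - 1) *: pT i f + t *: f.
Proof.
apply: tofrac_inj; rewrite (tofrac_pT t q0 n0 _ hi) tofracD !tofracZ (tofrac_pT t q0 n0 _ hi).
by rewrite (hT_quad act q0 t0 _ hi) rmorphB rmorph1.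
Qed.

Lemma quad_solve (V : lmodType K) (x y f : V) :
  t *: x + (t - 1) *: y = f -> x = (t^-1 - 1) *: y + t^-1 *: f.
Proof.
move=> <-; rewrite scalerDr !scalerA mulVf // scale1r addrCA -scalerDl.
have -> : t^-1 - 1 + t^-1 * (t - 1) = 0 by field.
by rewrite scale0r addr0.
Qed.

Lemma pTi_quad f : pTi i (pTi i f) = (t^-1 - 1) *: pTi i f + t^-1 *: f.
Proof.
have e : pT i (pTi i f) = f.
  apply: tofrac_inj; rewrite (tofrac_pT t q0 n0 _ hi) (tofrac_pTi t q0 n0 _ hi).
  exact: (hTKi act q0 t0).
by rewrite (pT_pTi q0 t0 n0 _ hi) in e; apply: quad_solve.
Qed.

Definition diag_coef eta := t - 1 - t * swap_coef q t eta i.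

Lemma pT_E_lt eta : (ev eta i < ev eta i.+1)%N ->
  pT i (E eta) = diag_coef eta *: E eta + t *: E (msw i eta).
Proof.
move=> h; rewrite (pT_pTi q0 t0 n0 _ hi) (E_swap q0 t0 n0 qt_gen hi h) /diag_coef.
apply/mpolyP => m; rewrite !(mcoeffD, mcoeffZ, mcoeffN); ring.
Qed.

Lemma pT_E_gt eta : (ev eta i.+1 < ev eta i)%N -> let u := diag_coef (msw i eta) in
  pT i (E eta) = (t - 1 - u) *: E eta + (1 + t^-1 * (u * (t - 1 - u))) *: E (msw i eta).
Proof.
move=> h u; have h' : (ev (msw i eta) i < ev (msw i eta) i.+1)%N.
  by rewrite !ev_msw ?swapnL ?swapnR //; lia.
have e1 := pT_E_lt h'; rewrite mswK // -/u in e1.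
have e2 := pT_quad (E (msw i eta)); rewrite {1}e1 (linD (pT_lin t q0 n0 hi)) in e2.
rewrite !(linZ (pT_lin t q0 n0 hi)) e1 in e2.
apply/mpolyP => m; have := congr1 (mcoeff m) e2; rewrite !(mcoeffD, mcoeffZ).
set x := (pT i (E eta))@_m => e3; apply: (mulfI t0);
  apply: (addrI (u * (u * (E (msw i eta))@_m + t * (E eta)@_m))).
by rewrite e3; field.
Qed.

Lemma pTi_E_gt eta : (ev eta i.+1 < ev eta i)%N -> let d := - swap_coef q t (msw i eta) i in
  pTi i (E eta) = (t^-1 - 1 - d) *: E eta + (t^-1 + d * (t^-1 - 1 - d)) *: E (msw i eta).
Proof.
move=> h d; have h' : (ev (msw i eta) i < ev (msw i eta) i.+1)%N.
  by rewrite !ev_msw ?swapnL ?swapnR //; lia.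
have e1 := E_swap q0 t0 n0 qt_gen hi h'; rewrite mswK // -scaleNr -/d in e1.
have e2 := pTi_quad (E (msw i eta)); rewrite {1}e1 (linD (pTi_lin t q0 n0 hi)) in e2.
rewrite !(linZ (pTi_lin t q0 n0 hi)) e1 in e2.
apply/mpolyP => m; have := congr1 (mcoeff m) e2; rewrite !(mcoeffD, mcoeffZ).
set x := (pTi i (E eta))@_m => e3; apply: (addIr (d * ((E eta)@_m + d * (E (msw i eta))@_m))).
by rewrite e3; ring.
Qed.
End TAction.

Section Cst.
Variables (K : fieldType) (n : nat) (q t : K).
Hypothesis q0 : q != 0.
Hypothesis t0 : t != 0.
Hypothesis n0 : (0 < n)%N.
Hypothesis qt_gen : forall a b c d : nat, q ^+ a * t ^+ b = q ^+ c * t ^+ d -> a = c /\ b = d.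
Implicit Types eta nu mu : 'X_{1..n}.
Notation evY := (@evY K n q t).

Definition kernel_coef eta := dcst q t eta / (dpcst q t eta * ecst q t eta).

Let Gd a l : K := 1 - q ^+ a.+1 * t ^+ l.+1.
Let Gp a l : K := 1 - q ^+ a.+1 * t ^+ l.
Let H j L : K := 1 - q ^+ j.-1.+1 * t ^+ (n - L).

Lemma one_sub_qt a b : 1 - q ^+ a.+1 * t ^+ b != 0.
Proof.
rewrite subr_eq0 eq_sym; apply/eqP => h.
have [] // : a.+1 = 0%N /\ b = 0%N by apply: qt_gen; rewrite h !expr0 mulr1.
Qed.

Lemma dcstE eta : dcst q t eta = nodeprodG Gd eta. Proof. by []. Qed.

Lemma dpcstE eta : dpcst q t eta = nodeprodG Gp eta. Proof. by []. Qed.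

Lemma ecstE eta :
  ecst q t eta = \prod_(1 <= i < n.+1) \prod_(1 <= j < (ev eta i).+1) H j (lp eta i).
Proof. by apply: eq_bigr => i _; apply: eq_bigr => j _; rewrite colegE. Qed.

Lemma prod_neq0 (r : seq nat) (G : nat -> K) : (forall i, G i != 0) -> \prod_(i <- r) G i != 0.
Proof.
by move=> h; apply: (big_ind (fun x => x != 0)) => [|x y|i _]; [exact: oner_neq0|exact: mulf_neq0|].
Qed.

Lemma dpcst_neq0 eta : dpcst q t eta != 0.
Proof. by do 2!apply: prod_neq0 => ?; exact: one_sub_qt. Qed.

Lemma ecst_neq0 eta : ecst q t eta != 0.
Proof. by do 2!apply: prod_neq0 => ?; exact: one_sub_qt. Qed.

Lemma lp1_le eta : (lp eta 1 <= n.-1)%N.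
Proof.
rewrite /lp big_geq // add0n.
apply: (@leq_trans (\sum_(2 <= k < n.+1) 1)%N); last by rewrite sum_nat_const_nat; lia.
by apply: leq_sum => k _; case: (_ < _)%N.
Qed.

Lemma kernel_coef_mphi eta :
  kernel_coef (mphi eta) * (1 - q ^+ (ev eta 1).+1 * t ^+ (n.-1 - lp eta 1)) = kernel_coef eta.
Proof.
rewrite /kernel_coef !dcstE !dpcstE !ecstE lprod_mphi // !nodeprodG_mphi // -!ecstE -!dpcstE.
rewrite /Gd /Gp /H /=.
have -> : ((n.-1 - lp eta 1).+1 = n - lp eta 1)%N by have := lp1_le eta; lia.
have := one_sub_qt (ev eta 1) (n - lp eta 1); have := one_sub_qt (ev eta 1) (n.-1 - lp eta 1).
have := dpcst_neq0 eta; have := ecst_neq0 eta.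
move: (1 - _) (1 - _) (dpcst _ _ _) (ecst _ _ _) => x y u v hv hu hx hy.
by field; rewrite ?hx ?hy ?hu ?hv.
Qed.

Lemma kernel_coef_msw i eta : (0 < i < n)%N -> (ev eta i < ev eta i.+1)%N ->
  let u := diag_coef q t i eta in kernel_coef eta * t =
    kernel_coef (msw i eta) * (t + u * (t - 1 - u)).
Proof.
move=> hi hlt u.
have hl := lp_msw_leg hi hlt; set l := leg _ _ _ in hl.
set X := q ^+ (ev eta i.+1 - ev eta i).
have hz : evY eta i.+1 = X * t ^+ l.+1 * evY eta i.
  rewrite /Defs.evY hl addn1 -addnS exprD invfM.
  have -> : q ^+ (ev eta i.+1) = X * q ^+ (ev eta i).
    by rewrite -exprD subnK // ltnW.
  have ht : t ^+ l.+1 != 0 by rewrite expf_neq0.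
  by move: (t ^- lp _ _) (q ^+ ev _ _) => y w; field.
have ha : (ev eta i.+1 - ev eta i = (ev eta i.+1 - (ev eta i).+1).+1)%N by lia.
have hX1 : 1 - X * t ^+ l.+1 != 0 by rewrite /X ha one_sub_qt.
have hX2 : 1 - X * t ^+ l.+2 != 0 by rewrite /X ha one_sub_qt.
have hX0 : 1 - X * t ^+ l != 0 by rewrite /X ha one_sub_qt.
have hev : evY eta i != 0 by rewrite mulf_neq0 ?invr_neq0 ?expf_neq0.
have hu : u = (t - 1) / (1 - X * t ^+ l.+1).
  rewrite /u /diag_coef /swap_coef hz.
  have h3 : X * t ^+ l.+1 - 1 != 0 by rewrite -opprB oppr_eq0.
  move: hX1 h3 hev; move: (X * t ^+ l.+1) (evY eta i) => z y h1 h3 hy.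
  have h4 : z * y - y != 0 by rewrite -{2}[y]mul1r -mulrBl mulf_neq0.
  by field; rewrite ?h1 ?h3 ?hy ?t0 ?h4.
have hd := nodeprodG_msw hi hlt Gd; have hp := nodeprodG_msw hi hlt Gp.
rewrite -!dcstE -/l /Gd -ha -/X in hd; rewrite -!dpcstE -/l /Gp -ha -/X in hp.
rewrite /kernel_coef !ecstE lprod_msw // -ecstE.
have hE := ecst_neq0 eta.
have hp1 := dpcst_neq0 eta; have hp2 := dpcst_neq0 (msw i eta).
have e2 : X * t ^+ l.+2 = t * (X * t ^+ l.+1) by rewrite [t ^+ l.+2]exprS mulrCA.
have e0 : X * t ^+ l = t^-1 * (X * t ^+ l.+1) by rewrite exprS; field.
rewrite hu; rewrite e2 in hd hX2; rewrite e0 in hp hX0.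
move: (X * t ^+ l.+1) hd hp hX0 hX1 hX2 => z hd hp hX0 hX1 hX2.
have -> : dcst q t eta = dcst q t (msw i eta) * (1 - t * z) / (1 - z) by rewrite -hd mulfK.
have -> : dpcst q t (msw i eta) = dpcst q t eta * (1 - t^-1 * z) / (1 - z) by rewrite hp mulfK.
have e3 : t - z = t * (1 - t^-1 * z) by field.
have hX0' : t - z != 0 by rewrite e3 mulf_neq0.
move: (dcst _ _ _) (dpcst _ _ _) (ecst _ _ _) hE hp1 => d d' e he hd'.
by field; rewrite ?hX0' ?hX1 ?he ?hd' ?t0.
Qed.
End Cst.

Section Inverse.
Variables (K : fieldType) (n : nat) (q t : K).
Hypothesis q0 : q != 0.
Hypothesis t0 : t != 0.
Hypothesis n0 : (0 < n)%N.
Hypothesis qt_gen : forall a b c d : nat, q ^+ a * t ^+ b = q ^+ c * t ^+ d -> a = c /\ b = d.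
Implicit Types eta nu mu : 'X_{1..n}.

Lemma qt_gen_inv a b c d : q^-1 ^+ a * t^-1 ^+ b = q^-1 ^+ c * t^-1 ^+ d -> a = c /\ b = d.
Proof.
rewrite !exprVn -!invfM => /invr_inj; exact: qt_gen.
Qed.

Lemma evY_inv eta i : evY q^-1 t^-1 eta i = (evY q t eta i)^-1.
Proof. by rewrite /evY !exprVn invfM. Qed.

Lemma swap_coef_inv i eta : (0 < i < n)%N -> ev eta i != ev eta i.+1 ->
  - swap_coef q^-1 t^-1 eta i = diag_coef q t i eta.
Proof.
move=> hi hne; rewrite /swap_coef /diag_coef /swap_coef !evY_inv invrK.
have := evY_neq t0 qt_gen hi hne; rewrite -subr_eq0.
have : evY q t eta i.+1 != 0 by rewrite mulf_neq0 ?invr_neq0 ?expf_neq0.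
have : evY q t eta i != 0 by rewrite mulf_neq0 ?invr_neq0 ?expf_neq0.
move: (evY q t eta i) (evY q t eta i.+1) => a b ha hb hab.
have hab' : a - b != 0 by rewrite -opprB oppr_eq0.
have -> : b^-1 - a^-1 = (a - b) / (a * b) by field; rewrite ha hb.
by field; rewrite ?ha ?hb ?hab ?hab' ?t0.
Qed.
End Inverse.

Section KernelIdentities.
Variables (K : fieldType) (n : nat).
Notation P := {mpoly K[n]}.
Notation F := {fraction P}.
Notation kF := (kF K n).
Notation XF := (XF K n).
Notation sF := (sF K n).
Variables (q t : K).
Hypothesis q0 : q != 0.
Hypothesis t0 : t != 0.
Hypothesis n0 : (0 < n)%N.
Hypothesis qt_gen : forall a b c d : nat, q ^+ a * t ^+ b = q ^+ c * t ^+ d -> a = c /\ b = d.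
Notation om := (WF n q0 n.-1).
Notation TF := (hT kF t XF sF).
Notation TiF := (hTi kF t XF sF).
Notation DF := (hD n kF t XF sF om).
Notation bT := (@pT K n t^-1).
Notation bTi := (@pTi K n t^-1).
Let act := affine_action_F q0 n0.
Let qi0 : q^-1 != 0. Proof. by rewrite invr_eq0. Qed.
Let ti0 : t^-1 != 0. Proof. by rewrite invr_eq0. Qed.
Let qt_geni := qt_gen_inv qt_gen.
Implicit Types eta nu mu : 'X_{1..n}.
Notation E := (@Emac K n q t).
Notation Eb := (@Emac K n q^-1 t^-1).
Notation macdonald_pair := (kernel_pair kF (kernel_coef q t) (fun eta => (E eta)%:F) Eb).

Section Swap.
Variable i : nat.
Hypothesis hi : (0 < i < n)%N.

Definition matU eta := if (ev eta i < ev eta i.+1)%N then diag_coef q t i eta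
  else if (ev eta i.+1 < ev eta i)%N then t - 1 - diag_coef q t i (msw i eta) else t.
Definition matV eta := if (ev eta i < ev eta i.+1)%N then t
  else if (ev eta i.+1 < ev eta i)%N then
    1 + t^-1 * (diag_coef q t i (msw i eta) * (t - 1 - diag_coef q t i (msw i eta))) else 0.
Definition matW eta := if (ev eta i < ev eta i.+1)%N then 1
  else if (ev eta i.+1 < ev eta i)%N then
    t + diag_coef q t i (msw i eta) * (t - 1 - diag_coef q t i (msw i eta)) else 0.

Lemma pT_E eta : pT t i (E eta) = matU eta *: E eta + matV eta *: E (msw i eta).
Proof.
rewrite /matU /matV; case: (ltngtP (ev eta i) (ev eta i.+1)) => h.
- exact: (pT_E_lt q0 t0 n0 qt_gen hi h).
- exact: (pT_E_gt q0 t0 n0 qt_gen hi h).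
- rewrite scale0r addr0 (pT_pTi q0 t0 n0 _ hi) (E_eq q0 t0 n0 qt_gen hi h).
  by rewrite scalerA mulfV // -scalerDl addrCA subrr addr0.
Qed.

Lemma pTi_Eb eta : bTi i (Eb eta) = matU eta *: Eb eta + matW eta *: Eb (msw i eta).
Proof.
rewrite /matU /matW; case: (ltngtP (ev eta i) (ev eta i.+1)) => h.
- rewrite (E_swap qi0 ti0 n0 qt_geni hi h) -scaleNr (swap_coef_inv q0 t0 qt_gen hi);
  last by rewrite neq_ltn h.
  by rewrite scale1r addrC.
- have := pTi_E_gt qi0 ti0 n0 qt_geni hi h; rewrite /= (swap_coef_inv q0 t0 qt_gen hi) ?invrK //.
  by rewrite !ev_msw ?swapnL ?swapnR ?neq_ltn ?h //; lia.
- by rewrite (E_eq qi0 ti0 n0 qt_geni hi h) invrK scale0r addr0.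
Qed.

Lemma matVW eta : kernel_coef q t eta * matV eta = kernel_coef q t (msw i eta) * matW (msw i eta).
Proof.
rewrite /matV /matW !ev_msw ?swapnL ?swapnR ?mswK //; try lia.
case: (ltngtP (ev eta i) (ev eta i.+1)) => h.
- exact: (kernel_coef_msw q0 t0 n0 qt_gen hi h).
- have h' : (ev (msw i eta) i < ev (msw i eta) i.+1)%N.
    by rewrite !ev_msw ?swapnL ?swapnR //; lia.
  have := kernel_coef_msw q0 t0 n0 qt_gen hi h'; rewrite mswK //=.
  move: (kernel_coef _ _ _) (kernel_coef _ _ _) (diag_coef _ _ _ _) => x y u e.
  by apply: (mulIf t0); rewrite mulr1 e; field.
- by rewrite !mulr0.
Qed.

Lemma TF_linF : linF kF (TF i).
Proof. by move=> a f g; rewrite hT_D (hT_Z t act). Qed.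

Lemma TiF_linF : linF kF (TiF i).
Proof. by move=> a f g; rewrite hTi_D (hTi_Z t act). Qed.

Lemma kernel_pair_T : macdonald_pair 0 (TF i) (bTi i).
Proof.
apply: (kernel_pair_swap (i := i) (u := matU) (v := matV) (w := matW)) => // [eta|eta|eta].
- by rewrite -(tofrac_pT t q0 n0 _ hi) pT_E tofracD !tofracZ.
- exact: pTi_Eb.
- exact: matVW.
Qed.

Lemma kernel_pair_Tinv : macdonald_pair 0 (TiF i) (bT i).
Proof.
apply: kernel_pair_ext (kernel_pair_lc (t^-1 - 1) t^-1 (@kernel_pair_id _ _ _ _ _ _ _)
  kernel_pair_T) => eta /=.
  by rewrite /hTi rmorphB rmorph1.
by rewrite (pT_pTi qi0 ti0 n0 _ hi) addrC.
Qed.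

Lemma bTi_Y_bTi p : bTi i (xv K n i.+1 * bTi i p) = t *: (xv K n i * p).
Proof.
have acti := affine_action_F qi0 n0.
apply: tofrac_inj; rewrite (tofrac_pTi t^-1 qi0 n0 _ hi) tofracM (tofrac_pTi t^-1 qi0 n0 _ hi).
rewrite (hTi_XS acti qi0 ti0 _ hi) (hTKi acti qi0 ti0 _ hi) invrK tofracZ tofracM.
by rewrite mulrA.
Qed.
End Swap.

Definition pPhib (p : P) : P := xv K n n * foldr bTi p (rev (iota 1 n.-1)).
Lemma tofrac_pPhib p : (pPhib p)%:F = XF n * foldr (hTi kF t^-1 XF sF) p%:F (rev (iota 1 n.-1)).
Proof.
rewrite /pPhib tofracM (tofrac_foldr (B := hTi kF t^-1 XF sF)) // => j r.
by rewrite mem_rev mem_iota => hj; apply: (tofrac_pTi t^-1 qi0 n0); lia.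
Qed.

Lemma kernel_pair_Phihat : macdonald_pair 1 (fun f => foldr TF (DF n f) (iota 1 n.-1)) pPhib.
Proof.
apply: (kernel_pair_phi (v := fun eta => (t ^+ (lp eta 1) * t ^- n.-1)^-1 *
    (1 - t ^+ n.-1 * evY q t (mphi eta) n)) (w := fun eta => t^-1 ^+ (lp eta 1) * t^-1 ^- n.-1))
      => //.
- by move=> eta h; apply: (PhihatF0 q0 t0 n0 qt_gen h).
- by move=> eta; apply: (PhihatF q0 t0 n0 qt_gen).
- move=> eta; apply: tofrac_inj; rewrite tofrac_pPhib tofracZ.
  exact: (PhiF qi0 ti0 n0 qt_geni).
move=> eta; rewrite -(kernel_coef_mphi q0 t0 n0 qt_gen eta) !exprVn -invfM [RHS]mulrAC
  -[RHS]mulrA; congr (_ * (_ * (1 - _))).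
rewrite /evY ev_mphi_n // lp_mphi_n // mulrCA; congr (_ * _).
by rewrite expfB_cond // (negPf t0) /=; exact: (lp1_le q0 t0 n0 eta).
Qed.

Lemma DF_linF i : linF kF (DF i).
Proof. by move=> a f g; apply: (hD_lin t act). Qed.

Lemma mulX_lin i : lin (fun p : P => xv K n i * p).
Proof. by move=> a p r; rewrite mulrDr scalerAr. Qed.

Lemma kernel_pair_Dn : macdonald_pair 1 (DF n) (fun p => xv K n n * p).
Proof.
have hc : macdonald_pair 0 (fun f => foldr TiF f (rev (iota 1 n.-1)))
    (fun p => foldr bT p (rev (rev (iota 1 n.-1)))).
  apply: kernel_pair_foldr => j; rewrite mem_rev mem_iota => hj.
  - by apply: kernel_pair_Tinv; lia.
  - by apply: TiF_linF.
  - by apply: (pT_lin t^-1 qi0 n0); lia.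
have hlin : linF kF (fun f => foldr TiF f (rev (iota 1 n.-1))).
  move=> a f g; rewrite foldr_add; last by move=> j x y; rewrite hTi_D.
  by rewrite foldr_Z // => j b x; apply: (hTi_Z t act).
have hlin' : lin pPhib.
  have h r : {subset r <= rev (iota 1 n.-1)} -> lin (fun p => foldr bTi p r).
    elim: r => // j r IHr hr a p p' /=.
    rewrite IHr; last by move=> x hx; apply: hr; rewrite in_cons hx orbT.
    have := hr j (mem_head _ _); rewrite mem_rev mem_iota => hj.
    by rewrite (pTi_lin t^-1 qi0 n0) //; lia.
  by move=> a p r; rewrite /pPhib h // mulrDr scalerAr.
have := kernel_pair_comp hlin hlin' hc kernel_pair_Phihat; apply: kernel_pair_ext => eta /=.
  rewrite foldr_revK // => j f; rewrite mem_iota => hj.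
  by apply: (hTiK act q0 t0); lia.
have acti := affine_action_F qi0 n0.
rewrite revK /pPhib foldr_revK // => j p; rewrite mem_iota => hj.
have hj' : (0 < j < n)%N by lia.
apply: tofrac_inj; rewrite (tofrac_pTi t^-1 qi0 n0 _ hj') (tofrac_pT t^-1 qi0 n0 _ hj').
exact: (hTiK acti qi0 ti0).
Qed.

Lemma kernel_pair_D i : (0 < i <= n)%N -> macdonald_pair 1 (DF i) (fun p => xv K n i * p).
Proof.
move=> /andP[hi0]; have [d] := ubnP (n - i)%N; elim: d => // d IH in i hi0 *.
move=> hd hin; case: (ltngtP i n) => [hlt||->]; [|lia|exact: kernel_pair_Dn].
have hi : (0 < i < n)%N by rewrite hi0 hlt.
have hD : macdonald_pair 1 (DF i.+1) (fun p => xv K n i.+1 * p) by apply: IH => //; lia.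
have hlin : lin (bTi i) by exact: (pTi_lin t^-1 qi0 n0 hi).
have h1 := kernel_pair_comp (@DF_linF i.+1) hlin hD (kernel_pair_T hi).
have hlin2 : lin (bTi i \o (fun p => xv K n i.+1 * p)).
  by move=> a p r; rewrite /= (mulX_lin i.+1) hlin.
have h2 := kernel_pair_comp (@TF_linF i) hlin2 (kernel_pair_T hi) h1.
have h3 := kernel_pair_lc t^-1 0 h2 h2.
apply: kernel_pair_ext h3 => eta /=.
  by rewrite rmorph0 mul0r addr0 -(hD_rec act q0 t0 _ hi).
by rewrite scale0r addr0 (bTi_Y_bTi hi) scalerA mulVf // scale1r.
Qed.
End KernelIdentities.

Section SeriesOfKernelPairs.
Variables (K : fieldType) (n : nat).
Notation P := {mpoly K[n]}.
Notation F := {fraction P}.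
Notation laur := (laur K n).
Notation kF := (kF K n).
Implicit Types (f g : laur) (z : n.-tuple int).

Lemma lcoefD f g z : lcoef (ladd f g) z = lcoef f z + lcoef g z.
Proof.
case: f g => [k p] [k' p'].
rewrite -(lcoef_shift k k' p) -(lcoef_shift k' k p') [(k' + k)%N]addnC /lcoef /=.
by case: ifP => _; rewrite ?mcoeffD ?addr0.
Qed.

Lemma lcoefZ c f z : lcoef (lscale c f) z = c * lcoef f z.
Proof. by rewrite /lcoef /=; case: ifP => _; rewrite ?mcoeffZ ?mulr0. Qed.

Lemma lcoef0 z : lcoef (@lpoly K n 0) z = 0.
Proof. by rewrite /lcoef /=; case: ifP => _; rewrite ?mcoeff0. Qed.

Definition absm z : 'X_{1..n} := [multinom absz (tnth z j) | j < n].
Lemma lcoef_lpoly (p : P) z :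
  lcoef (lpoly p) z = if [forall j, 0 <= tnth z j] then p@_(absm z) else 0.
Proof.
rewrite /lcoef /=; under eq_forallb => j do rewrite addr0.
by case: ifP => // _; congr _@_ _; apply/mnmP => j; rewrite !mnmE addr0.
Qed.

Definition lsum (I : Type) (r : seq I) (a : I -> K) (f : I -> laur) : laur :=
  foldr (@ladd K n) (lpoly 0) [seq lscale (a i) (f i) | i <- r].
Lemma lval_lsum (I : Type) (r : seq I) a (f : I -> laur) :
  lval (lsum r a f) = \sum_(i <- r) kF (a i) * lval (f i).
Proof.
elim: r => [|i r IH]; first by rewrite big_nil lval_lpoly tofrac0.
by rewrite big_cons /lsum /= lval_add lval_scale -IH.
Qed.

Lemma lcoef_lsum (I : Type) (r : seq I) a (f : I -> laur) z :
  lcoef (lsum r a f) z = \sum_(i <- r) a i * lcoef (f i) z.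
Proof.
elim: r => [|i r IH]; first by rewrite big_nil lcoef0.
by rewrite big_cons /lsum /= lcoefD lcoefZ -IH.
Qed.

Lemma ssum_cover (G : Defs.family K n) (m : monom2 n) s : uniq s -> covers G m s ->
  ssum G m = \sum_(eta <- s) G eta m.
Proof.
move=> us hs; rewrite /ssum; have : covers G m (pick0 [::] (covers G m)).
  by apply: pick0P; exists s.
move: (pick0 _ _) => s' hs'.
have rest r : \sum_(eta <- r) G eta m = \sum_(eta <- [seq eta <- r | G eta m != 0]) G eta m.
  rewrite big_filter [LHS](bigID (fun eta => G eta m != 0)) /= [X in _ + X]big1 ?addr0 //.
  by move=> eta /negPn/eqP.
rewrite rest [RHS]rest; apply: perm_big; apply: uniq_perm; rewrite ?filter_uniq ?undup_uniq //.
move=> eta; rewrite !mem_filter mem_undup; case h: (G eta m != 0) => //=.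
by rewrite hs ?hs'.
Qed.

Definition bmons N : seq 'X_{1..n} := [seq val eta | eta : 'X_{1..n < N}].
Lemma uniq_bmons N : uniq (bmons N).
Proof. by rewrite /bmons map_inj_uniq ?enum_uniq //; exact: val_inj. Qed.

Lemma mem_bmons N eta : (mdeg eta < N)%N -> eta \in bmons N.
Proof. by move=> h; apply/mapP; exists (BMultinom h); rewrite ?mem_enum. Qed.

Lemma big_bmons (V : nmodType) N (G : 'X_{1..n} -> V) :
  \sum_(eta <- bmons N) G eta = \sum_(eta : 'X_{1..n < N}) G eta.
Proof. by rewrite big_image. Qed.

Lemma series_eq_kernel_pair (c : 'X_{1..n} -> K) (E Eb : 'X_{1..n} -> P) e A B (LA LB : laur ->
  laur) :
  (forall eta, is_homogeneous (mdeg eta) (E eta)) ->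
    (forall eta, is_homogeneous (mdeg eta) (Eb eta)) ->
  kernel_pair kF c (fun eta => (E eta)%:F) Eb e A B ->
  (forall eta, lval (LA (lpoly (E eta))) = A (E eta)%:F) ->
  (forall eta, lval (LB (lpoly (Eb eta))) = (B (Eb eta))%:F) ->
  series_eq (fun eta m => c eta * lcoef (LA (lpoly (E eta))) m.1 * lcoef (lpoly (Eb eta)) m.2)
            (fun eta m => c eta * lcoef (lpoly (E eta)) m.1 * lcoef (LB (lpoly (Eb eta))) m.2).
Proof.
move=> hE hEb hKP hA hB.
have hLB eta (z : n.-tuple int) : lcoef (LB (lpoly (Eb eta))) z = lcoef (lpoly (B (Eb eta))) z.
  by apply: leqL_lval; rewrite hB lval_lpoly.
have hom (p : P) d (z : n.-tuple int) : is_homogeneous d p -> lcoef (lpoly p) z != 0 ->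
  mdeg (absm z) = d.
  by move=> hp; rewrite lcoef_lpoly; case: ifP => _; [exact: (hp (absm z))|rewrite eqxx].
pose N (m : monom2 n) := (mdeg (absm m.1) + mdeg (absm m.2)).+1.
set G := fun eta m => _; set G' := fun eta m => _.
have cov m : covers G m (bmons (N m + e)).
  move=> eta; rewrite /G mulf_eq0 negb_or => /andP[_ /(hom _ _ _ (hEb eta)) h].
  by apply: mem_bmons; rewrite -h /N; lia.
have cov' m : covers G' m (bmons (N m)).
  move=> eta; rewrite /G' !mulf_eq0 !negb_or => /andP[/andP[_ /(hom _ _ _ (hE eta)) h] _].
  by apply: mem_bmons; rewrite -h /N; lia.
split; first by move=> m; exists (bmons (N m + e)); exact: cov.
split=> [m|m]; first by exists (bmons (N m)); exact: cov'.
rewrite (ssum_cover (uniq_bmons _) (cov m)) (ssum_cover (uniq_bmons _) (cov' m)).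
rewrite /G /G' /=; under [RHS]eq_bigr => eta _ do rewrite hLB (lcoef_lpoly _ m.2).
under [LHS]eq_bigr => eta _ do rewrite (lcoef_lpoly _ m.2).
case: [forall j, _]; last by rewrite !big1 // => eta _; rewrite mulr0.
have h : leqL (lsum (bmons (N m + e)) (fun eta => c eta * (Eb eta)@_(absm m.2))
    (fun eta => LA (lpoly (E eta))))
   (lsum (bmons (N m)) (fun eta => c eta * (B (Eb eta))@_(absm m.2)) (fun eta => lpoly (E eta))).
  apply: leqL_lval; rewrite !lval_lsum !big_bmons.
  under eq_bigr => eta _ do rewrite hA.
  under [RHS]eq_bigr => eta _ do rewrite lval_lpoly.
  exact: hKP.
have := h m.1; rewrite !lcoef_lsum.
under eq_bigr => eta _ do rewrite mulrAC.
by move=> ->; apply: eq_bigr => eta _; rewrite mulrAC.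
Qed.
End SeriesOfKernelPairs.

Lemma qq_neq0 : qq != 0.
Proof. by rewrite tofrac_eq0 polyC_eq0 polyX_eq0. Qed.

Lemma tt_neq0 : tt != 0.
Proof. by rewrite tofrac_eq0 polyX_eq0. Qed.

Lemma qt_generic a b c d : qq ^+ a * tt ^+ b = qq ^+ c * tt ^+ d -> a = c /\ b = d.
Proof.
rewrite /qq /tt -!rmorphXn -!rmorphM => /eqP.
rewrite tofrac_eq => /eqP /= e.
have hb x y z : (('X^x : {poly rat})%:P * 'X^y)`_z = if z == y then 'X^x else 0.
  by rewrite coefCM coefXn; case: eqP; rewrite ?mulr1 ?mulr0.
have hbd : b = d.
  move: (congr1 (fun p : {poly {poly rat}} => p`_b) e); rewrite !hb eqxx.
  by case: eqP => // _ /eqP; rewrite expf_eq0 polyX_eq0 andbF.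
move: (congr1 (fun p : {poly {poly rat}} => p`_b) e); rewrite !hb hbd eqxx.
by move/(congr1 (fun p : {poly rat} => size p)); rewrite !size_polyXn => -[].
Qed.

Section GenericField.
Variables (K : fieldType) (n : nat) (q t : K).
Hypothesis q0 : q != 0.
Hypothesis t0 : t != 0.
Hypothesis hn : (0 < n)%N.
Hypothesis gen : forall a b c d : nat, q ^+ a * t ^+ b = q ^+ c * t ^+ d -> a = c /\ b = d.
Let qi0 : q^-1 != 0. Proof. by rewrite invr_eq0. Qed.
Let ti0 : t^-1 != 0. Proof. by rewrite invr_eq0. Qed.

Definition kernel_terms (A B : laur K n -> laur K n) : Defs.family K n := fun eta m =>
  kernel_coef q t eta * lcoef (A (lpoly (Emac q t eta))) m.1
    * lcoef (B (lpoly (Emac q^-1 t^-1 eta))) m.2.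

Lemma kernel_terms_eq :
  (forall i : nat, (1 <= i <= n.-1)%N ->
     series_eq (kernel_terms (lT t i) id) (kernel_terms id (lTinv t^-1 i)) /\
     series_eq (kernel_terms (lTinv t i) id) (kernel_terms id (lT t^-1 i))) /\
  series_eq (kernel_terms (lPhihat q t) id) (kernel_terms id (lPhi t^-1)) /\
  (forall i : nat, (1 <= i <= n)%N ->
     series_eq (kernel_terms (lD q t i) id) (kernel_terms id (lmulX i))).
Proof.
have hE eta : is_homogeneous (mdeg eta) (@Emac K n q t eta).
  by have [] := Emac_nsmac q0 t0 hn gen eta.
have hEb eta : is_homogeneous (mdeg eta) (@Emac K n q^-1 t^-1 eta).
  by have [] := Emac_nsmac qi0 ti0 hn (qt_gen_inv gen) eta.
split=> [i hi|]; [split|split=> [|i hi]].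
- have hi' : (0 < i < n)%N by lia.
  apply: (series_eq_kernel_pair hE hEb (kernel_pair_T q0 t0 hn gen hi')) => eta.
    by rewrite (lval_lT t q0 hn _ hi') lval_lpoly.
  by rewrite (lval_lTinv t^-1 qi0 hn _ hi') lval_lpoly (tofrac_pTi t^-1 qi0 hn _ hi').
- have hi' : (0 < i < n)%N by lia.
  apply: (series_eq_kernel_pair hE hEb (kernel_pair_Tinv q0 t0 hn gen hi')) => eta.
    by rewrite (lval_lTinv t q0 hn _ hi') lval_lpoly.
  by rewrite (lval_lT t^-1 qi0 hn _ hi') lval_lpoly (tofrac_pT t^-1 qi0 hn _ hi').
- apply: (series_eq_kernel_pair hE hEb (kernel_pair_Phihat q0 t0 hn gen)) => eta.
    by rewrite (lval_lPhihat t q0 hn) lval_lpoly.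
  by rewrite (lval_lPhi t^-1 qi0 hn) lval_lpoly (tofrac_pPhib q0 t0 hn).
- apply: (series_eq_kernel_pair hE hEb (kernel_pair_D q0 t0 hn gen hi)) => eta.
    by rewrite (lval_lD t q0 hn _ hi) lval_lpoly.
  by rewrite lval_lmulX lval_lpoly tofracM.
Qed.
End GenericField.

(* K_A(x;y;q,t) = sum_eta d_eta/(d'_eta e_eta) E_eta(x;q,t) E_eta(y;q^-1,t^-1);
   A^{(x)} B^{(y)} K_A is the termwise series KAterms A B (see Defs.v);
   operators with parameters (qq^-1, tt^-1) are the barred operators. *)
Theorem theorem5p2 (n : nat) (hn : (1 <= n)%N) :
  (forall i : nat, (1 <= i <= n.-1)%N ->
     series_eq (@KAterms n (lT tt i) id) (@KAterms n id (lTinv tt^-1 i)) /\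
     series_eq (@KAterms n (lTinv tt i) id) (@KAterms n id (lT tt^-1 i))) /\
  series_eq (@KAterms n (lPhihat qq tt) id) (@KAterms n id (lPhi tt^-1)) /\
  (forall i : nat, (1 <= i <= n)%N ->
     series_eq (@KAterms n (lD qq tt i) id) (@KAterms n id (lmulX i))).
Proof. exact: (kernel_terms_eq qq_neq0 tt_neq0 hn qt_generic). Qed.
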